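(* Let $(M,L)$ be a pseudo-Finsler manifold with $L$ defined on the conic open set $A\subset TM\setminus\{0\}$, and let $S\subset M$ be a non-degenerate submanifold. For $v\in A\cap TS$, $u,w,z,b\in T_{\pi(v)}S$ and $n\in(T_{\pi(v)}S)^{\bot_{g_v}}$, (Gauss equation) $$\begin{aligned} g_v(\widetilde R_v(u,w)z,b)=\;&g_v(R_v(u,w)z,b)-g_v(\mathrm{I\!I}_v(w,z),\mathrm{I\!I}_v(u,b))+g_v(\mathrm{I\!I}_v(u,z),\mathrm{I\!I}_v(w,b))\\ &-2C_v(\mathrm{I\!I}_v(u,v),\mathrm{I\!I}_v(w,z),b)+2C_v(\mathrm{I\!I}_v(w,v),\mathrm{I\!I}_v(u,z),b)\\ &+g_v(\widetilde P_v(u,z,\mathrm{I\!I}_v(w,v))-\widetilde P_v(w,z,\mathrm{I\!I}_v(u,v)),b)\\ &+g_v(P_v(u,z,Q_v(w,v))-P_v(w,z,Q_v(u,v)),b)\\ &+g_v((\nabla_uQ)_v(w,z)-(\nabla_wQ)_v(u,z),b)\\ &+g_v((\partial^\nu Q)_v(u,z,Q_v(w,v))-(\partial^\nu Q)_v(w,z,Q_v(u,v)),b)\\ &+g_v(Q_v(u,Q_v(w,z))-Q_v(w,Q_v(u,z)),b), \end{aligned}$$ and (Codazzi equation) $$\begin{aligned} g_v(\widetilde R_v(u,w)z,n)=\;&g_v((\nabla_u\mathrm{I\!I})_v(w,z),n)-g_v((\nabla_w\mathrm{I\!I})_v(u,z),n)\\ &+g_v(\mathrm{I\!I}_v(u,Q_v(w,z)),n)-g_v(\mathrm{I\!I}_v(w,Q_v(u,z)),n)\\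 &+g_v((\partial^\nu\mathrm{I\!I})_v(w,z,\mathrm{I\!I}_v(u,v)),n)-g_v((\partial^\nu\mathrm{I\!I})_v(u,z,\mathrm{I\!I}_v(w,v)),n)\\ &+g_v(\widetilde P_v(u,z,\mathrm{I\!I}_v(w,v)),n)-g_v(\widetilde P_v(w,z,\mathrm{I\!I}_v(u,v)),n). \end{aligned}$$
   Context: Pseudo-Finsler metric: $M$ is a smooth manifold, $\pi:TM\to M$, $A\subset TM\setminus\{0\}$ is open and conic ($\lambda v\in A$ for $v\in A$, $\lambda>0$), and $L:A\to\mathbb R$ is smooth with $L(\lambda v)=\lambda^2L(v)$ for $\lambda>0$ and with non-degenerate fundamental tensor $g_v(u,w)=\frac12\frac{\partial^2}{\partial s\partial t}L(v+su+tw)|_{s=t=0}$. Cartan tensor: $C_v(u,w,z)=\frac12\frac{\partial}{\partial t}g_{v+tz}(u,w)|_{t=0}$. Anisotropic connection: a map $(v,X,Y)\mapsto\nabla^v_XY\in T_{\pi(v)}M$, smooth in $v\in A$, which for each $v$ is additive in $X,Y$, function-linear in $X$ and satisfies the Leibniz rule $\nabla^v_X(fY)=X(f)Y|_{\pi(v)}+f(\pi(v))\nabla^v_XY$. For a local vector field $V$ with values in $A$ ($A$-admissible), $(\nabla^V_XY)_p=\nabla^{V_p}_XY$ is an affine connection. The Levi-Civita-Chern connection of $L$ is the unique anisotropic connection that is torsion-free ($\nabla^v_XY-\nabla^v_YX=[X,Y]$) and satisfies $X(g_V(Y,Z))=g_V(\nabla^V_XY,Z)+g_V(Y,\nabla^V_XZ)+2C_V(\nabla^V_XV,Y,Z)$.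 Its vertical derivative is $P_v(X,Y,Z)=\frac{\partial}{\partial t}\nabla^{v+tZ}_XY|_{t=0}$, and its curvature tensor is $R_v(X,Y)Z=R^V(X,Y)Z|_{\pi(v)}-P_v(Y,Z,\nabla^V_XV)+P_v(X,Z,\nabla^V_YV)$, with $V$ any $A$-admissible local extension of $v$ and $R^V(X,Y)Z=\nabla^V_X\nabla^V_YZ-\nabla^V_Y\nabla^V_XZ-\nabla^V_{[X,Y]}Z$ (independent of $V$). Submanifold: $S$ is non-degenerate if $g_v$ restricted to $T_{\pi(v)}S$ is non-degenerate for every $v\in A\cap TS$; then $L|_S:=L|_{A\cap TS}$ is a pseudo-Finsler metric on $S$. $\widetilde\nabla,\widetilde R,\widetilde P$ are the Levi-Civita-Chern connection of $(M,L)$, its curvature and vertical derivative; $\nabla,R,P$ are those of $(S,L|_S)$. $\top_{g_v},\bot_{g_v}$ denote the components of a vector in the decomposition $T_{\pi(v)}M=T_{\pi(v)}S\oplus(T_{\pi(v)}S)^{\bot_{g_v}}$. For $X,Y$ vector fields on $S$, $\widetilde\nabla^v_XY$ is computed with any extensions and $\widetilde\nabla^v_XY=\widehat\nabla^v_XY+\mathrm{I\!I}_v(X,Y)$, with $\widehat\nabla^v_XY$ tangent to $S$ and $\mathrm{I\!I}_v(X,Y)$ $g_v$-orthogonal to $S$ (the latter also makes sense for $v\in A$ over $S$, not tangent to $S$, near $A\cap TS$). $Q_v(X,Y)=\widehat\nabla^v_XY-\nabla^v_XY$ for $v\in A\cap TS$. Derivatives: $(\partial^\nu Q)_v(u,w,z)=\frac{\partial}{\partial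 t}Q_{v+tz}(u,w)|_{t=0}$ for $u,w,z\in T_{\pi(v)}S$; $(\partial^\nu\mathrm{I\!I})_v(u,w,y)=\frac{\partial}{\partial t}\mathrm{I\!I}_{v+ty}(u,w)|_{t=0}$ for $u,w\in T_{\pi(v)}S$, $y\in T_{\pi(v)}M$. For $V$ any $A$-admissible extension of $v$ tangent to $S$ and $X,Y,Z$ vector fields on $S$, $(\nabla_XQ)_V(Y,Z)=\nabla^V_X(Q_V(Y,Z))-(\partial^\nu Q)_V(Y,Z,\nabla^V_XV)-Q_V(\nabla^V_XY,Z)-Q_V(Y,\nabla^V_XZ)$. Finally $(\nabla_X\mathrm{I\!I})_v(Y,Z)=(\widetilde\nabla^v_X(\mathrm{I\!I}(Y,Z)))^{\bot_{g_v}}-\mathrm{I\!I}_v(\nabla^v_XY,Z)-\mathrm{I\!I}_v(Y,\nabla^v_XZ)$, where $\widetilde\nabla^v_X(\mathrm{I\!I}(Y,Z))=\widetilde\nabla^v_X(\mathrm{I\!I}_V(Y,Z))-(\partial^\nu\mathrm{I\!I})_v(Y,Z,\widetilde\nabla^v_XV)$ with $V$ an $A$-admissible extension of $v$. These are tensorial and independent of the extensions. *)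

(* Defs.v *)
From HB Require Import structures.
From mathcomp Require Import all_boot all_order all_algebra.
From mathcomp Require Import all_classical all_reals all_analysis.
Set Implicit Arguments.
Unset Strict Implicit.
Unset Printing Implicit Defensive.
Import Order.TTheory GRing.Theory Num.Theory.
Import numFieldNormedType.Exports.
Local Open Scope classical_set_scope.
Local Open Scope ring_scope.

(* The value of an expression "computed with any extension", [E] being the set
   of the values it takes over all extensions (a singleton whenever the
   expression does not depend on the extension). *)
Definition any_of (R : realType) n (E : set 'rV[R]_n) : 'rV[R]_n := xget 0 E.

Section smooth_on.
Context {R : realType} {E F : normedModType R}.
Implicit Types (U : set E) (f : E -> F).

(* [E] is always finite dimensional and [U] open below; the directional
   derivatives ['D_v f] then carry the same information as the total
   derivative, so that [Ck_on k U f] says that [f] is of class C^k on [U]. *)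
Fixpoint Ck_on (k : nat) U f : Prop :=
  match k with
  | 0 => forall x, U x -> {for x, continuous f}
  | k'.+1 => (forall x, U x -> differentiable f x) /\
             (forall v : E, Ck_on k' U ('D_v f))
  end.

Definition smooth_on U f : Prop := forall k, Ck_on k U f.

End smooth_on.

Section charts.
Context {R : realType} {n : nat} {M : topologicalType}.

(* [cmap] and [cinv] are total functions: only their values on [cdom] and on
   [cimg] are meaningful. *)
Record chart := Chart {
  cdom : set M;
  cmap : M -> 'rV[R]_n;
  cinv : 'rV[R]_n -> M;
  cdom_open : open cdom;
  cimg_open : open (cmap @` cdom);
  cmapK : forall q, cdom q -> cinv (cmap q) = q;
  cmap_continuous : forall q, cdom q -> {for q, continuous cmap};
  cinv_continuous : forall x, (cmap @` cdom) x -> {for x, continuous cinv}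
}.

Definition cimg (c : chart) (U : set M) : set 'rV[R]_n :=
  cmap c @` (cdom c `&` U).

Definition compatible (c d : chart) : Prop :=
  smooth_on (cimg c (cdom d)) (cmap d \o cinv c) /\
  smooth_on (cimg d (cdom c)) (cmap c \o cinv d).

End charts.
Arguments chart : clear implicits.

(* Smooth n-manifold: an atlas in which a preferred chart has been selected
   around each point.  The maximal atlas consists of the charts compatible with
   all the [chart_at q]. *)
Record manifold (R : realType) (n : nat) := Manifold {
  point :> topologicalType;
  chart_at : point -> chart R n point;
  chart_at_dom : forall q, cdom (chart_at q) q;
  chart_at_compatible : forall q r, compatible (chart_at q) (chart_at r);
  manifold_hausdorff : hausdorff_space point;
  manifold_second_countable : @second_countable point
}.

(* The tangent space T_q M is 'rV[R]_n, a tangent vector at [q] being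
   represented by its components in the preferred chart [chart_at q]; the
   components in an arbitrary chart are given by [tcoord], and vector fields are
   functions [M -> 'rV[R]_n].  A function of v in TM is written as a function of
   the base point and of the vector, and a subset of TM as a family of subsets
   of the tangent spaces. *)
Section tangent.
Context {R : realType} {n : nat} (M : manifold R n).
Implicit Types (c : chart R n M) (q : M) (U : set M).

Definition vfield := M -> 'rV[R]_n.

Definition tcoord c q (v : 'rV[R]_n) : 'rV[R]_n :=
  'D_v (cmap c \o cinv (chart_at q)) (cmap (chart_at q) q).

(* The tangent vector at [cinv c x] whose components in [c] are [y]. *)
Definition tvec c (x y : 'rV[R]_n) : 'rV[R]_n :=
  'D_y (cmap (chart_at (cinv c x)) \o cinv c) x.

(* Image of [A `&` TU] under the chart of TM induced by [c]. *)
Definition timg c U (A : M -> set 'rV[R]_n) : set ('rV[R]_n * 'rV[R]_n) :=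
  [set xy | cimg c U xy.1 /\ A (cinv c xy.1) (tvec c xy.1 xy.2)].

Definition in_maximal_atlas c : Prop := forall q, compatible c (chart_at q).

Definition smooth_fun_on U (f : M -> R) : Prop :=
  forall a : M, let c := chart_at a in smooth_on (cimg c U) (f \o cinv c).

(* Components of a field in the chart [chart_at q], as a function of the
   coordinates. *)
Definition field_coord q (X : vfield) (x : 'rV[R]_n) : 'rV[R]_n :=
  let c := chart_at q in tcoord c (cinv c x) (X (cinv c x)).

Definition smooth_field_on U (X : vfield) : Prop :=
  forall a : M, smooth_on (cimg (chart_at a) U) (field_coord a X).

Definition smooth_fun_near q (f : M -> R) : Prop :=
  exists2 U, open_nbhs q U & smooth_fun_on U f.

Definition smooth_near q (X : vfield) : Prop :=
  exists2 U, open_nbhs q U & smooth_field_on U X.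

Definition extension q (x : 'rV[R]_n) (X : vfield) : Prop :=
  smooth_near q X /\ X q = x.

Definition dir_deriv q (v : 'rV[R]_n) (f : M -> R) : R :=
  'D_v (f \o cinv (chart_at q)) (cmap (chart_at q) q).

(* [X, Y] = sum_ij (X^i d_i Y^j - Y^i d_i X^j) d_j in the preferred chart. *)
Definition bracket (X Y : vfield) : vfield := fun q =>
  let x := cmap (chart_at q) q in
  'D_(X q) (field_coord q Y) x - 'D_(Y q) (field_coord q X) x.

End tangent.

Section pseudo_finsler.
Context {R : realType} {n : nat} {M : manifold R n}.
Variables (A : M -> set 'rV[R]_n) (L : M -> 'rV[R]_n -> R).
Implicit Types (q : M) (v u w z : 'rV[R]_n).

Definition fundamental q v u w : R := 2^-1 * 'D_u (fun y => 'D_w (L q) y) v.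

Definition cartan q v u w z : R :=
  2^-1 * 'D_z (fun y => fundamental q y u w) v.

Record pseudo_finsler_metric : Prop := {
  pf_nonzero : forall q v, A q v -> v != 0;
  pf_open : forall a : M, open (timg (chart_at a) setT A);
  pf_conic : forall q v (lambda : R), A q v -> 0 < lambda ->
    A q (lambda *: v);
  pf_smooth : forall a : M, let c := chart_at a in
    smooth_on (timg c setT A)
      (fun xy => L (cinv c xy.1) (tvec c xy.1 xy.2));
  pf_homogeneous : forall q v (lambda : R), A q v -> 0 < lambda ->
    L q (lambda *: v) = lambda ^+ 2 * L q v;
  pf_nondegenerate : forall q v, A q v ->
    forall u, (forall w, fundamental q v u w = 0) -> u = 0
}.

(* Local vector field defined around [q], with values in [A]. *)
Definition admissible_near q (V : vfield M) : Prop :=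
  smooth_near q V /\ \forall r \near q, A r (V r).

Definition admissible_extension q v (V : vfield M) : Prop :=
  admissible_near q V /\ V q = v.

(* [nabla q v X Y] is the vector nabla^v_X Y of T_q M, for v in T_q M.  The
   fields only need to be smooth near [q]; since the Leibniz rule below is also
   required for functions that are only smooth near [q], the value depends only
   on the germs of X and Y at [q]. *)
Definition connection_op := M -> 'rV[R]_n -> vfield M -> vfield M -> 'rV[R]_n.

Variable nabla : connection_op.

Record anisotropic_connection : Prop := {
  ac_addl : forall q v X X' Y, A q v ->
    smooth_near q X -> smooth_near q X' -> smooth_near q Y ->
    nabla q v (fun r => X r + X' r) Y = nabla q v X Y + nabla q v X' Y;
  ac_addr : forall q v X Y Y', A q v ->
    smooth_near q X -> smooth_near q Y -> smooth_near q Y' ->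
    nabla q v X (fun r => Y r + Y' r) = nabla q v X Y + nabla q v X Y';
  ac_linear : forall q v (f : M -> R) X Y, A q v ->
    smooth_fun_near q f -> smooth_near q X -> smooth_near q Y ->
    nabla q v (fun r => f r *: X r) Y = f q *: nabla q v X Y;
  ac_leibniz : forall q v (f : M -> R) X Y, A q v ->
    smooth_fun_near q f -> smooth_near q X -> smooth_near q Y ->
    nabla q v X (fun r => f r *: Y r) =
      dir_deriv q (X q) f *: Y q + f q *: nabla q v X Y;
  ac_smooth : forall (U : set M) X Y, open U ->
    smooth_field_on U X -> smooth_field_on U Y ->
    forall a : M, let c := chart_at a in
    smooth_on (timg c U A)
      (fun xy => let q := cinv c xy.1 in
                 tcoord c q (nabla q (tvec c xy.1 xy.2) X Y))
}.

(* The field nabla^V_X Y. *)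
Definition along (V X Y : vfield M) : vfield M := fun q => nabla q (V q) X Y.

Record levi_civita_chern : Prop := {
  lcc_connection : anisotropic_connection;
  lcc_torsion_free : forall q v X Y, A q v ->
    smooth_near q X -> smooth_near q Y ->
    nabla q v X Y - nabla q v Y X = bracket X Y q;
  lcc_metric : forall q V X Y Z, admissible_near q V ->
    smooth_near q X -> smooth_near q Y -> smooth_near q Z ->
    dir_deriv q (X q) (fun r => fundamental r (V r) (Y r) (Z r)) =
      fundamental q (V q) (along V X Y q) (Z q)
      + fundamental q (V q) (Y q) (along V X Z q)
      + 2 * cartan q (V q) (along V X V q) (Y q) (Z q)
}.

(* P_v(x, y, z) *)
Definition vertical_deriv q v (x y z : 'rV[R]_n) : 'rV[R]_n :=
  any_of [set e | exists X Y, [/\ extension q x X, extension q y Y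
                                & e = 'D_z (fun v' => nabla q v' X Y) v]].

(* The field R^V(X, Y) Z. *)
Definition affine_curvature (V X Y Z : vfield M) : vfield M := fun q =>
  along V X (along V Y Z) q - along V Y (along V X Z) q
  - along V (bracket X Y) Z q.

(* R_v(x, y) z *)
Definition curvature q v (x y z : 'rV[R]_n) : 'rV[R]_n :=
  any_of [set e | exists V X Y Z,
    [/\ admissible_extension q v V, extension q x X, extension q y Y,
        extension q z Z
      & e = affine_curvature V X Y Z q
            - vertical_deriv q v y z (along V X V q)
            + vertical_deriv q v x z (along V Y V q)]].

End pseudo_finsler.

(* A submanifold S of M is given by its inclusion [i : S -> M], where S carries
   its own manifold structure; T_p S is sent into T_(i p) M by [tmap i p]. *)
Section submanifold.
Context {R : realType} {k l : nat} {S : manifold R k} {M : manifold R (k + l)}.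
Variable i : S -> M.

(* Slice charts: [i @` S] is locally {x | x_k = ... = x_(k+l-1) = 0} and the
   first k coordinates are a chart of S; [cdom d = i @^-1` cdom c] makes the
   topology of S the subspace topology. *)
Definition submanifold : Prop :=
  injective i /\
  forall p : S, exists (d : chart R k S) (c : chart R (k + l) M),
    [/\ in_maximal_atlas d, in_maximal_atlas c, cdom d p,
        cdom d = i @^-1` cdom c
      & forall q, cdom d q -> cmap c (i q) = row_mx (cmap d q) 0].

Definition tmap (p : S) (u : 'rV[R]_k) : 'rV[R]_(k + l) :=
  'D_u (cmap (chart_at (i p)) \o i \o cinv (chart_at p)) (cmap (chart_at p) p).

Variables (A : M -> set 'rV[R]_(k + l)) (L : M -> 'rV[R]_(k + l) -> R).
Implicit Types (p : S) (X Y Z : vfield S).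

(* A :&: TS and L|_S *)
Definition sub_cone p : set 'rV[R]_k := tmap p @^-1` A (i p).
Definition sub_metric p (v : 'rV[R]_k) : R := L (i p) (tmap p v).

Definition nondegenerate_submanifold : Prop :=
  forall p v, sub_cone p v ->
  forall u, (forall w, fundamental L (i p) (tmap p v) (tmap p u) (tmap p w) = 0)
    -> u = 0.

(* Components of [e] in T_p S + (T_p S)^(g_v-orthogonal); [v] is in
   T_(i p) M, not necessarily tangent to S. *)
Definition tan_part p (v e : 'rV[R]_(k + l)) : 'rV[R]_k :=
  any_of [set u | forall w, fundamental L (i p) v (e - tmap p u) (tmap p w) = 0].
Definition nor_part p (v e : 'rV[R]_(k + l)) : 'rV[R]_(k + l) :=
  e - tmap p (tan_part p v e).

(* [Wb] is a local extension to M, around [i p], of the field [W] along S. *)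
Definition extension_along p (W : S -> 'rV[R]_(k + l)) (Wb : vfield M) : Prop :=
  smooth_near (i p) Wb /\ \forall q \near p, Wb (i q) = W q.

Definition push X (q : S) : 'rV[R]_(k + l) := tmap q (X q).

Variables (nablaM : @connection_op R (k + l) M) (nablaS : @connection_op R k S).

(* nablaM^v_X W for a tangent field X and a field W along S, not necessarily
   tangent to S. *)
Definition ambient p (v : 'rV[R]_(k + l)) X (W : S -> 'rV[R]_(k + l)) :
    'rV[R]_(k + l) :=
  any_of [set e | exists Xb Wb,
    [/\ extension_along p (push X) Xb, extension_along p W Wb
      & e = nablaM (i p) v Xb Wb]].

(* II_v(x, y) *)
Definition second_form p (v : 'rV[R]_(k + l)) (x y : 'rV[R]_k) :
    'rV[R]_(k + l) :=
  any_of [set e | exists X Y, [/\ extension p x X, extension p y Y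
                        & e = nor_part p v (ambient p v X (push Y))]].

(* Q_v(x, y) *)
Definition difference p (v x y : 'rV[R]_k) : 'rV[R]_k :=
  any_of [set e | exists X Y, [/\ extension p x X, extension p y Y
    & e = tan_part p (tmap p v) (ambient p (tmap p v) X (push Y))
          - nablaS p v X Y]].

Definition vderiv_difference p (v x y z : 'rV[R]_k) : 'rV[R]_k :=
  'D_z (fun v' => difference p v' x y) v.

Definition vderiv_second_form p (v : 'rV[R]_(k + l)) (x y : 'rV[R]_k)
    (z : 'rV[R]_(k + l)) : 'rV[R]_(k + l) :=
  'D_z (fun v' => second_form p v' x y) v.

(* (nabla_x Q)_v(y, z) *)
Definition cov_difference p (v x y z : 'rV[R]_k) : 'rV[R]_k :=
  any_of [set e | exists V X Y Z,
    [/\ admissible_extension sub_cone p v V,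
        extension p x X, extension p y Y, extension p z Z
      & e = nablaS p v X (fun q => difference q (V q) (Y q) (Z q))
            - vderiv_difference p v y z (nablaS p v X V)
            - difference p v (nablaS p v X Y) z
            - difference p v y (nablaS p v X Z)]].

(* (nabla_x II)_v(y, z), for [v] tangent to S; the extension V of [v] need not
   be tangent to S. *)
Definition cov_second_form p (v x y z : 'rV[R]_k) : 'rV[R]_(k + l) :=
  let tv := tmap p v in
  any_of [set e | exists V X Y Z,
    [/\ admissible_extension A (i p) tv V,
        extension p x X, extension p y Y, extension p z Z
      & e = nor_part p tv
              (ambient p tv X (fun q => second_form q (V (i q)) (Y q) (Z q))
               - vderiv_second_form p tv y z (ambient p tv X (V \o i)))
            - second_form p tv (nablaS p v X Y) z
            - second_form p tv y (nablaS p v X Z)]].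

End submanifold.

(* Main.v *)
From HB Require Import structures.
Require Import Defs.
From mathcomp Require Import all_boot all_order all_algebra.
From mathcomp Require Import all_classical all_reals all_analysis.
From mathcomp Require Import ring.
Set Implicit Arguments.
Unset Strict Implicit.
Unset Printing Implicit Defensive.
Import Order.TTheory GRing.Theory Num.Theory.
Import numFieldNormedType.Exports.
Local Open Scope classical_set_scope.
Local Open Scope ring_scope.

(** In a slice chart [c] of [M] and the chart [d] it induces on [S], write the
    connections as Christoffel symbols depending on the base point and on [v].
    On tangent vectors those of [M] split as [Gamma + Q + II], while both
    curvatures are the same expression [curvature_coord] in the symbols, whose
    derivatives are taken along the horizontal direction [(a, - Gamma(a, v))].
    Passing from the horizontal direction of [M] to that of [S] shifts it by
    [Q(a, v) + II(a, v)], which produces the vertical derivatives of [P], [Q]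
    and [II]. Pairing the resulting decomposition of the curvature with tangent
    vectors and using that the connection of [M] is metric turns the normal
    derivative of [II] into [- g(II(w, z), II(u, b))] and Cartan terms (Gauss);
    pairing it with normal vectors gives Codazzi. *)

(** Every object that depends on extensions is a choice [any_of] from the set of its values. For
    each one the set is shown to be inhabited and all its elements to have the same coordinate
    expression, so independence of the extensions comes out of the computation and is never assumed.
    The shape of the proof is dictated by the domains. [Q] lives on the cone of [S], but [II] is
    differentiated along ambient vectors, so it must be handled on ambient vectors over [S].
    Non-degeneracy is given only at vectors tangent to [S]; it reaches nearby ambient vectors
    because a Gram determinant stays nonzero ([regular]). The splitting of the Christoffel symbols
    holds only over vectors tangent to [S], so it may be differentiated only along directions that
    stay there; the normal component of a horizontal direction has to be split off beforehand.
    Symmetry of second derivatives is what makes the bracket formula independent of the chart,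
    removes the second derivatives from the curvature, and makes the fundamental and Cartan tensors
    symmetric. *)

Section derive_extra.
Context {R : realType}.
Implicit Types E F G : normedModType R.

(** Differentiability is a statement about the chosen differential ['d g x]: the first-order
    expansion of [f] is transported to [g], and uniqueness then identifies the two differentials. *)
Lemma near_eq_differentiable E F (f g : E -> F) (x : E) :
  (\near x, f x = g x) -> differentiable f x -> differentiable g x.
Proof.
move=> fg df; have fgx := nbhs_singleton fg.
have nfg : \forall y \near 0, f (y + x) = g (y + x).
  have : (\near x, f x = g x) by [].
  rewrite (near_shift 0 x) => H; apply: filterS H => y /=.
  by rewrite /shift /= subr0.
have H := diff_locally df.
have {}H : g \o shift x = cst (g x) + 'd f x +o_ 0 id.
  apply/eqaddoP => e e0; move/eqaddoP : H => /(_ e e0).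
  apply: filter_app; near=> y => /=.
  rewrite -![(_ + _ : _ -> _) _]/(_ + _) -![(- _ : _ -> _) _]/(- _) /=.
  by rewrite /cst /= /shift/= fgx (near nfg y).
apply/diff_locallyP.
have -> : 'd g x = 'd f x :> (E -> F).
  by apply: diff_unique => //; exact: diff_continuous.
by split => //; exact: diff_continuous.
Unshelve. all: by end_near. Qed.

Lemma deriveDdir E F (f : E -> F) x u v : differentiable f x ->
  'D_(u + v) f x = 'D_u f x + 'D_v f x.
Proof. by move=> df; rewrite !deriveE// linearD. Qed.

Lemma deriveZdir E F (f : E -> F) x (a : R) v : differentiable f x ->
  'D_(a *: v) f x = a *: 'D_v f x.
Proof. by move=> df; rewrite !deriveE// linearZ. Qed.

Lemma derive_comp E F G (f : F -> G) (g : E -> F) x v :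
  differentiable g x -> differentiable f (g x) ->
  'D_v (f \o g) x = 'D_('D_v g x) f (g x).
Proof.
move=> dg df; rewrite !deriveE//; last exact: differentiable_comp.
by rewrite diff_comp.
Qed.

Lemma derive_pair E F G (f : E -> F) (g : E -> G) x v :
  differentiable f x -> differentiable g x ->
  'D_v (fun y => (f y, g y)) x = ('D_v f x, 'D_v g x).
Proof.
move=> df dg; rewrite !deriveE//; last exact: differentiable_pair.
by rewrite diff_pair.
Qed.

(** The product rule for scaling is read off from the differential of a continuous bilinear map on
    [R^o * F]. *)
Lemma scale_diff F (p : R^o * F) :
  is_diff p (fun q : R^o * F => q.1 *: q.2) (fun q => p.1 *: q.2 + q.1 *: p.2).
Proof.
pose h := fun (a : R^o) (b : F) => a *: b.
have hl : bilinear_for (GRing.Scale.Law.clone _ _ *:%R _)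
    (GRing.Scale.Law.clone _ _ *:%R _) h.
  split=> [b a c d|b a c d] /=; first by rewrite /h scalerDl -scalerA.
  by rewrite /h scalerDr !scalerA mulrC.
pose hB := bilinear_isBilinear.Build _ _ _ _ _ _ h hl.
pose B : {bilinear R^o -> F -> F} := HB.pack h hB.
have cB : continuous (fun q : R^o * F => B q.1 q.2) by exact: scale_continuous.
split; first exact: (differentiable_bilin _ cB).
by rewrite (diff_bilin _ cB).
Qed.

Lemma differentiable_scale E F (k : E -> R) (f : E -> F) x :
  differentiable k x -> differentiable f x ->
  differentiable (fun y => k y *: f y) x.
Proof.
move=> dk df.
apply: (@differentiable_comp _ _ _ _ (fun y => (k y : R^o, f y)) (fun q => q.1 *: q.2) x).
  exact: differentiable_pair.
by case: (scale_diff (k x : R^o, f x)).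
Qed.

Lemma derive_scale E F (k : E -> R) (f : E -> F) x v :
  differentiable k x -> differentiable f x ->
  'D_v (fun y => k y *: f y) x = 'D_v k x *: f x + k x *: 'D_v f x.
Proof.
move=> dk df; have [ds sE] := scale_diff (k x : R^o, f x).
rewrite (@derive_comp _ _ _ (fun q : R^o * F => q.1 *: q.2)
  (fun y => (k y : R^o, f y)) x v)//; last exact: differentiable_pair.
by rewrite derive_pair// deriveE//= sE addrC.
Qed.

(** The difference quotient equals [f v] for every nonzero step. *)
Lemma derive_lin E F (f : E -> F) x v :
  (forall a y z, f (a *: y + z) = a *: f y + f z) -> 'D_v f x = f v.
Proof.
move=> fl; apply: lim_near_cst => //; near=> h => /=.
rewrite /shift /= fl addrK scalerA mulVf ?scale1r//.
by near: h; exact: nbhs_dnbhs_neq.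
Unshelve. all: by end_near. Qed.

End derive_extra.

(* The data of a basis of a finite dimensional [E], with its coordinate forms;
   it turns a derivative along a varying direction into a finite sum. *)
Class findim {R : realType} (E : normedModType R) := Findim {
  fd_index : finType;
  fd_vec : fd_index -> E;
  fd_coef : fd_index -> E -> R;
  fd_coef_lin : forall j a x y, fd_coef j (a *: x + y) = a * fd_coef j x + fd_coef j y;
  fd_coef_diff : forall j x, differentiable (fd_coef j) x;
  fd_sum : forall x, x = \sum_j fd_coef j x *: fd_vec j
}.

Section differentiable_proj.
Context {R : realType} {E F : normedModType R}.

Lemma differentiable_fst (x : E * F) : differentiable (@fst E F) x.
Proof. by apply: linear_differentiable => y; exact: cvg_fst. Qed.

Lemma differentiable_snd (x : E * F) : differentiable (@snd E F) x.
Proof. by apply: linear_differentiable => y; exact: cvg_snd. Qed.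

End differentiable_proj.

Section findim_theory.
Context {R : realType}.
Implicit Types E F G : normedModType R.

#[global] Instance findim_mx m n : findim 'M[R]_(m, n).
Proof.
apply: (@Findim R _ ('I_m * 'I_n)%type (fun p => delta_mx p.1 p.2)
  (fun p (x : 'M[R]_(m, n)) => x p.1 p.2)).
- by move=> j a x y; rewrite !mxE.
- by move=> j x; exact: differentiable_coord.
- by move=> x; rewrite {1}(matrix_sum_delta x) pair_big.
Defined.

#[global] Instance findim_scalar : findim (R : normedModType R).
Proof.
apply: (@Findim R (R : normedModType R) 'I_1 (fun _ => (1 : R)) (fun _ (x : R) => x)).
- by [].
- by move=> _ x; exact: ex_diff.
- by move=> x; rewrite big_ord1 [RHS]mulr1.
Defined.

#[global] Instance findim_prod E F (fE : findim E) (fF : findim F) :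
  findim (E * F)%type.
Proof.
apply: (@Findim R _ (@fd_index _ _ fE + @fd_index _ _ fF)%type
  (fun j => match j with inl a => (fd_vec a, 0) | inr b => (0, fd_vec b) end)
  (fun j (x : E * F) => match j with inl a => fd_coef a x.1
                        | inr b => fd_coef b x.2 end)).
- by case=> j a x y; rewrite fd_coef_lin.
- case=> j x; apply: (@differentiable_comp _ _ _ _ _ (fd_coef j) x);
    [exact: differentiable_fst|exact: fd_coef_diff
    |exact: differentiable_snd|exact: fd_coef_diff].
- move=> [x y]; rewrite [RHS]surjective_pairing.
  congr pair; rewrite raddf_sum /= big_sumType /= -fd_sum.
    by rewrite [X in _ + X]big1 ?addr0// => j _; rewrite scaler0.
  by rewrite [X in X + _]big1 ?add0r// => j _; rewrite scaler0.
Defined.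
End findim_theory.

Section derive_basis.
Context {R : realType} {E F G : normedModType R}.

Lemma differentiable_bigsum (I : Type) (r : seq I) (f : I -> E -> F) x :
  (forall j, differentiable (f j) x) ->
  differentiable (fun y => \sum_(j <- r) f j y) x.
Proof.
move=> df; elim: r => [|j r IH].
  by under [X in differentiable X _]eq_fun do rewrite big_nil.
under [X in differentiable X _]eq_fun do rewrite big_cons.
exact: differentiableD.
Qed.

Lemma derive_bigsum (I : Type) (r : seq I) (f : I -> E -> F) x v :
  (forall j, differentiable (f j) x) ->
  'D_v (fun y => \sum_(j <- r) f j y) x = \sum_(j <- r) 'D_v (f j) x.
Proof.
move=> df; elim: r => [|j r IH].
  by under [X in derive X _ _]eq_fun do rewrite big_nil; rewrite big_nil derive_cst.
under [X in derive X _ _]eq_fun do rewrite big_cons.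
rewrite big_cons -IH [LHS]deriveD//; first exact: diff_derivable.
exact/diff_derivable/differentiable_bigsum.
Qed.

Lemma fd_coef_derive (fE : findim E) j (x v : E) :
  'D_v (fd_coef j) x = fd_coef j v.
Proof. by apply: derive_lin => a y z; rewrite fd_coef_lin. Qed.

Lemma derive_dirE (fE : findim E) (f : E -> F) x v : differentiable f x ->
  'D_v f x = \sum_j fd_coef j v *: 'D_(fd_vec j) f x.
Proof.
move=> df; rewrite {1}(fd_sum v) deriveE// linear_sum.
by apply: eq_bigr => j _; rewrite linearZ deriveE.
Qed.

End derive_basis.

(** * Calculus of functions of class C^k *)

Section Ck.
Context {R : realType}.
Implicit Types E F G : normedModType R.

Lemma Ck_onS E F k (U : set E) (f : E -> F) : Ck_on k.+1 U f -> Ck_on k U f.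
Proof.
elim: k f => [|k IH] f [df Df].
  by move=> x Ux; apply: differentiable_continuous; exact: df.
by split=> // v; exact: IH.
Qed.

Lemma Ck_onSP E F k (U : set E) (f : E -> F) : Ck_on k.+1 U f ->
  (forall x, U x -> differentiable f x) /\ (forall v, Ck_on k U ('D_v f)).
Proof. by []. Qed.

Lemma Ck_on_sub E F k (U V : set E) (f : E -> F) :
  U `<=` V -> Ck_on k V f -> Ck_on k U f.
Proof.
move=> UV; elim: k f => [|k IH] f /= => [Cf x Ux|[df Df]]; first exact/Cf/UV.
by split=> [x Ux|v]; [exact/df/UV|exact: IH].
Qed.

Lemma Ck_on_eq E F k (U : set E) (f g : E -> F) : open U ->
  (forall x, U x -> f x = g x) -> Ck_on k U f -> Ck_on k U g.
Proof.
move=> oU.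
have nU x (h1 h2 : E -> F) : U x -> (forall x, U x -> h1 x = h2 x) -> \near x, h1 x = h2 x.
  by move=> Ux h12; apply: filterS h12 _; exact: open_nbhs_nbhs.
elim: k f g => [|k IH] f g fg /= => [Cf x Ux|[df Df]].
  have H := nU x _ _ Ux fg.
  rewrite /prop_for /continuous_at -fg//.
  apply: cvg_trans (Cf x Ux); apply: near_eq_cvg; near=> y.
  by near: y.
split=> [x Ux|v]; first exact: near_eq_differentiable (nU _ _ _ Ux fg) (df _ Ux).
apply: IH (Df v) => x Ux; apply: near_eq_derive; exact: nU.
Unshelve. all: by end_near. Qed.

Lemma Ck_on_cst E F k (U : set E) (a : F) : Ck_on k U (fun _ => a).
Proof.
elim: k a => [|k IH] a /=; first by move=> x _; exact: cst_continuous.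
split=> [x _|v]; first exact: differentiable_cst.
rewrite [X in Ck_on _ _ X](_ : _ = fun _ => 0)//; apply/funext => x.
exact: derive_cst.
Qed.

Lemma Ck_onD E F k (U : set E) (f g : E -> F) : open U ->
  Ck_on k U f -> Ck_on k U g -> Ck_on k U (fun x => f x + g x).
Proof.
move=> oU; elim: k f g => [|k IH] f g /=.
  by move=> Cf Cg x Ux; apply: cvgD; [exact: Cf|exact: Cg].
move=> [df Df] [dg Dg]; split=> [x Ux|v].
  by apply: differentiableD; [exact: df|exact: dg].
apply: Ck_on_eq (IH _ _ (Df v) (Dg v)) => // x Ux.
by rewrite [RHS]deriveD//; apply: diff_derivable; [exact: df|exact: dg].
Qed.

Lemma Ck_onZ E F k (U : set E) (a : E -> R) (f : E -> F) : open U ->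
  Ck_on k U a -> Ck_on k U f -> Ck_on k U (fun x => a x *: f x).
Proof.
move=> oU; elim: k a f => [|k IH] a f.
  by move=> Ca Cf x Ux; apply: cvgZ; [exact: Ca|exact: Cf].
move=> Ca Cf; have [da Da] := Ck_onSP Ca; have [df Df] := Ck_onSP Cf; split=> [x Ux|v].
  by apply: differentiable_scale; [exact: da|exact: df].
apply: (@Ck_on_eq _ _ _ _ (fun x => 'D_v a x *: f x + a x *: 'D_v f x)) => //.
  by move=> x Ux; rewrite derive_scale//; [exact: da|exact: df].
by apply: Ck_onD => //; apply: IH => //; exact: Ck_onS.
Qed.

Lemma Ck_on_sum E F k (U : set E) (I : Type) (r : seq I) (f : I -> E -> F) :
  open U -> (forall j, Ck_on k U (f j)) ->
  Ck_on k U (fun x => \sum_(j <- r) f j x).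
Proof.
move=> oU Cf; elim: r => [|j r IH].
  by under [X in Ck_on _ _ X]eq_fun do rewrite big_nil; exact: Ck_on_cst.
under [X in Ck_on _ _ X]eq_fun do rewrite big_cons.
exact: Ck_onD.
Qed.

Lemma Ck_on_coef E F (fF : findim F) j k (U : set E) (f : E -> F) : open U ->
  Ck_on k U f -> Ck_on k U (fun x => fd_coef j (f x)).
Proof.
move=> oU; elim: k f => [|k IH] f /=.
  move=> Cf x Ux; apply: (@continuous_comp _ _ _ f (fd_coef j)); first exact: Cf.
  exact/differentiable_continuous/fd_coef_diff.
move=> [df Df]; split=> [x Ux|v].
  by apply: differentiable_comp; [exact: df|exact: fd_coef_diff].
apply: Ck_on_eq (IH _ (Df v)) => // x Ux.
rewrite [RHS]derive_comp; [|exact: df|exact: fd_coef_diff].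
by rewrite fd_coef_derive.
Qed.

(** The direction ['D_v g x] moves with [x], whereas [Ck_on] only speaks of fixed directions.
    Expanding it in the basis of [F] brings back fixed directions, to which the induction
    applies. *)
Lemma Ck_on_comp E F G (fF : findim F) k (U : set E) (V : set F)
    (g : E -> F) (f : F -> G) : open U -> (forall x, U x -> V (g x)) ->
  Ck_on k U g -> Ck_on k V f -> Ck_on k U (f \o g).
Proof.
move=> oU gUV; elim: k f => [|k IH] f.
  move=> Cg Cf x Ux; apply: continuous_comp; first exact: Cg.
  exact/Cf/gUV.
move=> Cg Cf; have [dg Dg] := Ck_onSP Cg; have [df Df] := Ck_onSP Cf; split=> [x Ux|v].
  by apply: differentiable_comp; [exact: dg|exact/df/gUV].
apply: (@Ck_on_eq _ _ _ _
  (fun x => \sum_j fd_coef j ('D_v g x) *: ('D_(fd_vec j) f \o g) x)) => //.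
  move=> x Ux; rewrite derive_comp; [|exact: dg|exact/df/gUV].
  by rewrite -derive_dirE//; exact/df/gUV.
apply: Ck_on_sum => // j; apply: Ck_onZ => //; first exact: Ck_on_coef.
by apply: IH => //; exact: Ck_onS.
Qed.

Lemma Ck_on_pair E F G k (U : set E) (f : E -> F) (g : E -> G) : open U ->
  Ck_on k U f -> Ck_on k U g -> Ck_on k U (fun x => (f x, g x)).
Proof.
move=> oU; elim: k f g => [|k IH] f g.
  by move=> Cf Cg x Ux; apply: cvg_pair; [exact: Cf|exact: Cg].
move=> [df Df] [dg Dg]; split=> [x Ux|v].
  by apply: differentiable_pair; [exact: df|exact: dg].
apply: Ck_on_eq (IH _ _ (Df v) (Dg v)) => // x Ux.
by rewrite derive_pair//; [exact: df|exact: dg].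
Qed.

(** The derivative contains only the reciprocal itself and a derivative of [f], so the induction on
    the order closes. *)
Lemma Ck_onV E k (U : set E) (f : E -> R) : open U ->
  (forall x, U x -> f x != 0) -> Ck_on k U f -> Ck_on k U (fun x => (f x)^-1).
Proof.
move=> oU f0; elim: k => [|k IH].
  by move=> Cf x Ux; apply: cvgV; [exact: f0|exact: Cf].
move=> Cf; have [df Df] := Ck_onSP Cf; split=> [x Ux|v].
  by apply: differentiableV; [exact: df|exact: f0].
apply: (@Ck_on_eq _ _ _ _ (fun x => (-1) *: (((f x)^-1 *: (f x)^-1) *: 'D_v f x))) => //.
  move=> x Ux; rewrite deriveV; [|exact: f0|exact/diff_derivable/df].
  by rewrite scaleN1r -scaleNr -exprVn.
apply: Ck_onZ => //; first exact: Ck_on_cst.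
by do 2?[apply: Ck_onZ => //]; apply: IH; exact: Ck_onS.
Qed.

End Ck.

Section linear_prop.
Context {R : realType} {V W : lmodType R} (f : V -> W).
Hypothesis lf : linear f.

(** Linearity is carried around as a plain proposition, because Christoffel symbols and metrics are
    known to be linear only at points of the cone. Packing it here gives access to the general
    lemmas on linear maps. *)
Let fL : {linear V -> W} := HB.pack f (GRing.isLinear.Build _ _ _ _ _ lf).

Lemma lin0 : f 0 = 0. Proof. exact: (linear0 fL). Qed.
Lemma linD x y : f (x + y) = f x + f y. Proof. exact: (linearD fL). Qed.
Lemma linN x : f (- x) = - f x. Proof. exact: (linearN fL). Qed.
Lemma linB x y : f (x - y) = f x - f y. Proof. exact: (linearB fL). Qed.
Lemma linZ a x : f (a *: x) = a *: f x. Proof. exact: (linearZZ fL a x). Qed.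
Lemma lin_sum I (r : seq I) (F : I -> V) :
  f (\sum_(j <- r) F j) = \sum_(j <- r) f (F j).
Proof. exact: (linear_sum fL). Qed.
End linear_prop.

(** * Germs of smooth maps *)

Section smooth_at.
Context {R : realType}.
Implicit Types E F G : normedModType R.

(** One neighbourhood serves all orders at once, so the notion depends only on the germ and passes
    to derivatives. *)
Definition smooth_at E F (x : E) (f : E -> F) : Prop :=
  exists2 U, open_nbhs x U & smooth_on U f.

Lemma near_smooth_at E F (x : E) (f : E -> F) :
  smooth_at x f -> \forall y \near x, smooth_at y f.
Proof.
move=> [U xU sf]; apply: filterS (open_nbhs_nbhs xU) => y Uy.
by exists U => //; case: xU.
Qed.

Lemma smooth_onP E F (U : set E) (f : E -> F) : open U ->
  smooth_on U f <-> (forall x, U x -> smooth_at x f).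
Proof.
move=> oU; split=> [sf x Ux|sf k]; first by exists U.
have : forall x, U x -> exists2 V, open_nbhs x V & Ck_on k V f.
  by move=> x /sf[V xV /(_ k)]; exists V.
elim: k f {sf} => [|k IH] f sf.
  by move=> x Ux; have [V [_ Vx]] := sf _ Ux; exact.
split=> [x Ux|v]; first by have [V [_ Vx] [df _]] := sf _ Ux; exact: df.
by apply: IH => x Ux; have [V xV [_ Df]] := sf _ Ux; exists V => //; exact: Df.
Qed.

Lemma smooth_at_diff E F (x : E) (f : E -> F) : smooth_at x f -> differentiable f x.
Proof. by move=> [U [_ Ux] /(_ 1%N) [df _]]; exact: df. Qed.

Lemma smooth_at_cont E F (x : E) (f : E -> F) : smooth_at x f -> {for x, continuous f}.
Proof. by move/smooth_at_diff/differentiable_continuous. Qed.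

Lemma smooth_at_derive E F (x v : E) (f : E -> F) :
  smooth_at x f -> smooth_at x ('D_v f).
Proof.
by move=> [U xU sf]; exists U => // k; have [_] := sf k.+1; apply.
Qed.

Lemma smooth_at_eq E F (x : E) (f g : E -> F) :
  (\near x, f x = g x) -> smooth_at x f -> smooth_at x g.
Proof.
rewrite /prop_near1 nbhsE => -[V xV fg] [U xU sf].
exists (U `&` V); first exact: open_nbhsI.
have oUV : open (U `&` V) by apply: openI; [case: xU|case: xV].
move=> k; apply: Ck_on_eq (Ck_on_sub (V := U) _ (sf k)) => //.
  by move=> y [_ Vy]; exact: fg.
Qed.

Lemma smooth_at_cst E F (x : E) (a : F) : smooth_at x (fun _ => a).
Proof. by exists setT; [exact: open_nbhsT|move=> k; exact: Ck_on_cst]. Qed.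

Lemma smooth_at2 E F F' G (x : E) (f : E -> F) (g : E -> F') (h : E -> G) :
  (forall U k, open U -> Ck_on k U f -> Ck_on k U g -> Ck_on k U h) ->
  smooth_at x f -> smooth_at x g -> smooth_at x h.
Proof.
move=> H [U xU sf] [V xV sg]; exists (U `&` V); first exact: open_nbhsI.
move=> k; apply: H; first by apply: openI; [case: xU|case: xV].
  by apply: Ck_on_sub (sf k) => y [].
by apply: Ck_on_sub (sg k) => y [].
Qed.

Lemma smooth_atD E F (x : E) (f g : E -> F) : smooth_at x f -> smooth_at x g ->
  smooth_at x (fun y => f y + g y).
Proof. by apply: smooth_at2 => U k; exact: Ck_onD. Qed.

Lemma smooth_atZ E F (x : E) (a : E -> R) (f : E -> F) :
  smooth_at x a -> smooth_at x f -> smooth_at x (fun y => a y *: f y).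
Proof. by apply: smooth_at2 => U k; exact: Ck_onZ. Qed.

Lemma smooth_atM E (x : E) (a f : E -> R) :
  smooth_at x a -> smooth_at x f -> smooth_at x (fun y => a y * f y).
Proof. exact: smooth_atZ. Qed.

Lemma smooth_atN E F (x : E) (f : E -> F) : smooth_at x f ->
  smooth_at x (fun y => - f y).
Proof.
move=> sf; have := smooth_atZ (smooth_at_cst x (-1 : R)) sf.
by under eq_fun do rewrite scaleN1r.
Qed.

Lemma smooth_atB E F (x : E) (f g : E -> F) : smooth_at x f -> smooth_at x g ->
  smooth_at x (fun y => f y - g y).
Proof. by move=> sf sg; apply: smooth_atD => //; exact: smooth_atN. Qed.

Lemma smooth_at_pair E F G (x : E) (f : E -> F) (g : E -> G) :
  smooth_at x f -> smooth_at x g -> smooth_at x (fun y => (f y, g y)).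
Proof. by apply: smooth_at2 => U k; exact: Ck_on_pair. Qed.

Lemma smooth_at_sum E F (x : E) (I : Type) (r : seq I) (f : I -> E -> F) :
  (forall j, smooth_at x (f j)) -> smooth_at x (fun y => \sum_(j <- r) f j y).
Proof.
move=> sf; elim: r => [|j r IH].
  by under eq_fun do rewrite big_nil; exact: smooth_at_cst.
by under eq_fun do rewrite big_cons; exact: smooth_atD.
Qed.

Lemma smooth_at_prod E (x : E) (I : Type) (r : seq I) (f : I -> E -> R) :
  (forall j, smooth_at x (f j)) -> smooth_at x (fun y => \prod_(j <- r) f j y).
Proof.
move=> sf; elim: r => [|j r IH].
  by under eq_fun do rewrite big_nil; exact: smooth_at_cst.
by under eq_fun do rewrite big_cons; exact: smooth_atM.
Qed.

Lemma smooth_at_comp E F G (fF : findim F) (x : E) (g : E -> F) (f : F -> G) :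
  smooth_at x g -> smooth_at (g x) f -> smooth_at x (f \o g).
Proof.
move=> sg [V [oV Vgx] sf].
have : nbhs x (g @^-1` V).
  by apply: (smooth_at_cont sg); apply: open_nbhs_nbhs.
rewrite nbhsE => -[W [oW Wx] WV]; have [U [oU Ux] Cg] := sg.
exists (U `&` W); first by split; [exact: openI|split].
move=> k; apply: (@Ck_on_comp _ _ _ _ _ _ _ V) => //.
- exact: openI.
- by move=> y [_ /WV].
- by apply: Ck_on_sub (Cg k) => y [].
Qed.

Lemma smooth_atV E (x : E) (f : E -> R) : f x != 0 -> smooth_at x f ->
  smooth_at x (fun y => (f y)^-1).
Proof.
move=> fx0 sf; have := smooth_at_cont sf.
move=> /(_ [set r : R | r != 0]) H.
have : nbhs x (f @^-1` [set r : R | r != 0]).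
  by apply: H; apply: open_nbhs_nbhs; split => //; exact: open_neq.
rewrite nbhsE => -[W [oW Wx] WV]; have [U [oU Ux] Cf] := sf.
exists (U `&` W); first by split; [exact: openI|split].
move=> k; apply: Ck_onV => //; first exact: openI.
  by move=> y [_ /WV].
by apply: Ck_on_sub (Cf k) => y [].
Qed.

Lemma smooth_at_lin E F (fE : findim E) (x : E) (f : E -> F) :
  linear f -> smooth_at x f.
Proof.
move=> lf; exists setT; first exact: open_nbhsT.
move=> k; apply: (@Ck_on_eq _ _ _ _ _ (fun y => \sum_j fd_coef j y *: f (fd_vec j))).
- exact: openT.
- move=> y _; rewrite [in RHS](fd_sum y) (lin_sum lf).
  by apply: eq_bigr => j _; rewrite (linZ lf).
apply: Ck_on_sum; first exact: openT.
move=> j; apply: Ck_onZ; [exact: openT| |exact: Ck_on_cst].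
have Cid : Ck_on k setT (@id E).
  case: k => [|k]; first by move=> y _; exact: cvg_id.
  split=> [y _|v]; first exact: ex_diff.
  by under eq_fun do rewrite derive_id; exact: Ck_on_cst.
by apply: Ck_on_coef Cid; exact: openT.
Qed.

Lemma smooth_at_id E (fE : findim E) (x : E) : smooth_at x (fun y => y).
Proof. by apply: smooth_at_lin. Qed.

Lemma smooth_at_coef E F (fF : findim F) j (x : E) (f : E -> F) :
  smooth_at x f -> smooth_at x (fun y => fd_coef j (f y)).
Proof.
move=> [U xU Cf]; exists U => // k.
by apply: Ck_on_coef => //; case: xU.
Qed.

Lemma smooth_at_entry E m n (x : E) (f : E -> 'M[R]_(m, n)) a b :
  smooth_at x f -> smooth_at x (fun y => f y a b).
Proof. by move=> sf; exact: (@smooth_at_coef _ _ (findim_mx m n) (a, b) _ _ sf). Qed.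

Lemma smooth_at_mx E m n (x : E) (f : E -> 'M[R]_(m, n)) :
  (forall a b, smooth_at x (fun y => f y a b)) -> smooth_at x f.
Proof.
move=> sf; rewrite [f](_ : _ = fun y => \sum_p f y p.1 p.2 *: delta_mx p.1 p.2).
  by apply: smooth_at_sum => p; apply: smooth_atZ => //; exact: smooth_at_cst.
by apply/funext => y; rewrite {1}(matrix_sum_delta (f y)) pair_big.
Qed.

Lemma smooth_at_mulmx E m n q (x : E) (f : E -> 'M[R]_(m, n)) (g : E -> 'M[R]_(n, q)) :
  smooth_at x f -> smooth_at x g -> smooth_at x (fun y => f y *m g y).
Proof.
move=> sf sg; apply: smooth_at_mx => a b.
under eq_fun do rewrite mxE.
by apply: smooth_at_sum => j; apply: smooth_atM; exact: smooth_at_entry.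
Qed.

Lemma smooth_at_det E n (x : E) (f : E -> 'M[R]_n) :
  smooth_at x f -> smooth_at x (fun y => \det (f y)).
Proof.
move=> sf; apply: smooth_at_sum => s; apply: smooth_atM; first exact: smooth_at_cst.
by apply: smooth_at_prod => j; exact: smooth_at_entry.
Qed.

(** Near a matrix with nonzero determinant, Cramer's formula makes the inverse a rational function
    of the entries. *)
Lemma smooth_at_invmx E n (x : E) (f : E -> 'M[R]_n) : \det (f x) != 0 ->
  smooth_at x f -> smooth_at x (fun y => invmx (f y)).
Proof.
move=> dfx sf; have sd := smooth_at_det sf.
apply: (@smooth_at_eq _ _ _ (fun y => (\det (f y))^-1 *: \adj (f y))).
  have := smooth_at_cont sd.
  move=> /(_ [set r : R | r != 0]) H.
  have : nbhs x [set y | \det (f y) != 0].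
    by apply: H; apply: open_nbhs_nbhs; split => //; exact: open_neq.
  by apply: filterS => y /= dy; rewrite /invmx unitmxE unitfE dy.
apply: smooth_atZ; first exact: smooth_atV.
apply: smooth_at_mx => a b; under eq_fun do rewrite mxE.
apply: smooth_atM; first exact: smooth_at_cst.
apply: smooth_at_det; apply: smooth_at_mx => c d.
by under eq_fun do rewrite !mxE; exact: smooth_at_entry.
Qed.

(** The usual way below to prove smoothness of a tensor evaluated on a moving vector: expand the
    vector in the basis. Linearity is asked near [x] only, since expressions in charts are
    meaningful only there. *)
Lemma smooth_at_slot E F G (fF : findim F) (x : E) (B : E -> F -> G) (f : E -> F) :
  (\forall y \near x, linear (B y)) -> (forall a, smooth_at x (B ^~ a)) ->
  smooth_at x f -> smooth_at x (fun y => B y (f y)).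
Proof.
move=> lB sB sf.
apply: (@smooth_at_eq _ _ _ (fun y => \sum_j fd_coef j (f y) *: B y (fd_vec j))).
  apply: filterS lB => y lB; rewrite [in RHS](fd_sum (f y)) (lin_sum lB).
  by apply: eq_bigr => j _; rewrite (linZ lB).
by apply: smooth_at_sum => j; apply: smooth_atZ => //; exact: smooth_at_coef.
Qed.

(** Both [f] and the constant [f x] are expanded in the basis. The expansion of the constant gives
    the derivative with the slot frozen, and what remains is [B x] applied to the derivative of
    [f]. *)
Lemma derive_slot E F G (fF : findim F) (x v : E) (B : E -> F -> G) (f : E -> F) :
  (\forall y \near x, linear (B y)) -> (forall a, differentiable (B ^~ a) x) ->
  differentiable f x ->
  'D_v (fun y => B y (f y)) x = 'D_v (B ^~ (f x)) x + B x ('D_v f x).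
Proof.
move=> lB dB df; have lBx := nbhs_singleton lB.
have E1 (h : E -> F) : \forall y \near x,
    B y (h y) = \sum_j fd_coef j (h y) *: B y (fd_vec j).
  apply: filterS lB => y lB; rewrite {1}(fd_sum (h y)) (lin_sum lB).
  by apply: eq_bigr => j _; rewrite (linZ lB).
have dc j (h : E -> F) : differentiable h x -> differentiable (fun y => fd_coef j (h y)) x.
  by move=> dh; apply: differentiable_comp => //; exact: fd_coef_diff.
have D1 (h : E -> F) : differentiable h x ->
    'D_v (fun y => B y (h y)) x =
    \sum_j (fd_coef j ('D_v h x) *: B x (fd_vec j)
            + fd_coef j (h x) *: 'D_v (B ^~ (fd_vec j)) x).
  move=> dh; rewrite (near_eq_derive v (E1 h)) derive_bigsum.
    apply: eq_bigr => j _; rewrite derive_scale//; last exact: dc.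
    rewrite (derive_comp (f := fd_coef j))//; last exact: fd_coef_diff.
    by rewrite fd_coef_derive.
  by move=> j; apply: differentiable_scale => //; exact: dc.
rewrite D1// (D1 (fun _ => f x))// big_split addrC; congr (_ + _); last first; last first.
  by have := nbhs_singleton (E1 (fun _ => 'D_v f x)) => /= ->.
apply: eq_bigr => j _.
rewrite (derive_cst (f x)) (lin0 (f := fd_coef j)) ?scale0r ?add0r// => a y z.
by rewrite fd_coef_lin.
Qed.

End smooth_at.

(** * Symmetry of second derivatives *)

Section schwarz.
Context {R : realType} {E : normedModType R}.

Lemma line_is_derive (f : E -> R) (p u : E) (s : R) :
  differentiable f (s *: u + p) ->
  is_derive s 1 (fun t : R => f (t *: u + p)) ('D_u f (s *: u + p)).
Proof.
move=> df.
have dg : differentiable (fun t : R => t *: u + p) s.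
  by apply: differentiableD => //; exact: differentiableZl.
have Dg : 'D_1 (fun t : R => t *: u + p) s = u.
  rewrite deriveD//; last exact/diff_derivable/differentiableZl.
  by rewrite derive_cst addr0 (derive_lin (f := fun t : R => t *: u)) ?scale1r// => a y z; rewrite scalerDl scalerA.
have df' : differentiable (fun t : R => f (t *: u + p)) s.
  by apply: (@differentiable_comp _ _ _ _ (fun t : R => t *: u + p) f).
split; first exact: diff_derivable.
by rewrite (@derive_comp _ _ _ _ f (fun t : R => t *: u + p))// Dg.
Qed.

(** The mean value theorem is applied twice: along [u] to the increment [G] in direction [v], then
    along [v] to the derivative found. This gives exactly [h ^+ 2] times the mixed derivative at an
    intermediate point, and continuity of that derivative gives the bound. *)
Lemma second_difference (f : E -> R) (x u v : E) (e : R) : 0 < e ->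
  smooth_at x f ->
  \forall h \near (0 : R)^'+,
    `|f (h *: u + (h *: v + x)) - f (h *: u + x) - f (h *: v + x) + f x
      - h ^+ 2 * 'D_v ('D_u f) x| <= e * h ^+ 2.
Proof.
move=> e0 sf.
have sDf := smooth_at_derive u sf; have sDDf := smooth_at_derive v sDf.
have := smooth_at_cont sDDf; move=> /cvgrPdist_le /(_ e e0) H1.
have [d d0 Hd] : exists2 d : R, 0 < d & forall y, `|x - y| < d ->
    [/\ differentiable f y, differentiable ('D_u f) y
      & `|'D_v ('D_u f) x - 'D_v ('D_u f) y| <= e].
  have : \forall y \near x, [/\ differentiable f y, differentiable ('D_u f) y
      & `|'D_v ('D_u f) x - 'D_v ('D_u f) y| <= e].
    near=> y; split.
    - by apply: smooth_at_diff; near: y; exact: near_smooth_at.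
    - by apply: smooth_at_diff; near: y; exact: near_smooth_at.
    - by near: y.
  by move=> /nbhs_ballP[d /= d0 Hd]; exists d => // y xy; apply: Hd; rewrite -ball_normE.
near=> h.
have h0 : 0 < h by [].
have small (s t : R) : 0 <= s <= h -> 0 <= t <= h -> `|x - (s *: u + (t *: v + x))| < d.
  move=> /andP[s0 sh] /andP[t0 th].
  rewrite addrA opprD addrCA subrr addr0 normrN.
  apply: (@le_lt_trans _ _ (h * (`|u| + `|v|))).
    rewrite (le_trans (ler_normD _ _))// !normrZ !ger0_norm// mulrDr.
    by rewrite lerD// ler_wpM2r.
  (* The [+ 1] keeps the divisor positive when [u] and [v] both vanish. *)
  have : h < d / (`|u| + `|v| + 1) by near: h; exact: nbhs_right_lt (divr_gt0 _ _).
  have n0 : 0 < `|u| + `|v| + 1 by rewrite ltr_wpDl ?addr_ge0.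
  rewrite ltr_pdivlMr//; apply: le_lt_trans.
  by rewrite ler_pM2l// lerDl.
have h0h : 0 <= h <= h by rewrite ltW//=.
have z0h : 0 <= (0 : R) <= h by rewrite lexx ltW.
pose G (s : R) : R := f (s *: u + (h *: v + x)) - f (s *: u + x).
pose G' (s : R) : R := 'D_u f (s *: u + (h *: v + x)) - 'D_u f (s *: u + x).
have x0 (s : R) : s *: u + x = s *: u + (0 *: v + x) by rewrite scale0r add0r.
have dG (s : R) : 0 <= s <= h -> is_derive s 1 G (G' s).
  move=> sh; apply: is_deriveB.
    by apply: line_is_derive; case: (Hd _ (small _ _ sh h0h)).
  by apply: line_is_derive; rewrite x0; case: (Hd _ (small _ _ sh z0h)).
have [s sh EG] : exists2 s : R, s \in `]0, h[%R & G h - G 0 = G' s * (h - 0).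
  apply: (@MVT R G G' 0 h h0) => [s|].
    by move=> /[!in_itv]/= /andP[s0 sh]; apply: dG; rewrite !ltW.
  apply: continuous_in_subspaceT => s; rewrite inE/= in_itv/= => sh.
  by have [+ _] := dG _ sh => /derivable1_diffP/differentiable_continuous.
have {sh} shl : 0 <= s <= h by move: sh; rewrite in_itv/= => /andP[? ?]; rewrite !ltW.
pose K (t : R) : R := 'D_u f (t *: v + (s *: u + x)).
pose K' (t : R) : R := 'D_v ('D_u f) (t *: v + (s *: u + x)).
have xv (t : R) : t *: v + (s *: u + x) = s *: u + (t *: v + x) by rewrite addrCA.
have dK (t : R) : 0 <= t <= h -> is_derive t 1 K (K' t).
  by move=> th; apply: line_is_derive; rewrite xv; case: (Hd _ (small _ _ shl th)).
have [t th EK] : exists2 t : R, t \in `]0, h[%R & K h - K 0 = K' t * (h - 0).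
  apply: (@MVT R K K' 0 h h0) => [t|].
    by move=> /[!in_itv]/= /andP[t0 th]; apply: dK; rewrite !ltW.
  apply: continuous_in_subspaceT => t; rewrite inE/= in_itv/= => th.
  by have [+ _] := dK _ th => /derivable1_diffP/differentiable_continuous.
have {th} thl : 0 <= t <= h by move: th; rewrite in_itv/= => /andP[? ?]; rewrite !ltW.
have -> : f (h *: u + (h *: v + x)) - f (h *: u + x) - f (h *: v + x) + f x
    = h ^+ 2 * 'D_v ('D_u f) (s *: u + (t *: v + x)).
  have -> : f (h *: u + (h *: v + x)) - f (h *: u + x) - f (h *: v + x) + f x
      = G h - G 0.
    by rewrite /G !scale0r !add0r; ring.
  have E2 : G' s = K h - K 0 by rewrite /K !xv /G' scale0r add0r.
  by rewrite EG E2 EK /K' xv subr0; ring.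
rewrite -mulrBr normrM ger0_norm ?exprn_ge0 ?(ltW h0)// mulrC distrC.
by rewrite ler_wpM2r ?exprn_ge0 ?(ltW h0)//; case: (Hd _ (small _ _ shl thl)).
Unshelve. all: by end_near. Qed.

Lemma squeeze_coef (D X Y e h : R) : 0 < h -> `|D - h ^+ 2 * X| <= e / 2 * h ^+ 2 ->
  `|D - h ^+ 2 * Y| <= e / 2 * h ^+ 2 -> `|X - Y| <= e.
Proof.
move=> h0 HX HY; have h20 : 0 < h ^+ 2 by rewrite exprn_gt0.
have : `|h ^+ 2 * (X - Y)| <= e * h ^+ 2.
  rewrite (_ : h ^+ 2 * _ = (D - h ^+ 2 * Y) - (D - h ^+ 2 * X)); last by ring.
  by rewrite (le_trans (ler_normB _ _))// [e]splitr mulrDl lerD.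
by rewrite normrM (gtr0_norm h20) mulrC ler_pM2r.
Qed.

(** The second difference is symmetric in [u] and [v], so both mixed derivatives approximate the
    same number up to any [e]. *)
Lemma derive_swapR (f : E -> R) (x u v : E) : smooth_at x f ->
  'D_v ('D_u f) x = 'D_u ('D_v f) x.
Proof.
move=> sf; apply/eqP; rewrite -subr_eq0 -normr_le0; apply/ler_addgt0Pl => e e0.
rewrite addr0.
have e20 : 0 < e / 2 by exact: divr_gt0.
have H1 := second_difference u v e20 sf.
have H2 := second_difference v u e20 sf.
have [h [{}H1 [{}H2 h0]]] := filter_ex (filterI H1 (filterI H2 (nbhs_right_gt (0 : R)))).
move: H1 H2; rewrite [h *: v + (h *: u + x)]addrCA.
set D := f _; set a := f _; set b := f _; set c := f _.
rewrite (addrAC D (- b)) => H1 H2.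
exact: squeeze_coef h0 H1 H2.
Unshelve. all: by end_near. Qed.

Lemma derive_swap (F : normedModType R) (fF : findim F) (f : E -> F) (x u v : E) :
  smooth_at x f -> 'D_v ('D_u f) x = 'D_u ('D_v f) x.
Proof.
move=> sf; rewrite (fd_sum ('D_v _ x)) [RHS]fd_sum.
have key a b j : fd_coef j ('D_b ('D_a f) x) = 'D_b ('D_a (fd_coef j \o f)) x.
  rewrite (near_eq_derive (f := 'D_a (fd_coef j \o f)) (g := fd_coef j \o 'D_a f)).
    rewrite derive_comp ?fd_coef_derive//; last exact: fd_coef_diff.
    exact/smooth_at_diff/smooth_at_derive.
  apply: filterS (near_smooth_at sf) => y /smooth_at_diff dy /=.
  by rewrite derive_comp ?fd_coef_derive//; exact: fd_coef_diff.
apply: eq_bigr => j _; rewrite key key derive_swapR//.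
exact: smooth_at_coef.
Qed.
End schwarz.

(* Locked copy of the directional derivative: unification would otherwise
   unfold it down to the choice of a limit. *)
HB.lock Definition lderive {R : realType} {E F : normedModType R}
  (f : E -> F) (x v : E) : F := 'D_v f x.

Reserved Notation "''L_' v f" (at level 10, v, f at next level, format "''L_' v  f").
Reserved Notation "''L_' v f x" (at level 10, v, f, x at next level, format "''L_' v  f  x").
Notation "''L_' v f" := (fun x => lderive f x v).
Notation "''L_' v f x" := (lderive f x v).

Section lderive_theory.
Context {R : realType} {E F G : normedModType R}.
Implicit Types (f : E -> F) (x u v : E).

Lemma lderiveE f x v : 'D_v f x = 'L_v f x.
Proof. by rewrite lderive.unlock. Qed.

Lemma lderive_near f g x v : (\near x, f x = g x) -> 'L_v f x = 'L_v g x.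
Proof. by rewrite lderive.unlock; exact: near_eq_derive. Qed.

Lemma lderive_cst (a : F) x v : 'L_v (fun _ => a) x = 0.
Proof. by rewrite lderive.unlock; exact: derive_cst. Qed.

Lemma lderive_id x v : 'L_v (fun y => y) x = v.
Proof. by rewrite lderive.unlock; exact: derive_id. Qed.

Lemma lderive_lin f x v : linear f -> 'L_v f x = f v.
Proof. by rewrite lderive.unlock => lf; exact: derive_lin. Qed.

Lemma lderive_linear f x : smooth_at x f -> linear (fun v => 'L_v f x).
Proof.
rewrite lderive.unlock => /smooth_at_diff df a u v.
by rewrite deriveDdir// deriveZdir.
Qed.

Lemma lderiveD f g x v : smooth_at x f -> smooth_at x g ->
  'L_v (fun y => f y + g y) x = 'L_v f x + 'L_v g x.
Proof.
rewrite lderive.unlock => /smooth_at_diff df /smooth_at_diff dg.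
by rewrite [LHS]deriveD//; exact: diff_derivable.
Qed.

Lemma lderiveZ (k : E -> R) f x v : smooth_at x k -> smooth_at x f ->
  'L_v (fun y => k y *: f y) x = 'L_v k x *: f x + k x *: 'L_v f x.
Proof.
rewrite lderive.unlock => /smooth_at_diff dk /smooth_at_diff df.
exact: derive_scale.
Qed.

Lemma lderive_comp (g : E -> F) (f : F -> G) x v : smooth_at x g -> smooth_at (g x) f ->
  'L_v (f \o g) x = 'L_('L_v g x) f (g x).
Proof.
rewrite lderive.unlock => /smooth_at_diff dg /smooth_at_diff df.
exact: derive_comp.
Qed.

Lemma lderive_pair (f : E -> F) (g : E -> G) x v : smooth_at x f -> smooth_at x g ->
  'L_v (fun y => (f y, g y)) x = ('L_v f x, 'L_v g x).
Proof.
rewrite lderive.unlock => /smooth_at_diff df /smooth_at_diff dg.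
exact: derive_pair.
Qed.

Lemma smooth_at_lderive f x v : smooth_at x f -> smooth_at x (fun y => 'L_v f y).
Proof. by rewrite lderive.unlock; exact: smooth_at_derive. Qed.

Lemma lderive_slot (fF : findim F) x v (B : E -> F -> G) (f : E -> F) :
  (\forall y \near x, linear (B y)) -> (forall a, smooth_at x (B ^~ a)) ->
  smooth_at x f ->
  'L_v (fun y => B y (f y)) x = 'L_v (B ^~ (f x)) x + B x ('L_v f x).
Proof.
rewrite lderive.unlock => lB sB sf.
by apply: derive_slot => // [a|]; exact: smooth_at_diff.
Qed.

Lemma lderive_swap (fF : findim F) f x u v : smooth_at x f ->
  'L_v (fun y => 'L_u f y) x = 'L_u (fun y => 'L_v f y) x.
Proof. by rewrite lderive.unlock; exact: derive_swap. Qed.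

End lderive_theory.

Section lderive_dir.
Context {R : realType} {E F : normedModType R}.

Lemma near_lderive_linear (f : E -> F) x : smooth_at x f ->
  \forall y \near x, linear (fun v => 'L_v f y).
Proof. by move=> /near_smooth_at; apply: filterS => y; exact: lderive_linear. Qed.

Context (fE : findim E).

Lemma smooth_dir_lderive (x : E) (X : E -> E) (Y : E -> F) :
  smooth_at x X -> smooth_at x Y -> smooth_at x (fun z => 'L_(X z) Y z).
Proof.
move=> sX sY; apply: (@smooth_at_slot _ _ _ _ _ _ (fun x a => 'L_a Y x)).
- exact: near_lderive_linear.
- by move=> a; exact: smooth_at_lderive.
- exact: sX.
Qed.

Lemma lderive_dir_lderive (x : E) (X : E -> E) (Y : E -> F) v :
  smooth_at x X -> smooth_at x Y ->
  'L_v (fun z => 'L_(X z) Y z) x =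
  'L_v (fun z => 'L_(X x) Y z) x + 'L_('L_v X x) Y x.
Proof.
move=> sX sY; apply: (@lderive_slot _ _ _ _ _ x v (fun x a => 'L_a Y x)).
- exact: near_lderive_linear.
- by move=> a; exact: smooth_at_lderive.
- exact: sX.
Qed.

End lderive_dir.

Section lderive_prod.
Context {R : realType} {E F G : normedModType R}.
Variables (f : E * F -> G) (p : E * F).
Hypothesis sf : smooth_at p f.

Let addE (s s' : E) (t t' : F) : (s + s', t + t') = (s, t) + (s', t') :> E * F.
Proof. by []. Qed.

Let scaleE a (s : E) (t : F) : (a *: s, a *: t) = a *: (s, t) :> E * F.
Proof. by []. Qed.

Lemma lderive_split s t : 'L_(s, t) f p = 'L_(s, 0) f p + 'L_(0, t) f p.
Proof. by rewrite -(linD (lderive_linear sf)) -addE addr0 add0r. Qed.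

Lemma lderive_snd_linear : linear (fun t => 'L_(0, t) f p).
Proof.
by move=> a s t; rewrite -(lderive_linear sf) -scaleE -addE scaler0 addr0.
Qed.

End lderive_prod.

Lemma near_fst {R : realType} (E F : normedModType R) (x : E) (y : F) (P : E -> Prop) :
  (\forall z \near x, P z) -> \forall xy \near (x, y), P xy.1.
Proof. by move=> /(@cvg_fst _ _ (nbhs x) (nbhs y)). Qed.

Section bilinear_along.
Context {R : realType} {E K F1 F2 H : normedModType R}.
Context (fK : findim K) (f1 : findim F1) (f2 : findim F2).

(** The common shape of the coordinate forms of the Christoffel symbols, the metric, [Q] and [II]:
    bilinear in the vectors near the point, and smooth in the point when the vectors are frozen. *)
Definition bilin_smooth_at (p : K) (G : K -> F1 -> F2 -> H) : Prop :=
  (\forall r \near p, (forall a, linear (G r a)) /\ (forall b, linear (G r ^~ b)))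
  /\ (forall a b, smooth_at p (fun r => G r a b)).

Variables (G : K -> F1 -> F2 -> H) (x : E) (phi : E -> K) (Y : E -> F1) (Z : E -> F2).
Hypotheses (GP : bilin_smooth_at (phi x) G) (sphi : smooth_at x phi)
  (sY : smooth_at x Y) (sZ : smooth_at x Z).

Let near_lin : \forall y \near x,
  (forall a, linear (G (phi y) a)) /\ (forall b, linear (G (phi y) ^~ b)).
Proof. by have [nG _] := GP; have := smooth_at_cont sphi nG. Qed.

Let smooth_fix a b : smooth_at x (fun y => G (phi y) a b).
Proof.
have [_ sG] := GP.
by apply: (@smooth_at_comp _ _ _ _ _ _ _ (fun r => G r a b)); [exact: sphi|exact: sG].
Qed.

Let smooth_fix2 b : smooth_at x (fun y => G (phi y) (Y y) b).
Proof.
apply: (@smooth_at_slot _ _ _ _ _ _ (fun y a => G (phi y) a b)); last exact: sY.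
  by apply: filterS near_lin => y [_ +]; exact.
by move=> a; exact: smooth_fix.
Qed.

Lemma smooth_bilin_along : smooth_at x (fun y => G (phi y) (Y y) (Z y)).
Proof.
apply: (@smooth_at_slot _ _ _ _ _ _ (fun y b => G (phi y) (Y y) b)); last exact: sZ.
  by apply: filterS near_lin => y [+ _]; exact.
exact: smooth_fix2.
Qed.

Lemma lderive_bilin_along v : 'L_v (fun y => G (phi y) (Y y) (Z y)) x =
  'L_('L_v phi x) (fun r => G r (Y x) (Z x)) (phi x)
  + G (phi x) ('L_v Y x) (Z x) + G (phi x) (Y x) ('L_v Z x).
Proof.
have -> := @lderive_slot _ _ _ _ _ x v (fun y b => G (phi y) (Y y) b) Z; last 3 first.
- by apply: filterS near_lin => y [+ _]; exact.
- by move=> b; exact: smooth_fix2.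
- exact: sZ.
congr (_ + _).
have -> := @lderive_slot _ _ _ _ _ x v (fun y a => G (phi y) a (Z x)) Y; last 3 first.
- by apply: filterS near_lin => y [_ +]; exact.
- by move=> a; exact: smooth_fix.
- exact: sY.
congr (_ + _).
have [_ sG] := GP.
by apply: (@lderive_comp _ _ _ _ phi (fun r => G r (Y x) (Z x))); [exact: sphi|exact: sG].
Qed.

End bilinear_along.

(** The only access to values computed with any extension. One extension excludes the default value
    [0]; a property shared by all extensions then holds for the chosen one. *)
Lemma any_ofE {R : realType} n (E : set 'rV[R]_n) e0 (P : 'rV[R]_n -> Prop) :
  E e0 -> (forall e, E e -> P e) -> P (any_of E).
Proof.
by move=> Ee0 EP; apply: EP; rewrite /any_of; case: xgetP => [e ->//|/(_ e0)].
Qed.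

(* Vector identities are checked entrywise, after the derivatives have been
   generalized. *)
Ltac row_ring := let j := fresh "j" in apply/rowP => j; rewrite !mxE; ring.
Ltac gen_lderive := repeat match goal with
  |- context [@lderive ?R ?V ?W ?f ?a ?v] =>
    let t := fresh "t" in move: (@lderive R V W f a v) => t
  end.

(** * Charts *)

Section chart_theory.
Context {R : realType} {n : nat} {M : topologicalType}.
Implicit Types (c d : chart R n M) (q : M) (x y : 'rV[R]_n).

Lemma cinv_dom c x : cimg c setT x -> cdom c (cinv c x).
Proof. by move=> [q [cq _] <-]; rewrite cmapK. Qed.

Lemma cinvK c x : cimg c setT x -> cmap c (cinv c x) = x.
Proof. by move=> [q [cq _] <-]; rewrite cmapK. Qed.

Lemma cimg_map c q : cdom c q -> cimg c setT (cmap c q).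
Proof. by move=> cq; exists q. Qed.

Lemma cimgE c (U : set M) x : cimg c U x <-> cimg c setT x /\ U (cinv c x).
Proof.
split=> [[q [cq Uq] <-]|[[q [cq _] <-] Uq]]; first by rewrite cmapK//; split => //; exists q.
by exists q => //; split => //; rewrite -(cmapK cq).
Qed.

Lemma cimgT_open c : open (cimg c setT).
Proof. by rewrite /cimg setIT; exact: cimg_open. Qed.

Lemma near_cimg c q : cdom c q -> \forall x \near cmap c q, cimg c setT x.
Proof.
by move=> cq; apply: open_nbhs_nbhs; split; [exact: cimgT_open|exact: cimg_map].
Qed.

Lemma near_cdom c q : cdom c q -> \forall r \near q, cdom c r.
Proof. by move=> cq; apply: open_nbhs_nbhs; split => //; exact: cdom_open. Qed.

Lemma cinv_cts c q : cdom c q -> cinv c x @[x --> cmap c q] --> q.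
Proof.
move=> cq; have := @cinv_continuous _ _ _ c (cmap c q).
by rewrite /prop_for /continuous_at cmapK//; apply; exists q.
Qed.

Lemma near_chart c q (P : M -> Prop) : cdom c q -> (\forall r \near q, P r) ->
  \forall x \near cmap c q, P (cinv c x).
Proof. by move=> cq nP; apply: (cinv_cts cq). Qed.

Lemma near_chartV c q (P : 'rV[R]_n -> Prop) : cdom c q ->
  (\forall x \near cmap c q, P x) -> \forall r \near q, P (cmap c r).
Proof. by move=> cq nP; apply: (cmap_continuous cq). Qed.

Lemma cimg_open_set c (U : set M) : open U -> open (cimg c U).
Proof.
move=> oU; rewrite openE => x /cimgE[xc Ux]; rewrite /interior.
have cx := cinv_dom xc; rewrite -(cinvK xc).
have := near_chart cx (open_nbhs_nbhs (conj oU Ux)).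
by apply: filter_app; apply: filterS (near_cimg cx) => z zc Uz; apply/cimgE.
Qed.
End chart_theory.

(** Transition maps, components of vectors and local expressions of fields are locked so that
    unification treats them as opaque. *)
HB.lock Definition trans {R : realType} {n : nat} {M : topologicalType}
  (c d : chart R n M) := cmap d \o cinv c.
HB.lock Definition tco {R : realType} {n : nat} {M : manifold R n}
  (c : chart R n M) (q : M) (v : 'rV[R]_n) := tcoord c q v.
HB.lock Definition tve {R : realType} {n : nat} {M : manifold R n}
  (c : chart R n M) (x v : 'rV[R]_n) := tvec c x v.

HB.lock Definition cfield {R : realType} {n : nat} {M : manifold R n}
  (c : chart R n M) (X : vfield M) (x : 'rV[R]_n) := tco c (cinv c x) (X (cinv c x)).

Section atlas.
Context {R : realType} {n : nat} {M : manifold R n}.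

(** Slice charts need not be preferred charts, so all coordinate formulas are proved in arbitrary
    charts of the maximal atlas. *)
Record mchart := MChart {
  mchart_chart :> chart R n M;
  mchart_max : in_maximal_atlas mchart_chart
}.

Lemma chart_at_max (r : M) : in_maximal_atlas (chart_at r).
Proof. by move=> q; exact: chart_at_compatible. Qed.

Definition mchart_at (r : M) := MChart (chart_at_max r).

Lemma mchart_at_dom (r : M) : cdom (mchart_at r) r.
Proof. exact: chart_at_dom. Qed.

Implicit Types (c d e : mchart) (q r : M) (x y v : 'rV[R]_n) (X Y : vfield M).

Lemma trans_val (c d : chart R n M) x : trans c d x = cmap d (cinv c x).
Proof. by rewrite trans.unlock. Qed.

Lemma trans_comp c d e q : cdom c q -> cdom d q ->
  \forall x \near cmap c q, trans c e x = (trans d e \o trans c d) x.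
Proof.
move=> cq dq; apply: filterS (near_chart cq (near_cdom dq)) => x dx.
by rewrite /= !trans_val cmapK.
Qed.

Lemma trans_id c q : cdom c q -> \forall x \near cmap c q, trans c c x = x.
Proof. by move=> cq; apply: filterS (near_cimg cq) => x xc; rewrite trans_val cinvK. Qed.

Lemma transE c d q : cdom c q -> trans c d (cmap c q) = cmap d q.
Proof. by move=> cq; rewrite trans_val cmapK. Qed.

(** Membership in the maximal atlas only compares a chart with the preferred ones, so the transition
    is factored through the preferred chart at [q]. *)
Lemma trans_smooth c d q : cdom c q -> cdom d q -> smooth_at (cmap c q) (trans c d).
Proof.
move=> cq dq; have qq := mchart_at_dom q.
have sm (e f : mchart) : smooth_on (cimg e (cdom f)) (cmap f \o cinv e) ->
    cdom e q -> cdom f q -> smooth_at (cmap e q) (trans e f).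
  move=> s eq fq; rewrite trans.unlock; apply: (smooth_onP _ _).1 s _ _; first exact/cimg_open_set/cdom_open.
  by exists q.
apply: (@smooth_at_eq _ _ _ _ (trans (mchart_at q) d \o trans c (mchart_at q))).
  by have := trans_comp d cq qq; apply: filterS => x ->.
have [s1 _] := mchart_max c q; have [_ s2] := mchart_max d q.
apply: smooth_at_comp; first exact: sm.
by rewrite transE//; exact: sm.
Qed.

Lemma lderive_trans c d e q v : cdom c q -> cdom d q -> cdom e q ->
  'L_v (trans c e) (cmap c q) = 'L_('L_v (trans c d) (cmap c q)) (trans d e) (cmap d q).
Proof.
move=> cq dq eq.
rewrite (lderive_near v (trans_comp e cq dq)) lderive_comp ?(transE _ cq)//.
  exact: trans_smooth.
exact: trans_smooth.
Qed.

Lemma lderive_trans_id c q v : cdom c q -> 'L_v (trans c c) (cmap c q) = v.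
Proof. by move=> cq; rewrite (lderive_near v (trans_id cq)) lderive_id. Qed.

Lemma tcoordE (c : chart R n M) q v :
  tco c q v = 'L_v (trans (mchart_at q) c) (cmap (mchart_at q) q).
Proof. by rewrite tco.unlock trans.unlock lderive.unlock. Qed.

Lemma tvecE c q v : cdom c q -> tve c (cmap c q) v = 'L_v (trans c (mchart_at q)) (cmap c q).
Proof. by move=> cq; rewrite tve.unlock trans.unlock lderive.unlock /tvec (cmapK cq). Qed.

Lemma tcoord_trans c d q v : cdom c q -> cdom d q ->
  tco d q v = 'L_(tco c q v) (trans c d) (cmap c q).
Proof.
move=> cq dq; rewrite !tcoordE; apply: lderive_trans => //.
exact: mchart_at_dom.
Qed.

Lemma tcoord_at q v : tco (mchart_at q) q v = v.
Proof. by rewrite tcoordE lderive_trans_id//; exact: mchart_at_dom. Qed.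

Lemma tvecK c q v : cdom c q ->
  tco c q (tve c (cmap c q) v) = v.
Proof.
move=> cq; have qq := mchart_at_dom q; rewrite tcoordE tvecE//.
by rewrite -lderive_trans ?lderive_trans_id.
Qed.

Lemma tcoordK c q v : cdom c q ->
  tve c (cmap c q) (tco c q v) = v.
Proof.
move=> cq; have qq := mchart_at_dom q; rewrite tcoordE tvecE//.
by rewrite -lderive_trans ?lderive_trans_id.
Qed.

Lemma tcoord_linear c q : cdom c q -> linear (tco c q).
Proof.
move=> cq a u v; have qq := mchart_at_dom q.
by rewrite !tcoordE (lderive_linear (trans_smooth qq cq)).
Qed.

Lemma tvec_linear c q : cdom c q -> linear (tve c (cmap c q)).
Proof.
move=> cq a u v; have qq := mchart_at_dom q.
by rewrite !(tvecE _ cq) (lderive_linear (trans_smooth cq qq)).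
Qed.

Lemma tcoord_tvec c d q v : cdom c q -> cdom d q ->
  tco d q (tve c (cmap c q) v) = 'L_v (trans c d) (cmap c q).
Proof. by move=> cq dq; rewrite (tcoord_trans _ cq dq) tvecK. Qed.

Lemma smooth_derive_trans c d q a : cdom c q -> cdom d q -> smooth_at (cmap c q) (fun x => 'L_a (trans c d) x).
Proof. by move=> *; apply/smooth_at_lderive/trans_smooth. Qed.

Lemma near_derive_trans_linear c d q : cdom c q -> cdom d q ->
  \forall x \near cmap c q, linear (fun a => 'L_a (trans c d) x).
Proof.
by move=> cq dq; apply/near_lderive_linear/trans_smooth.
Qed.

Lemma cfield_val (c : chart R n M) X x :
  cfield c X x = tco c (cinv c x) (X (cinv c x)).
Proof. by rewrite cfield.unlock. Qed.

Lemma field_coordE q X : field_coord q X = cfield (mchart_at q) X.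
Proof. by rewrite cfield.unlock tco.unlock. Qed.

Lemma cfieldE c X q : cdom c q -> cfield c X (cmap c q) = tco c q (X q).
Proof. by move=> cq; rewrite cfield_val cmapK. Qed.

Lemma cfield_trans c d X q : cdom c q -> cdom d q -> \forall x \near cmap c q,
  cfield d X (trans c d x) = 'L_(cfield c X x) (trans c d) x.
Proof.
move=> cq dq.
have := near_chart cq (near_cdom dq).
apply: filter_app; apply: filterS (near_cimg cq) => x xc dx.
have cx := cinv_dom xc.
by rewrite -(cinvK xc) (transE _ cx) !cfieldE// (tcoord_trans _ cx dx).
Qed.

Lemma smooth_cfield_trans c d X q : cdom c q -> cdom d q ->
  smooth_at (cmap c q) (cfield c X) -> smooth_at (cmap d q) (cfield d X).
Proof.
move=> cq dq sX; have st := trans_smooth dq cq.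
apply: (@smooth_at_eq _ _ _ _
  ((fun x => 'L_(cfield c X x) (trans c d) x) \o trans d c)).
  have H := cfield_trans X cq dq.
  have := smooth_at_cont st; rewrite /prop_for /continuous_at (transE _ dq) => /(_ _ H).
  have := near_cimg dq.
  apply: filter_app2; apply: filterS (near_chart dq (near_cdom cq)) => x cx xd /= <-.
  by rewrite !trans_val cmapK// cinvK.
apply: smooth_at_comp; first exact: st.
rewrite (transE _ dq).
apply: (@smooth_at_slot _ _ _ _ _ _ (fun x a => 'L_a (trans c d) x)) => //.
  exact: near_derive_trans_linear.
by move=> a; exact: smooth_derive_trans.
Qed.

(** [smooth_near] refers to all preferred charts at once; by the transformation rule for fields a
    single chart around [q] decides. *)
Lemma smooth_nearP c X q : cdom c q ->
  smooth_near q X <-> smooth_at (cmap c q) (cfield c X).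
Proof.
move=> cq; split=> [[U [oU Uq] /(_ q)]|sX].
  rewrite field_coordE => /(smooth_onP _ (cimg_open_set oU)) /(_ (cmap (mchart_at q) q)).
  have qq := mchart_at_dom q.
  move=> H; apply: (@smooth_cfield_trans (mchart_at q)) ; [exact: qq|exact: cq|].
  by apply: H; exists q.
have := near_chartV cq (near_smooth_at sX); have := near_cdom cq.
rewrite -!nbhs_nearE !nbhsE => -[V [oV Vq] Vc] [W [oW Wq] WP].
exists (V `&` W); first by apply: open_nbhsI.
move=> a; rewrite field_coordE; apply/smooth_onP; first exact/cimg_open_set/openI.
move=> _ [r [ar [Vr Wr]] <-].
by apply: (@smooth_cfield_trans c (mchart_at a)); [exact: Vc|exact: ar|exact: WP].
Qed.

Lemma smooth_fun_nearI c (f : M -> R) q : cdom c q ->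
  smooth_at (cmap c q) (f \o cinv c) -> smooth_fun_near q f.
Proof.
move=> cq sX.
have := near_chartV cq (near_smooth_at sX); have := near_cdom cq.
rewrite -!nbhs_nearE !nbhsE => -[V [oV Vq] Vc] [W [oW Wq] WP].
exists (V `&` W); first by apply: open_nbhsI.
move=> a; apply/smooth_onP; first exact/cimg_open_set/openI.
move=> _ [r [ar [Vr Wr]] <-].
have cr := Vc _ Vr.
apply: (@smooth_at_eq _ _ _ _ ((f \o cinv c) \o trans (mchart_at a) c)).
  by apply: filterS (near_chart ar (near_cdom cr)) => x cx; rewrite /= trans_val cmapK.
apply: smooth_at_comp; first by apply: (@trans_smooth (mchart_at a) c).
by rewrite (@transE (mchart_at a))//; exact: WP.
Qed.

Lemma dir_derivE c (f : M -> R) q v : cdom c q ->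
  smooth_at (cmap c q) (f \o cinv c) ->
  dir_deriv q v f = 'L_(tco c q v) (f \o cinv c) (cmap c q).
Proof.
move=> cq; have qq := mchart_at_dom q; rewrite tcoordE -(transE c qq) => sf.
rewrite -(lderive_comp _ (trans_smooth qq cq) sf) /dir_deriv lderiveE.
apply: lderive_near.
apply: filterS (near_chart qq (near_cdom cq)) => x cx.
by rewrite /= trans_val (cmapK cx).
Qed.

Definition lift_field (c : chart R n M) (f : 'rV[R]_n -> 'rV[R]_n) : vfield M :=
  fun q => tve c (cmap c q) (f (cmap c q)).

Lemma lift_fieldK c f q : cdom c q ->
  \forall x \near cmap c q, cfield c (lift_field c f) x = f x.
Proof.
move=> cq; apply: filterS (near_cimg cq) => x xc.
by rewrite -{1}(cinvK xc) cfieldE ?tvecK ?cinvK//; exact: cinv_dom.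
Qed.

Lemma lift_field_smooth c f q : cdom c q ->
  smooth_at (cmap c q) f -> smooth_near q (lift_field c f).
Proof.
move=> cq sf; apply/(smooth_nearP _ cq); apply: smooth_at_eq sf.
by apply: filterS (lift_fieldK f cq) => x ->.
Qed.

Lemma lderive_cfield_trans c d X q v : cdom c q -> cdom d q -> smooth_near q X ->
  'L_(tco d q v) (cfield d X) (cmap d q) =
  'L_(tco c q v) ('L_(tco c q (X q)) (trans c d)) (cmap c q)
  + 'L_('L_(tco c q v) (cfield c X) (cmap c q)) (trans c d) (cmap c q).
Proof.
move=> cq dq sX.
have sXc := (smooth_nearP _ cq).1 sX; have sXd := (smooth_nearP _ dq).1 sX.
rewrite (tcoord_trans _ cq dq) -{1}(transE d cq) -lderive_comp; last 2 first.
  exact: trans_smooth.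
  by rewrite (transE _ cq).
rewrite (lderive_near _ (cfield_trans X cq dq)) -(cfieldE X cq).
apply: (@lderive_slot _ _ _ _ _ _ _ (fun x a => 'L_a (trans c d) x)).
- exact: near_derive_trans_linear.
- by move=> a; exact: smooth_derive_trans.
- exact: sXc.
Qed.

(** Under a change of charts, the second derivative of the transition map enters both terms and
    cancels by symmetry, so the formula defining the bracket in the preferred chart holds in every
    chart. *)
Lemma bracketE c X Y q : cdom c q ->
  smooth_near q X -> smooth_near q Y ->
  tco c q (bracket X Y q) = 'L_(tco c q (X q)) (cfield c Y) (cmap c q)
    - 'L_(tco c q (Y q)) (cfield c X) (cmap c q).
Proof.
move=> cq sX sY; have qq := mchart_at_dom q.
rewrite (lderive_cfield_trans _ qq cq sX) (lderive_cfield_trans _ qq cq sY) !tcoord_at.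
rewrite (lderive_swap _ _ _ (trans_smooth qq cq)) opprD addrACA subrr add0r.
rewrite -(linB (lderive_linear (trans_smooth qq cq))).
by rewrite /bracket !lderiveE !field_coordE tcoordE.
Qed.

Lemma near_smooth_near q X :
  smooth_near q X -> (\forall r \near q, smooth_near r X).
Proof.
move=> [U xU sU]; apply: filterS (open_nbhs_nbhs xU) => r Ur.
by exists U => //; case: xU.
Qed.

Lemma bracket_smooth X Y q : smooth_near q X -> smooth_near q Y ->
  smooth_near q (bracket X Y).
Proof.
move=> sX sY; have qq := mchart_at_dom q.
set c := mchart_at q in qq.
have sXc := (smooth_nearP _ qq).1 sX; have sYc := (smooth_nearP _ qq).1 sY.
apply/(smooth_nearP _ qq).
apply: smooth_at_eq (smooth_atB (smooth_dir_lderive _ sXc sYc) (smooth_dir_lderive _ sYc sXc)).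
have := near_chart qq (near_smooth_near sX); have := near_chart qq (near_smooth_near sY).
apply: filter_app2; apply: filterS (near_cimg qq) => x xc sYx sXx.
have cx := cinv_dom xc.
by rewrite -(cinvK xc) (cfieldE (bracket X Y) cx) (bracketE cx sXx sYx) !(cfieldE _ cx).
Qed.

Lemma timgE (A : M -> set 'rV[R]_n) c (U : set M) (xy : 'rV[R]_n * 'rV[R]_n) :
  timg c U A xy <-> cimg c U xy.1 /\ A (cinv c xy.1) (tve c xy.1 xy.2).
Proof. by rewrite tve.unlock. Qed.

(** * Functions on the tangent bundle under a change of charts *)

Section tangent_functions.
Variable A : M -> set 'rV[R]_n.

Lemma tvec_trans c d x y : cimg c (cdom d) x ->
  tve d (trans c d x) ('L_y (trans c d) x) = tve c x y.
Proof.
move=> /[dup] /cimgE[xc dx] _; have cx := cinv_dom xc.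
set q := cinv c x in dx cx; have <- : cmap c q = x by exact: cinvK.
by rewrite (transE _ cx) -(tcoord_tvec y cx dx) (tcoordK _ dx).
Qed.

Lemma ttrans_smooth c d q v : cdom c q -> cdom d q ->
  smooth_at (cmap c q, v) (fun xy => (trans c d xy.1, 'L_(xy.2) (trans c d) xy.1)).
Proof.
move=> cq dq.
have sfst : smooth_at (cmap c q, v) (@fst 'rV[R]_n 'rV[R]_n) by exact: smooth_at_lin.
have ssnd : smooth_at (cmap c q, v) (@snd 'rV[R]_n 'rV[R]_n) by exact: smooth_at_lin.
apply: smooth_at_pair.
  by apply: (@smooth_at_comp _ _ _ _ _ _ fst) => //; exact: trans_smooth.
apply: (@smooth_at_slot _ _ _ _ _ _ (fun xy a => 'L_a (trans c d) xy.1)); last exact: ssnd.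
  by have := near_fst v (near_derive_trans_linear cq dq).
move=> a; apply: (@smooth_at_comp _ _ _ _ _ _ fst (fun x => 'L_a (trans c d) x)); first exact: sfst.
exact: smooth_derive_trans.
Qed.

Lemma smooth_tfun_trans (F : normedModType R) (G : M -> 'rV[R]_n -> F) c d q v :
  cdom c q -> cdom d q ->
  smooth_at (cmap d q, tco d q v) (fun xy => G (cinv d xy.1) (tve d xy.1 xy.2)) ->
  smooth_at (cmap c q, tco c q v) (fun xy => G (cinv c xy.1) (tve c xy.1 xy.2)).
Proof.
move=> cq dq sG; have st := ttrans_smooth (tco c q v) cq dq.
apply: (@smooth_at_eq _ _ _ _ ((fun xy => G (cinv d xy.1) (tve d xy.1 xy.2)) \o
  (fun xy => (trans c d xy.1, 'L_(xy.2) (trans c d) xy.1)))); last first.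
  apply: smooth_at_comp; first exact: st.
  by rewrite /= (transE _ cq) -(tcoord_trans _ cq dq).
have : \forall x \near cmap c q, cimg c (cdom d) x.
  apply: open_nbhs_nbhs; split; first exact/cimg_open_set/cdom_open.
  by exists q.
move=> /(near_fst (tco c q v)).
apply: filterS => -[x y] /= xcd.
rewrite tvec_trans// trans_val cmapK//.
by move/cimgE : xcd => [].
Qed.

Lemma timg_nbhs c d q v : cdom c q -> cdom d q ->
  nbhs (cmap d q, tco d q v) (timg d setT A) ->
  nbhs (cmap c q, tco c q v) (timg c setT A).
Proof.
move=> cq dq nA; have st := ttrans_smooth (tco c q v) cq dq.
rewrite (tcoord_trans _ cq dq) -(transE d cq) in nA.
have nD := smooth_at_cont st nA.
have nx : nbhs (cmap c q) (cimg c (cdom d)).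
  apply: open_nbhs_nbhs; split; first exact/cimg_open_set/cdom_open.
  by exists q.
apply: filterS (filterI (near_fst (tco c q v) nx) nD) => -[a b] [/= /cimgE[ac da] Dt].
have [_ Dab] := (timgE _ _ _ _).1 (Dt : timg d setT A (trans c d a, 'L_b (trans c d) a)).
have E : tve d (trans c d a) ('L_b (trans c d) a) = tve c a b.
  by apply: tvec_trans; exact/cimgE.
have E2 : cinv d (trans c d a) = cinv c a by rewrite trans_val cmapK.
apply/timgE; split; first exact: ac.
by rewrite -E -E2.
Qed.

Lemma timg_open c U : (forall a : M, open (timg (chart_at a) setT A)) ->
  open U -> open (timg c U A).
Proof.
move=> oA oU; rewrite openE => -[x y] /timgE[/= /cimgE[xc Ux] Axy].
set q := cinv c x in Axy Ux; have cq : cdom c q := cinv_dom xc.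
have qq := mchart_at_dom q.
have xE : x = cmap c q by rewrite cinvK.
have yE : y = tco c q (tve c x y) by rewrite xE tvecK.
have nA : nbhs (cmap c q, tco c q (tve c x y)) (timg c setT A).
  apply: (timg_nbhs cq qq); apply: open_nbhs_nbhs; split; first exact: oA.
  apply/timgE; split; first exact: cimg_map.
  by rewrite /= (cmapK qq) (tcoordK _ qq).
rewrite -xE -yE in nA.
have nx : nbhs x (cimg c U).
  by apply: open_nbhs_nbhs; split; [exact: cimg_open_set|exact/cimgE].
apply: filterS (filterI (near_fst y nx) nA) => -[a b] [/= aU /timgE[_ Aab]].
exact/timgE.
Qed.

End tangent_functions.
End atlas.
Arguments mchart {R n} M.

(** * Local fields and tensoriality *)

Section fields.
Context {R : realType} {n : nat} {M : manifold R n}.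
Implicit Types (c : mchart M) (q : M) (X Y Z V : vfield M) (f : M -> R).

Lemma smooth_fun_nearE c f q : cdom c q ->
  smooth_fun_near q f -> smooth_at (cmap c q) (f \o cinv c).
Proof.
move=> cq [U [oU Uq] /(_ q)].
move=> /(smooth_onP _ (cimg_open_set oU)) /(_ (cmap (chart_at q) q)) sf.
have qq := mchart_at_dom q.
apply: (@smooth_at_eq _ _ _ _ ((f \o cinv (chart_at q)) \o trans c (mchart_at q))).
  by apply: filterS (near_chart cq (near_cdom qq)) => x qx; rewrite /= trans_val cmapK.
apply: smooth_at_comp; first exact: trans_smooth.
by rewrite (transE _ cq); apply: sf; exists q.
Qed.

Lemma near_cfield c q X Y Z (op : 'rV[R]_n -> 'rV[R]_n -> 'rV[R]_n) : cdom c q ->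
  (forall r, cdom c r -> tco c r (Z r) = op (tco c r (X r)) (tco c r (Y r))) ->
  \forall x \near cmap c q, op (cfield c X x) (cfield c Y x) = cfield c Z x.
Proof.
move=> cq H; apply: filterS (near_cimg cq) => x xc; have cx := cinv_dom xc.
by rewrite !cfield_val H.
Qed.

Lemma near_cfieldD c q X Y : cdom c q ->
  \forall x \near cmap c q, cfield c X x + cfield c Y x = cfield c (fun r => X r + Y r) x.
Proof.
by move=> cq; apply: (near_cfield cq) => r cr; rewrite (linD (tcoord_linear cr)).
Qed.

Lemma near_cfieldZ c q f X : cdom c q -> \forall x \near cmap c q,
  (f \o cinv c) x *: cfield c X x = cfield c (fun r => f r *: X r) x.
Proof.
move=> cq; apply: filterS (near_cimg cq) => x xc; have cx := cinv_dom xc.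
by rewrite !cfield_val (linZ (tcoord_linear cx)).
Qed.

Lemma smooth_nearD q X Y : smooth_near q X -> smooth_near q Y ->
  smooth_near q (fun r => X r + Y r).
Proof.
have qq := mchart_at_dom q.
move=> /(smooth_nearP _ qq) sX /(smooth_nearP _ qq) sY; apply/(smooth_nearP _ qq).
exact: smooth_at_eq (near_cfieldD _ _ qq) (smooth_atD sX sY).
Qed.

Lemma smooth_nearZ q f X : smooth_fun_near q f -> smooth_near q X ->
  smooth_near q (fun r => f r *: X r).
Proof.
have qq := mchart_at_dom q.
move=> /(smooth_fun_nearE qq) sf /(smooth_nearP _ qq) sX; apply/(smooth_nearP _ qq).
exact: smooth_at_eq (near_cfieldZ _ _ qq) (smooth_atZ sf sX).
Qed.

Lemma smooth_fun_near_cst q (a : R) : smooth_fun_near q (fun _ => a).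
Proof. by apply: (smooth_fun_nearI (mchart_at_dom q)); exact: smooth_at_cst. Qed.

Definition cst_field c (a : 'rV[R]_n) : vfield M := lift_field c (fun _ => a).

Lemma cst_field_smooth c a q : cdom c q -> smooth_near q (cst_field c a).
Proof. by move=> cq; apply: (lift_field_smooth cq); exact: smooth_at_cst. Qed.

Lemma tcoord_cst_field c a q : cdom c q -> tco c q (cst_field c a q) = a.
Proof. by move=> cq; rewrite /cst_field /lift_field tvecK. Qed.

Lemma lderive_cst_field c a q v : cdom c q -> 'L_v (cfield c (cst_field c a)) (cmap c q) = 0.
Proof.
move=> cq; rewrite (lderive_near v (lift_fieldK (fun _ => a) cq)).
exact: lderive_cst.
Qed.

Lemma cst_field_extension c a q : cdom c q -> extension q (tve c (cmap c q) a) (cst_field c a).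
Proof. by move=> cq; split => //; exact: cst_field_smooth. Qed.

Section tensorial.
Context (W : lmodType R) (B : vfield M -> W) (c : mchart M) (q : M).
Hypotheses (cq : cdom c q)
  (BD : forall X Y, smooth_near q X -> smooth_near q Y ->
    B (fun r => X r + Y r) = B X + B Y)
  (BZ : forall f X, smooth_fun_near q f -> smooth_near q X ->
    B (fun r => f r *: X r) = f q *: B X).

(** The indicator function of a neighbourhood plays the part of a bump function: it is smooth near
    [q], being constantly 1 there, and multiplying by it makes [X] and [Y] equal everywhere. *)
Lemma tensorial_germ X Y : smooth_near q X -> smooth_near q Y ->
  (\forall r \near q, X r = Y r) -> B X = B Y.
Proof.
move=> sX sY; rewrite /prop_near1 nbhsE => -[U [oU Uq] XY].
pose f (r : M) : R := if `[< U r >] then 1 else 0.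
have fU r : U r -> f r = 1 by rewrite /f; case: asboolP.
have sf : smooth_fun_near q f.
  apply: (smooth_fun_nearI cq); apply: smooth_at_eq (smooth_at_cst _ (1 : R)).
  by apply: filterS (near_chart cq (open_nbhs_nbhs (conj oU Uq))) => x Ux; rewrite /= fU.
have := BZ sf sX; have := BZ sf sY; rewrite (fU _ Uq) !scale1r => <- <-.
congr B; apply/funext => r; rewrite /f; case: asboolP => [/XY ->//|_].
by rewrite !scale0r.
Qed.

Lemma tensorial_sum (I : eqType) (s : seq I) (f : I -> M -> R) (E : I -> vfield M) :
  (forall j, smooth_fun_near q (f j)) -> (forall j, smooth_near q (E j)) ->
  smooth_near q (fun r => \sum_(j <- s) f j r *: E j r) /\
  B (fun r => \sum_(j <- s) f j r *: E j r) = \sum_(j <- s) f j q *: B (E j).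
Proof.
move=> sf sE; elim: s => [|j s [sS BS]].
  (* The two laws of [B] do not mention the zero field, so the empty sum is rewritten as the scalar
     0 times a smooth field. *)
  have z : (fun r => \sum_(j <- [::]) f j r *: E j r) = (fun r => 0 *: cst_field c 0 r).
    by apply/funext => r; rewrite big_nil scale0r.
  have s0 := smooth_fun_near_cst q 0; have sc := cst_field_smooth 0 cq.
  by rewrite z big_nil (BZ s0 sc) scale0r; split; [exact: smooth_nearZ|reflexivity].
have z : (fun r => \sum_(i <- j :: s) f i r *: E i r) =
    (fun r => f j r *: E j r + \sum_(i <- s) f i r *: E i r).
  by apply/funext => r; rewrite big_cons.
have sj := smooth_nearZ (sf j) (sE j).
rewrite z big_cons (BD sj sS) (BZ (sf j) (sE j)) BS.
by split; [exact: smooth_nearD|reflexivity].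
Qed.

(** Near [q] both fields are combinations of the coordinate frame. By [tensorial_sum] only the
    coefficients at [q] matter, and there they agree. *)
Lemma tensorialE X : smooth_near q X -> B X = B (cst_field c (tco c q (X q))).
Proof.
move=> sX; have sXc := (smooth_nearP _ cq).1 sX.
pose E (j : 'I_n) := cst_field c (delta_mx 0 j).
pose f (j : 'I_n) (r : M) := cfield c X (cmap c r) 0 j.
pose f0 (j : 'I_n) (r : M) := tco c q (X q) 0 j.
have sE j : smooth_near q (E j) by exact: cst_field_smooth.
have sf0 j : smooth_fun_near q (f0 j) by exact: smooth_fun_near_cst.
have sf j : smooth_fun_near q (f j).
  apply: (smooth_fun_nearI cq); apply: smooth_at_eq (smooth_at_entry 0 j sXc).
  by apply: filterS (near_cimg cq) => x xc; rewrite /f /= cinvK.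
have [sS BS] := tensorial_sum (index_enum 'I_n) sf sE.
have [sS0 BS0] := tensorial_sum (index_enum 'I_n) sf0 sE.
have sum_row (a : 'rV[R]_n) r : cdom c r -> \sum_j a 0 j *: E j r = tve c (cmap c r) a.
  move=> cr; rewrite {2}(row_sum_delta a) (lin_sum (tvec_linear cr)).
  by apply: eq_bigr => j _; rewrite (linZ (tvec_linear cr)).
transitivity (B (fun r => \sum_j f j r *: E j r)).
  apply: tensorial_germ; [exact: sX|exact: sS|].
  apply: filterS (near_cdom cq) => r cr.
  by rewrite /f (sum_row _ _ cr) (cfieldE _ cr) (tcoordK _ cr).
rewrite BS; transitivity (B (fun r => \sum_j f0 j r *: E j r)).
  by rewrite BS0; apply: eq_bigr => j _; rewrite /f (cfieldE _ cq).
apply: tensorial_germ; [exact: sS0|exact: cst_field_smooth|].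
by apply: filterS (near_cdom cq) => r cr; rewrite (sum_row _ _ cr).
Qed.

End tensorial.
End fields.

(** * Anisotropic connections in coordinates *)

HB.lock Definition christoffel {R : realType} {n : nat} {M : manifold R n}
  (nabla : connection_op (M := M)) (c : mchart M) (xy : 'rV[R]_n * 'rV[R]_n) (a b : 'rV[R]_n) :=
  tco c (cinv c xy.1)
    (nabla (cinv c xy.1) (tve c xy.1 xy.2) (cst_field c a) (cst_field c b)).

Section connection.
Context {R : realType} {n : nat} {M : manifold R n}.
Variables (A : M -> set 'rV[R]_n) (nabla : connection_op (M := M)).
Hypotheses (oA : forall a : M, open (timg (chart_at a) setT A))
  (acn : anisotropic_connection A nabla).
Implicit Types (c : mchart M) (q : M) (v : 'rV[R]_n) (X Y Z V : vfield M) (f : M -> R).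

Lemma timg_coord c q v : cdom c q -> A q v -> timg c setT A (cmap c q, tco c q v).
Proof.
move=> cq Av; apply/timgE; split; first exact: cimg_map.
by rewrite /= (cmapK cq) (tcoordK _ cq).
Qed.

(** The connection is tensorial in [X]. In [Y] it becomes tensorial once the coordinate derivative
    is subtracted, because the two Leibniz terms cancel. Both arguments can therefore be replaced by
    constant fields. *)
Lemma nablaE c q v X Y : cdom c q -> A q v -> smooth_near q X -> smooth_near q Y ->
  tco c q (nabla q v X Y) = 'L_(tco c q (X q)) (cfield c Y) (cmap c q)
    + christoffel nabla c (cmap c q, tco c q v) (tco c q (X q)) (tco c q (Y q)).
Proof.
move=> cq Av sX sY; set a := tco c q (X q).
have -> : nabla q v X Y = nabla q v (cst_field c a) Y.
  apply: (@tensorialE _ _ _ _ (fun X => nabla q v X Y)); [exact: cq| | |exact: sX].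
    by move=> X1 X2 s1 s2; exact: (ac_addl acn).
  by move=> f X1 sf s1; exact: (ac_linear acn).
have sa := cst_field_smooth a cq.
pose B Y := tco c q (nabla q v (cst_field c a) Y) - 'L_a (cfield c Y) (cmap c q).
have dY Z : smooth_near q Z -> smooth_at (cmap c q) (cfield c Z).
  by move/(smooth_nearP _ cq).
have tl := tcoord_linear cq.
have : B Y = B (cst_field c (tco c q (Y q))).
  apply: tensorialE; [exact: cq| | |exact: sY].
  - move=> Y1 Y2 s1 s2; rewrite /B (ac_addr acn Av sa s1 s2) (linD tl).
    rewrite -(lderive_near a (near_cfieldD Y1 Y2 cq)) lderiveD.
    + by rewrite opprD addrACA.
    + exact: dY.
    + exact: dY.
  - move=> f Y1 sf s1; rewrite /B (ac_leibniz acn Av sf sa s1) (linD tl) !(linZ tl).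
    rewrite -(lderive_near a (near_cfieldZ f Y1 cq)).
    have df := smooth_fun_nearE cq sf.
    rewrite lderiveZ; [|exact: df|exact: dY].
    rewrite (dir_derivE _ cq df) (tcoord_cst_field _ cq) (cfieldE _ cq) /= (cmapK cq).
    move: (nabla q v (cst_field c a) Y1) (Y1 q) => w1 w2.
    move: (tco c q w1) (tco c q w2) => {}w1 {}w2; gen_lderive; row_ring.
rewrite /B (lderive_cst_field _ _ cq) subr0 => /eqP; rewrite subr_eq => /eqP ->.
by rewrite [LHS]addrC christoffel.unlock /= (cmapK cq) (tcoordK _ cq).
Qed.

Section at_point.
Context (c : mchart M) (q : M) (v : 'rV[R]_n).
Hypotheses (cq : cdom c q) (Av : A q v).

Let xy := (cmap c q, tco c q v).

Lemma christoffel_linearl b : linear (fun a => christoffel nabla c xy a b).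
Proof.
move=> s a1 a2 /=.
have sb := cst_field_smooth b cq.
have s1 := cst_field_smooth a1 cq; have s2 := cst_field_smooth a2 cq.
have ss := smooth_fun_near_cst q s.
have s1' := smooth_nearZ ss s1.
have s12 := smooth_nearD s1' s2.
have tl := tcoord_linear cq.
have := nablaE cq Av s12 sb.
rewrite (ac_addl acn Av s1' s2 sb) (ac_linear acn Av ss s1 sb) !(linD tl) !(linZ tl).
have E1 := nablaE cq Av s1 sb; have E2 := nablaE cq Av s2 sb.
rewrite (lderive_cst_field b _ cq) add0r !(tcoord_cst_field _ cq) in E1.
rewrite (lderive_cst_field b _ cq) add0r !(tcoord_cst_field _ cq) in E2.
rewrite E1 E2 (lderive_cst_field b _ cq) !(tcoord_cst_field _ cq) => ->.
by rewrite add0r.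
Qed.

Lemma christoffel_linearr a : linear (christoffel nabla c xy a).
Proof.
move=> s b1 b2 /=.
have sa := cst_field_smooth a cq.
have s1 := cst_field_smooth b1 cq; have s2 := cst_field_smooth b2 cq.
have ss := smooth_fun_near_cst q s.
have s1' := smooth_nearZ ss s1.
have s12 := smooth_nearD s1' s2.
have tl := tcoord_linear cq.
have D0 : 'L_(tco c q (cst_field c a q))
    (cfield c (fun r => s *: cst_field c b1 r + cst_field c b2 r)) (cmap c q) = 0.
  have E : \forall x \near cmap c q, s *: b1 + b2 =
      cfield c (fun r => s *: cst_field c b1 r + cst_field c b2 r) x.
    apply: filterS (near_cimg cq) => x xc; have cx := cinv_dom xc.
    by rewrite cfield_val (linD (tcoord_linear cx)) (linZ (tcoord_linear cx)) !(tcoord_cst_field _ cx).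
  by rewrite -(lderive_near _ E) lderive_cst.
have := nablaE cq Av sa s12.
rewrite D0 add0r (ac_addr acn Av sa s1' s2) (ac_leibniz acn Av ss sa s1).
rewrite (_ : dir_deriv q _ (fun _ => s) = 0); last exact: derive_cst.
rewrite scale0r add0r.
rewrite !(linD tl) !(linZ tl).
have E1 := nablaE cq Av sa s1; have E2 := nablaE cq Av sa s2.
rewrite (lderive_cst_field b1 _ cq) add0r !(tcoord_cst_field _ cq) in E1.
rewrite (lderive_cst_field b2 _ cq) add0r !(tcoord_cst_field _ cq) in E2.
by rewrite E1 E2 !(tcoord_cst_field _ cq) => ->.
Qed.

(** [ac_smooth] requires both fields on one open set and speaks of preferred charts. The fields are
    restricted to a common neighbourhood, then the argument and the value are both moved to the
    chart [c]. *)
Lemma smooth_near_nabla X Y : smooth_near q X -> smooth_near q Y ->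
  smooth_at xy (fun zw => tco c (cinv c zw.1) (nabla (cinv c zw.1) (tve c zw.1 zw.2) X Y)).
Proof.
case=> U1 [oU1 U1q] sX; case=> U2 [oU2 U2q] sY.
have oU : open (U1 `&` U2) by exact: openI.
have res (U U' : set M) X' : open U -> open U' -> U `<=` U' -> smooth_field_on U' X' -> smooth_field_on U X'.
  move=> oV oV' UU' s a; apply/(smooth_onP _ (cimg_open_set oV)) => x /cimgE[xc Ux].
  apply: (smooth_onP _ (cimg_open_set oV')).1 (s a) _ _.
  by apply/cimgE; split => //; exact: UU'.
have s1 : smooth_field_on (U1 `&` U2) X by apply: (res _ _ _ oU oU1 _ sX) => r [].
have s2 : smooth_field_on (U1 `&` U2) Y by apply: (res _ _ _ oU oU2 _ sY) => r [].
have qq := mchart_at_dom q.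
have sN : smooth_on (timg (mchart_at q) (U1 `&` U2) A)
    (fun zw => tco (mchart_at q) (cinv (mchart_at q) zw.1)
      (nabla (cinv (mchart_at q) zw.1) (tve (mchart_at q) zw.1 zw.2) X Y)).
  by have := ac_smooth acn oU s1 s2 q; rewrite tco.unlock tve.unlock.
have oT : open (timg (mchart_at q) (U1 `&` U2) A) by exact: timg_open.
have {}sN := (smooth_onP _ oT).1 sN (cmap (mchart_at q) q, tco (mchart_at q) q v).
have {}sN := sN ((timgE _ _ _ _).2 (conj _ _)).
have Hc : cimg (mchart_at q) (U1 `&` U2) (cmap (mchart_at q) q) by exists q.
have HA : A (cinv (mchart_at q) (cmap (mchart_at q) q))
    (tve (mchart_at q) (cmap (mchart_at q) q) (tco (mchart_at q) q v)).
  by rewrite (cmapK qq) (tcoordK _ qq).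
have {Hc HA}sN := sN Hc HA.
have sM := @smooth_tfun_trans _ _ _ _ (fun r w => tco (mchart_at q) r (nabla r w X Y)) _ _ _ _ cq qq sN.
apply: (@smooth_at_eq _ _ _ _ (fun zw =>
   'L_(tco (mchart_at q) (cinv c zw.1) (nabla (cinv c zw.1) (tve c zw.1 zw.2) X Y))
     (trans (mchart_at q) c) (trans c (mchart_at q) zw.1))).
  have nq : \forall z \near cmap c q, cimg c (cdom (mchart_at q)) z.
    apply: open_nbhs_nbhs; split; first exact/cimg_open_set/cdom_open.
    by exists q.
  apply: filterS (near_fst (tco c q v) nq) => -[z w] /= /cimgE[zc qz].
  rewrite trans_val; symmetry.
  exact: (@tcoord_trans _ _ _ (mchart_at q) c _ _ qz (cinv_dom zc)).
have sfst : smooth_at xy (@fst 'rV[R]_n 'rV[R]_n) by exact: smooth_at_lin.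
have sfst2 : smooth_at xy (trans c (mchart_at q) \o fst).
  by apply: smooth_at_comp; first exact: sfst; exact: trans_smooth.
have sA a : smooth_at xy (fun zw => 'L_a (trans (mchart_at q) c) (trans c (mchart_at q) zw.1)).
  apply: (@smooth_at_comp _ _ _ _ _ _ (trans c (mchart_at q) \o fst)
    (fun z => 'L_a (trans (mchart_at q) c) z)); first exact: sfst2.
  have := smooth_derive_trans a qq cq; rewrite -(transE _ cq).
  by [].
apply: (@smooth_at_slot _ _ _ _ _ _ (fun zw a => 'L_a (trans (mchart_at q) c) (trans c (mchart_at q) zw.1))); [|exact: sA|exact: sM].
have nl := near_derive_trans_linear qq cq; rewrite -(transE _ cq) in nl.
by have := smooth_at_cont sfst2 nl.
Qed.

Lemma christoffel_smooth a b : smooth_at xy (fun zw => christoffel nabla c zw a b).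
Proof. by rewrite christoffel.unlock; apply: smooth_near_nabla; exact: cst_field_smooth. Qed.

End at_point.

Lemma timg_coordP c zw : timg c setT A zw ->
  zw = (cmap c (cinv c zw.1), tco c (cinv c zw.1) (tve c zw.1 zw.2)) /\
  [/\ cdom c (cinv c zw.1) & A (cinv c zw.1) (tve c zw.1 zw.2)].
Proof.
case: zw => x y /timgE[/= xc Axy]; have cx := cinv_dom xc; split; last by split.
by have := tvecK y cx; rewrite (cinvK xc) => ->.
Qed.

Lemma near_timg c zw : timg c setT A zw -> \forall z \near zw, timg c setT A z.
Proof.
by move=> Azw; apply: open_nbhs_nbhs; split => //; exact: timg_open oA openT.
Qed.

Lemma christoffel_bilin c zw : timg c setT A zw -> bilin_smooth_at zw (christoffel nabla c).
Proof.
move=> Azw; split=> [|a b]; last first.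
  have [E [cq Aq]] := timg_coordP Azw; rewrite E; exact: (christoffel_smooth cq Aq).
apply: filterS (near_timg Azw) => z Az; have [E [cq Aq]] := timg_coordP Az; rewrite E.
by split=> [a|b]; [exact: (christoffel_linearr cq Aq)|exact: (christoffel_linearl cq Aq)].
Qed.

Lemma admissible_coord c q V : cdom c q -> admissible_near A q V ->
  smooth_at (cmap c q) (cfield c V) /\
  \forall x \near cmap c q, timg c setT A (x, cfield c V x).
Proof.
move=> cq [sV AV]; split; first exact/(smooth_nearP _ cq).
have := near_chart cq AV; apply: filter_app; apply: filterS (near_cimg cq) => x xc AVx.
have cx := cinv_dom xc; apply/timgE; split => //=.
by rewrite cfield_val -{2}(cinvK xc) tcoordK.
Qed.

Lemma near_along c q V X Y : cdom c q -> admissible_near A q V ->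
  smooth_near q X -> smooth_near q Y -> \forall x \near cmap c q,
  cfield c (along nabla V X Y) x = 'L_(cfield c X x) (cfield c Y) x
    + christoffel nabla c (x, cfield c V x) (cfield c X x) (cfield c Y x).
Proof.
move=> cq [sV AV] sX sY.
have := near_chart cq AV; have := near_chart cq (near_smooth_near sX).
have := near_chart cq (near_smooth_near sY).
apply: filter_app3; apply: filterS (near_cimg cq) => x xc sYx sXx AVx.
have cx := cinv_dom xc.
have E := nablaE cx AVx sXx sYx.
by rewrite -(cinvK xc) !(cfieldE _ cx) /along.
Qed.

Lemma along_smooth q V X Y : admissible_near A q V ->
  smooth_near q X -> smooth_near q Y -> smooth_near q (along nabla V X Y).
Proof.
move=> aV sX sY; have qq := mchart_at_dom q; apply/(smooth_nearP _ qq).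
have sXc := (smooth_nearP _ qq).1 sX; have sYc := (smooth_nearP _ qq).1 sY.
have [sVc AVc] := admissible_coord qq aV.
apply: (@smooth_at_eq _ _ _ _ (fun x => 'L_(cfield (mchart_at q) X x) (cfield (mchart_at q) Y) x
    + christoffel nabla (mchart_at q) (x, cfield (mchart_at q) V x) (cfield (mchart_at q) X x) (cfield (mchart_at q) Y x))).
  by apply: filterS (near_along qq aV sX sY) => x ->.
apply: smooth_atD; first exact: smooth_dir_lderive.
apply: (@smooth_bilin_along _ _ _ _ _ _ _ _ _ _ _ (fun x => (x, cfield (mchart_at q) V x))) => //.
  exact/christoffel_bilin/(nbhs_singleton AVc).
by apply: smooth_at_pair => //; exact: smooth_at_id.
Qed.

Lemma vertical_derivE c q v x y z : cdom c q -> A q v ->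
  tco c q (vertical_deriv nabla q v x y z) =
  'L_(0, tco c q z) (fun zw => christoffel nabla c zw (tco c q x) (tco c q y))
    (cmap c q, tco c q v).
Proof.
move=> cq Av; have tl := tcoord_linear cq; have tvl := tvec_linear cq.
have ex a : extension q a (cst_field c (tco c q a)).
  by rewrite -{1}(tcoordK a cq); exact: cst_field_extension.
rewrite /vertical_deriv; set E := (X in any_of X).
have [e Ee] : exists e, E e.
  eexists; exists (cst_field c (tco c q x)), (cst_field c (tco c q y)).
  by split; [exact: ex|exact: ex|reflexivity].
apply: (@any_ofE _ _ _ _ (fun e => tco c q e = _) Ee) => {e Ee}.
move=> _ [X [Y [[sX Xq] [sY Yq] ->]]]; rewrite lderiveE.
pose F (w : 'rV[R]_n) := 'L_(tco c q x) (cfield c Y) (cmap c q) +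
  christoffel nabla c (cmap c q, w) (tco c q x) (tco c q y).
have stc : smooth_at v (tco c q) by exact: smooth_at_lin.
have spair : smooth_at v (fun w => (cmap c q, tco c q w)).
  by apply: smooth_at_pair => //; exact: smooth_at_cst.
have Azw := timg_coord cq Av.
have sG := christoffel_smooth cq Av (tco c q x) (tco c q y).
have sF : smooth_at v (F \o tco c q).
  apply: smooth_atD; first exact: smooth_at_cst.
  exact: (@smooth_at_comp _ _ _ _ _ _ _ (fun zw => christoffel nabla c zw (tco c q x) (tco c q y)) spair).
have nE : \forall w \near v, tve c (cmap c q) ((F \o tco c q) w) = nabla q w X Y.
  have nA : \forall w \near v, A q w.
    have H : \forall w \near v, timg c setT A (cmap c q, tco c q w).
      by have := smooth_at_cont spair (near_timg Azw).
    by apply: filterS H => w /timgE[/= _]; rewrite (cmapK cq) (tcoordK _ cq).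
  apply: filterS nA => w Aw; rewrite /F /= -{1 2}Xq -Yq -(nablaE cq Aw sX sY).
  by rewrite (tcoordK _ cq).
rewrite -(lderive_near z nE) (@lderive_comp _ _ _ _ _ (tve c (cmap c q)) _ _ sF); last exact: smooth_at_lin.
rewrite (lderive_lin _ _ tvl) (tvecK _ cq).
rewrite lderiveD; last 2 first.
  exact: smooth_at_cst.
  exact: (@smooth_at_comp _ _ _ _ _ _ _ (fun zw => christoffel nabla c zw (tco c q x) (tco c q y)) spair).
rewrite lderive_cst add0r.
rewrite (@lderive_comp _ _ _ _ _ (fun zw => christoffel nabla c zw (tco c q x) (tco c q y)) _ _ spair sG).
by rewrite (lderive_pair _ (smooth_at_cst _ _) stc) lderive_cst (lderive_lin _ _ tl).
Qed.

(* The curvature in terms of the Christoffel symbols [G]: the derivative of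
   [G] is taken along the horizontal lift of the first argument. *)
Definition curvature_coord (G : 'rV[R]_n * 'rV[R]_n -> 'rV[R]_n -> 'rV[R]_n -> 'rV[R]_n)
    zw a b e :=
  ('L_(a, - G zw a zw.2) (fun p => G p b e) zw + G zw a (G zw b e))
  - ('L_(b, - G zw b zw.2) (fun p => G p a e) zw + G zw b (G zw a e)).

Lemma along_alongE c q V X Y Z : cdom c q -> admissible_near A q V ->
  smooth_near q X -> smooth_near q Y -> smooth_near q Z ->
  let x := cmap c q in let zw := (x, cfield c V x) in
  let a := cfield c X x in let b := cfield c Y x in let e := cfield c Z x in
  let G := christoffel nabla c in
  tco c q (along nabla V X (along nabla V Y Z) q) =
   ('L_a ('L_b (cfield c Z)) x + 'L_('L_a (cfield c Y) x) (cfield c Z) x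
    + ('L_(a, 'L_a (cfield c V) x) (fun p => G p b e) zw
       + G zw ('L_a (cfield c Y) x) e + G zw b ('L_a (cfield c Z) x)))
   + (G zw a ('L_b (cfield c Z) x) + G zw a (G zw b e)).
Proof.
move=> cq aV sX sY sZ x zw a b e G.
have sXc := (smooth_nearP _ cq).1 sX; have sYc := (smooth_nearP _ cq).1 sY.
have sZc := (smooth_nearP _ cq).1 sZ.
have [sVc AVc] := admissible_coord cq aV.
have sYZ := along_smooth aV sY sZ.
have AV : A q (V q) by case: aV => _ /nbhs_singleton.
have bG := christoffel_bilin (nbhs_singleton AVc).
have nYZ := near_along cq aV sY sZ.
have spair : smooth_at x (fun z => (z, cfield c V z)).
  by apply: smooth_at_pair => //; exact: smooth_at_id.
rewrite /along (nablaE cq AV sX sYZ) -!(cfieldE _ cq) -/x -/a.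
rewrite (nbhs_singleton nYZ) -/x -/b -/e -/zw -/G.
have sD : smooth_at x (fun z => 'L_(cfield c Y z) (cfield c Z) z) by exact: smooth_dir_lderive.
have sB : smooth_at x (fun z => G (z, cfield c V z) (cfield c Y z) (cfield c Z z)).
  exact: (@smooth_bilin_along _ _ _ _ _ _ _ _ _ _ _ (fun x => (x, cfield c V x))).
have -> : 'L_a (cfield c (along nabla V Y Z)) x =
    'L_a (fun z => 'L_(cfield c Y z) (cfield c Z) z) x
    + 'L_a (fun z => G (z, cfield c V z) (cfield c Y z) (cfield c Z z)) x.
  by rewrite (lderive_near a nYZ); exact: lderiveD.
rewrite (lderive_dir_lderive _ a sYc sZc).
have -> : 'L_a (fun z => G (z, cfield c V z) (cfield c Y z) (cfield c Z z)) x =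
    'L_(a, 'L_a (cfield c V) x) (fun p => G p b e) zw
       + G zw ('L_a (cfield c Y) x) e + G zw b ('L_a (cfield c Z) x).
  have -> := @lderive_bilin_along _ _ _ _ _ _ _ _ _ _ _ _ _ _ bG spair sYc sZc a.
  by rewrite (lderive_pair _ (smooth_at_id _ _) sVc) lderive_id.
have GD := linD (christoffel_linearr cq AV a).
rewrite -(cfieldE V cq) -/x -/zw -/G in GD.
by rewrite GD.
Qed.

(** Differentiating the symbols along the field [V] produces the direction [(a, 'L_a V)]. The
    correction by the vertical derivative removes [(0, 'L_a V + G(a, v))] and leaves the horizontal
    direction [(a, - G(a, v))], from which the extension has disappeared. The derivatives of [X] and
    [Y] are absorbed by the bracket, and the second derivatives of [Z] cancel by symmetry. *)
Lemma curvatureE c q v x y z : cdom c q -> A q v ->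
  tco c q (curvature A nabla q v x y z) =
  curvature_coord (christoffel nabla c) (cmap c q, tco c q v)
    (tco c q x) (tco c q y) (tco c q z).
Proof.
move=> cq Av; have tl := tcoord_linear cq.
have ex w : extension q w (cst_field c (tco c q w)).
  by rewrite -{1}(tcoordK w cq); exact: cst_field_extension.
(* An element of the set of values is needed: the extension with constant components stays in the
   cone near [q] because the cone is open. *)
have av : admissible_extension A q v (cst_field c (tco c q v)).
  have [sv vq] := ex v; split => //; split => //.
  have spair : smooth_at (cmap c q) (fun w : 'rV[R]_n => (w, tco c q v)).
    by apply: smooth_at_pair; [exact: smooth_at_id|exact: smooth_at_cst].
  have := near_chartV cq (smooth_at_cont spair (near_timg (timg_coord cq Av))).
  apply: filter_app; apply: filterS (near_cdom cq) => r cr /timgE[/= _].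
  by rewrite cmapK.
rewrite /curvature.
set E := (X in any_of X).
have [e Ee] : exists e, E e.
  eexists; exists (cst_field c (tco c q v)), (cst_field c (tco c q x)),
   (cst_field c (tco c q y)), (cst_field c (tco c q z)); split; [exact: av|exact: ex|exact: ex|exact: ex|reflexivity].
apply: (@any_ofE _ _ _ _ (fun e => tco c q e = _) Ee) => {e Ee}.
move=> _ [V [X [Y [Z [[aV Vq] [sX Xq] [sY Yq] [sZ Zq] ->]]]]].
have Vc := cfieldE V cq; have Xc := cfieldE X cq; have Yc := cfieldE Y cq; have Zc := cfieldE Z cq.
rewrite Vq in Vc; rewrite Xq in Xc; rewrite Yq in Yc; rewrite Zq in Zc.
have AV : A q (V q) by rewrite Vq.
have sV : smooth_near q V by case: aV.
have sXY := bracket_smooth sX sY.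
have tD a b e : tco c q (a - b + e) = tco c q a - tco c q b + tco c q e.
  by rewrite (linD tl) (linB tl).
have tB a b e : tco c q (a - b - e) = tco c q a - tco c q b - tco c q e.
  by rewrite !(linB tl).
rewrite tD /affine_curvature tB.
rewrite [X in X - _ - _ - _ + _](along_alongE cq aV sX sY sZ).
rewrite [X in _ - X - _ - _ + _](along_alongE cq aV sY sX sZ).
rewrite [X in _ - _ - X - _ + _](nablaE cq AV sXY sZ) (bracketE cq sX sY).
rewrite [X in _ - _ - _ - X + _](vertical_derivE y z _ cq Av).
rewrite [X in _ - _ - _ - _ + X](vertical_derivE x z _ cq Av).
have -> : tco c q (along nabla V X V q) = _ := nablaE cq AV sX sV.
have -> : tco c q (along nabla V Y V q) = _ := nablaE cq AV sY sV.
rewrite Vq Xq Yq Zq Vc Xc Yc Zc.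
have sZc := (smooth_nearP _ cq).1 sZ.
rewrite (lderive_swap _ _ _ sZc) /curvature_coord.
set p := (cmap c q, tco c q v); have -> : p.2 = tco c q v by [].
have GL b := linB (christoffel_linearl cq Av b); rewrite -/p in GL.
have dG a b : smooth_at p (fun r => christoffel nabla c r a b).
  exact: christoffel_smooth.
have dd s t a b := lderive_split (dG a b) s t.
have dl a b := lderive_snd_linear (dG a b).
move: (tco c q v) (tco c q x) (tco c q y) (tco c q z) => v1 a b w.
rewrite (dd a ('L_a _ _)) (dd b ('L_b _ _)) (dd a (- _)) (dd b (- _)).
rewrite !(linD (dl _ _)) !(linN (dl _ _)) GL.
rewrite (linB (lderive_linear sZc)).
gen_lderive.
set G := christoffel nabla c p.
repeat match goal with |- context [G ?a ?b] => let g := fresh "g" in move: (G a b) => g end.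
row_ring.
Qed.

End connection.

Section derive_reparam.
Context {R : realType}.

(** An equality of difference quotients, so that it can be used under [funext] at vectors outside
    the cone, where nothing is known about [L]. *)
Lemma derive_along_lin (E E' F : normedModType R) (T : E' -> E) (f : E -> F) y a :
  linear T -> 'D_(T a) f (T y) = 'D_a (f \o T) y.
Proof.
move=> lT; rewrite /derive.
rewrite (_ : (fun h : R => _) = fun h : R => h^-1 *: ((f \o T \o shift y) (h *: a) - (f \o T) y))//.
by apply/funext => h; rewrite /= /shift /= (linD lT) (linZ lT).
Qed.

Lemma derive_slice (E E' F : normedModType R) (f : E * E' -> F) x y a :
  'D_(0, a) f (x, y) = 'D_a (fun y => f (x, y)) y.
Proof.
rewrite /derive.
rewrite (_ : (fun h : R => _) = fun h : R => h^-1 *: (((fun y => f (x, y)) \o shift y) (h *: a) - f (x, y)))//.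
apply/funext => h; rewrite /= /shift /=.
have -> : h *: (0, a) + (x, y) = (h *: 0 + x, h *: a + y) :> E * E' by [].
by rewrite scaler0 add0r.
Qed.

Lemma lderive_slice (E E' F : normedModType R) (f : E * E' -> F) x y a :
  'L_(0, a) f (x, y) = 'L_a (fun y => f (x, y)) y.
Proof. by rewrite lderive.unlock derive_slice. Qed.

End derive_reparam.

(** * The fundamental and Cartan tensors in coordinates *)

HB.lock Definition metric {R : realType} {n : nat} {M : manifold R n}
  (L : M -> 'rV[R]_n -> R) (c : mchart M) (xy : 'rV[R]_n * 'rV[R]_n) (a b : 'rV[R]_n) :=
  fundamental L (cinv c xy.1) (tve c xy.1 xy.2) (tve c xy.1 a) (tve c xy.1 b).

Section metric.
Context {R : realType} {n : nat} {M : manifold R n}.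
Variables (A : M -> set 'rV[R]_n) (L : M -> 'rV[R]_n -> R).
Hypothesis pf : pseudo_finsler_metric A L.
Implicit Types (c : mchart M) (q : M) (xy : 'rV[R]_n * 'rV[R]_n) (v a b e : 'rV[R]_n).

Let oA := pf_open pf.

Definition metric_fun c xy : R := L (cinv c xy.1) (tve c xy.1 xy.2).

Lemma metric_fun_smooth c xy : timg c setT A xy -> smooth_at xy (metric_fun c).
Proof.
move=> Axy; have [E [cq Aq]] := timg_coordP Axy; rewrite E.
set q := cinv c xy.1 in cq Aq *; set v := tve c xy.1 xy.2 in Aq *.
have qq := mchart_at_dom q.
apply: (@smooth_tfun_trans _ _ _ _ L _ _ _ _ cq qq).
have sL : smooth_on (timg (mchart_at q) setT A)
    (fun zw => L (cinv (mchart_at q) zw.1) (tve (mchart_at q) zw.1 zw.2)).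
  by have := pf_smooth pf q; rewrite tve.unlock.
have oT : open (timg (mchart_at q) setT A) := @oA q.
by have := (smooth_onP _ oT).1 sL _ (timg_coord qq Aq).
Qed.

Lemma tve_linear_at c x : cimg c setT x -> linear (tve c x).
Proof. by move=> xc; rewrite -(cinvK xc); apply: tvec_linear; exact: cinv_dom. Qed.

Lemma metricE c xy a b : cimg c setT xy.1 ->
  metric L c xy a b = 2^-1 * 'L_(0, a) (fun p => 'L_(0, b) (metric_fun c) p) xy.
Proof.
case: xy => x y /= xc; have lT := tve_linear_at xc.
have E w : 'D_(tve c x b) (L (cinv c x)) (tve c x w) = 'L_(0, b) (metric_fun c) (x, w).
  by rewrite (derive_along_lin _ _ _ lT) lderiveE lderive_slice.
rewrite metric.unlock /fundamental /= (derive_along_lin _ _ _ lT); congr (_ * _).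
rewrite lderiveE lderive_slice; congr (lderive _ _ _); apply/funext => w.
exact: E.
Qed.

Lemma fundamentalE c q v a b : cdom c q ->
  fundamental L q v a b = metric L c (cmap c q, tco c q v) (tco c q a) (tco c q b).
Proof. by move=> cq; rewrite metric.unlock /= (cmapK cq) !(tcoordK _ cq). Qed.

Lemma cartanE c q v a b e : cdom c q ->
  2 * cartan L q v a b e = 'L_(0, tco c q e)
    (fun p => metric L c p (tco c q a) (tco c q b)) (cmap c q, tco c q v).
Proof.
move=> cq; rewrite /cartan mulrA divff ?mul1r// lderive_slice.
have lT := tvec_linear cq.
rewrite -{1}(tcoordK e cq) -{1}(tcoordK v cq) (derive_along_lin _ _ _ lT) lderiveE.
congr (lderive _ _ _); apply/funext => w.
by rewrite /= (fundamentalE _ _ _ cq) (tvecK _ cq).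
Qed.

Section at_point.
Context (c : mchart M) (xy : 'rV[R]_n * 'rV[R]_n).
Hypothesis Axy : timg c setT A xy.

Let sL := metric_fun_smooth Axy.

Let nearA := near_timg oA Axy.

Lemma near_metricE a b : \forall p \near xy,
  2^-1 *: 'L_(0, a) (fun p => 'L_(0, b) (metric_fun c) p) p = metric L c p a b.
Proof.
by apply: filterS nearA => p /timgE[pc _]; rewrite (metricE _ _ pc).
Qed.

Lemma metric_smooth a b : smooth_at xy (fun p => metric L c p a b).
Proof.
apply: (smooth_at_eq (near_metricE a b)).
apply: smooth_atZ; first exact: smooth_at_cst.
by do 2!apply: smooth_at_lderive.
Qed.

Let pc : cimg c setT xy.1. Proof. by case/timgE: Axy. Qed.

Lemma metric_sym a b : metric L c xy a b = metric L c xy b a.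
Proof. by rewrite !(metricE _ _ pc) (lderive_swap _ _ _ sL). Qed.

Lemma metric_linearl b : linear (fun a => metric L c xy a b).
Proof.
move=> s a a' /=; rewrite !(metricE _ _ pc).
have lD := lderive_snd_linear (smooth_at_lderive (0, b) sL).
by rewrite lD mulrDr; congr (_ + _); rewrite [RHS]mulrCA.
Qed.

Lemma metric_linearr a : linear (metric L c xy a).
Proof.
by move=> s b b'; rewrite !(metric_sym a) (metric_linearl a).
Qed.

(** Total symmetry of the Cartan tensor: up to the constant factor, both sides are third vertical
    derivatives of [L], and these commute. *)
Lemma metric_cycle a b e : 'L_(0, e) (fun p => metric L c p a b) xy =
  'L_(0, a) (fun p => metric L c p b e) xy.
Proof.
have sLb := smooth_at_lderive (0, b) sL; have sLe := smooth_at_lderive (0, e) sL.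
have half (h : 'rV[R]_n) (f : 'rV[R]_n * 'rV[R]_n -> R) : smooth_at xy f ->
    'L_(0, h) (fun p => 2^-1 *: f p) xy = 2^-1 *: 'L_(0, h) f xy.
  move=> sf; rewrite lderiveZ//; last exact: smooth_at_cst.
  by rewrite lderive_cst scale0r add0r.
rewrite -(lderive_near _ (near_metricE a b)) -(lderive_near _ (near_metricE b e)).
rewrite !half; last 2 first.
- by do 2!apply: smooth_at_lderive.
- by do 2!apply: smooth_at_lderive.
congr (_ *: _); rewrite (lderive_swap _ _ _ sLb); apply: lderive_near.
by apply: filterS (near_smooth_at sL) => p sp; exact: lderive_swap.
Qed.

End at_point.

Lemma metric_bilin c xy : timg c setT A xy -> bilin_smooth_at xy (metric L c).
Proof.
move=> Axy; split=> [|a b]; last exact: metric_smooth.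
apply: filterS (near_timg oA Axy) => p Ap.
by split=> [a|b]; [exact: metric_linearr|exact: metric_linearl].
Qed.

Section compat.
Variable nabla : connection_op (M := M).
Hypothesis lcc : levi_civita_chern A L nabla.

(** The metric condition is applied to fields with constant components, the reference field [V]
    included. Then the derivative of [V] along the first field is [G(a, v)], and by symmetry the
    Cartan term is the vertical derivative of the metric along it. Moved to the left, it turns the
    derivative along [(a, 0)] into the horizontal one. *)
Lemma metric_compat c xy a b e : timg c setT A xy ->
  'L_(a, - christoffel nabla c xy a xy.2) (fun p => metric L c p b e) xy =
  metric L c xy (christoffel nabla c xy a b) e + metric L c xy b (christoffel nabla c xy a e).
Proof.
move=> Axy; have acn := lcc_connection lcc.
have sg := metric_smooth Axy b e.
rewrite (lderive_split sg) (linN (lderive_snd_linear sg)).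
apply/eqP; rewrite subr_eq; apply/eqP.
have [E [cq Aq]] := timg_coordP Axy.
set q := cinv c xy.1 in cq Aq E; set v := tve c xy.1 xy.2 in Aq E.
have y2 : xy.2 = tco c q v by rewrite E.
have sc h := cst_field_smooth h cq.
pose V := cst_field c (tco c q v).
have Vq : V q = v by rewrite /V /cst_field /lift_field (tcoordK _ cq).
have nA : \forall x \near cmap c q, timg c setT A (x, tco c q v).
  have spair : smooth_at (cmap c q) (fun w : 'rV[R]_n => (w, tco c q v)).
    by apply: smooth_at_pair; [exact: smooth_at_id|exact: smooth_at_cst].
  by rewrite E in Axy; have := smooth_at_cont spair (near_timg oA Axy).
have aV : admissible_near A q V.
  split; first exact: sc.
  have := near_chartV cq nA; apply: filter_app; apply: filterS (near_cdom cq) => r cr /timgE[/= _].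
  by rewrite (cmapK cr).
have := lcc_metric lcc aV (sc a) (sc b) (sc e).
have G h : tco c q (along nabla V (cst_field c a) (cst_field c h) q) = christoffel nabla c xy a h.
  rewrite /along Vq (nablaE acn cq Aq (sc a) (sc h)) (lderive_cst_field _ _ cq) add0r.
  by rewrite !(tcoord_cst_field _ cq) E.
rewrite !(fundamentalE _ _ _ cq) (cartanE _ _ _ _ cq) !(tcoord_cst_field _ cq) !G -E.
rewrite -y2 (metric_cycle Axy _ b e) => <-.
pose F := fun p => metric L c p b e.
have spair : smooth_at (cmap c q) (fun w : 'rV[R]_n => (w, tco c q v)).
  by apply: smooth_at_pair; [exact: smooth_at_id|exact: smooth_at_cst].
have sF : smooth_at (cmap c q) (F \o (fun w : 'rV[R]_n => (w, tco c q v))).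
  by apply: smooth_at_comp; [exact: spair|rewrite -E].
have nE : \forall x \near cmap c q, (F \o (fun w : 'rV[R]_n => (w, tco c q v))) x =
   ((fun r => fundamental L r (V r) (cst_field c b r) (cst_field c e r)) \o cinv c) x.
  apply: filterS (near_cimg cq) => x xc; have cx := cinv_dom xc.
  by rewrite /= (fundamentalE _ _ _ cx) !(tcoord_cst_field _ cx) (cinvK xc).
rewrite (dir_derivE _ cq (smooth_at_eq nE sF)) -(lderive_near _ nE).
rewrite (tcoord_cst_field _ cq) (lderive_comp _ spair); last by rewrite -E.
rewrite (lderive_pair _ (smooth_at_id _ _) (smooth_at_cst _ _)) lderive_id lderive_cst.
by rewrite -E.
Qed.

End compat.
End metric.

(** * Slice charts *)

Section inclusion.
Context {R : realType} {k l : nat}.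

Definition inc (a : 'rV[R]_k) : 'rV[R]_(k + l) := row_mx a 0.

Lemma inc_linear : linear inc.
Proof. by move=> s a b; rewrite /inc scale_row_mx add_row_mx scaler0 addr0. Qed.

Lemma incK : cancel inc lsubmx.
Proof. by move=> a; rewrite /inc row_mxKl. Qed.

Lemma inc_smooth x : smooth_at x inc.
Proof. exact: smooth_at_lin inc_linear. Qed.

Lemma lsubmx_smooth (x : 'rV[R]_(k + l)) : smooth_at x (fun z => lsubmx z : 'rV[R]_k).
Proof. by apply: smooth_at_lin => s a b; rewrite linearP. Qed.

Lemma lderive_inc x v : 'L_v inc x = inc v.
Proof. exact: lderive_lin inc_linear. Qed.

(** [II] depends on a point of [S] and an ambient vector, whereas the symbols of [M] depend on a
    point of [M] and an ambient vector. [tanp] and [incpp] are the two corresponding embeddings of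
    the tangent bundle of [S]. *)
Definition tanp (r : 'rV[R]_k * 'rV[R]_k) : 'rV[R]_k * 'rV[R]_(k + l) := (r.1, inc r.2).
Definition incpp (r : 'rV[R]_k * 'rV[R]_k) : 'rV[R]_(k + l) * 'rV[R]_(k + l) :=
  (inc r.1, inc r.2).

Lemma tanp_linear : linear tanp.
Proof. by move=> s r r'; rewrite /tanp /= inc_linear. Qed.

Lemma incpp_linear : linear incpp.
Proof. by move=> s r r'; rewrite /incpp /= !inc_linear. Qed.

End inclusion.

(** Components are linear on each fibre, so taking them commutes with vertical derivatives. The
    identification of [Phi] with the smooth [f] is asked only near [v], since it comes from formulas
    valid on the cone. *)
Lemma vderiv_coord {R : realType} {n n' : nat} {M : manifold R n} {M' : manifold R n'}
    (c : mchart M) (d : mchart M') q q' (Phi : 'rV[R]_n -> 'rV[R]_n') f v z :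
  cdom c q -> cdom d q' -> smooth_at (tco c q v) f ->
  (\forall w \near v, tco d q' (Phi w) = f (tco c q w)) ->
  tco d q' ('D_z Phi v) = 'L_(tco c q z) f (tco c q v).
Proof.
move=> cq dq sf nE; have lc := tcoord_linear cq; have ld := tvec_linear dq.
have sc : smooth_at v (tco c q) by exact: smooth_at_lin.
have nE2 : \forall w \near v, (tve d (cmap d q') \o (f \o tco c q)) w = Phi w.
  by apply: filterS nE => w /= <-; rewrite (tcoordK _ dq).
have sfc : smooth_at v (f \o tco c q) by exact: smooth_at_comp.
rewrite lderiveE -(lderive_near _ nE2) (lderive_comp _ sfc); last exact: smooth_at_lin.
rewrite (lderive_lin _ _ ld) (tvecK _ dq) (lderive_comp _ sc sf).
by rewrite (lderive_lin _ _ lc).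
Qed.

Section slice.
Context {R : realType} {k l : nat} {S : manifold R k} {M : manifold R (k + l)}.
Variables (i : S -> M) (d : mchart S) (c : mchart M).
Hypotheses (dom : cdom d = i @^-1` cdom c)
  (slice : forall q, cdom d q -> cmap c (i q) = inc (cmap d q)).
Implicit Types (q : S) (u v w : 'rV[R]_k) (x y : 'rV[R]_k).

Lemma slice_dom q : cdom d q -> cdom c (i q).
Proof. by rewrite dom. Qed.

Lemma slice_cinv x : cimg d setT x -> i (cinv d x) = cinv c (inc x).
Proof.
move=> xd; have dx := cinv_dom xd.
by rewrite -{2}(cinvK xd) -slice// cmapK//; exact: slice_dom.
Qed.

Lemma slice_cimg x : cimg d setT x -> cimg c setT (inc x).
Proof.
move=> xd; have dx := cinv_dom xd; rewrite -(cinvK xd) -slice//.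
by apply: cimg_map; exact: slice_dom.
Qed.

Lemma tmap_tve q u : cdom d q -> tmap i q u = tve c (cmap c (i q)) (inc (tco d q u)).
Proof.
move=> dq; have cq := slice_dom dq; have qq := mchart_at_dom q.
have qq' := mchart_at_dom (i q).
rewrite (tvecE _ cq) slice//.
have st := trans_smooth qq dq; have st' := trans_smooth cq qq'.
have sit : smooth_at (cmap (mchart_at q) q) (@inc R k l \o trans (mchart_at q) d).
  by apply: (@smooth_at_comp _ _ _ _ _ _ (trans (mchart_at q) d) (@inc R k l)); [exact: st|exact: inc_smooth].
have nE : \forall x \near cmap (mchart_at q) q,
    (trans c (mchart_at (i q)) \o (inc \o trans (mchart_at q) d)) x =
    (cmap (chart_at (i q)) \o i \o cinv (chart_at q)) x.
  apply: filterS (near_chart qq (near_cdom dq)) => x dx.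
  by rewrite /= !trans_val -slice// cmapK//; exact: slice_dom.
rewrite /tmap lderiveE -(lderive_near _ nE) (lderive_comp _ sit); last first.
  by rewrite /= (transE _ qq) -slice.
rewrite (lderive_comp _ st (inc_smooth _)) lderive_inc -tcoordE.
by rewrite /= (transE _ qq).
Qed.

Lemma tmapE q u : cdom d q -> tco c (i q) (tmap i q u) = inc (tco d q u).
Proof. by move=> dq; rewrite tmap_tve// tvecK//; exact: slice_dom. Qed.

Section cone.
Variable A : M -> set 'rV[R]_(k + l).

Lemma timg_slice x y : cimg d setT x ->
  timg d setT (sub_cone i A) (x, y) <-> timg c setT A (inc x, inc y).
Proof.
move=> xd; have dx := cinv_dom xd; rewrite !timgE /= /sub_cone /preimage /=.
have -> : tmap i (cinv d x) (tve d x y) = tve c (inc x) (inc y).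
  rewrite tmap_tve// slice// (cinvK xd).
  by have := tvecK y dx; rewrite (cinvK xd) => ->.
rewrite slice_cinv//; split=> -[_ Ay]; split => //; exact: slice_cimg.
Qed.

Lemma nbhs_slice_cone q v : (forall a : M, open (timg (chart_at a) setT A)) ->
  cdom d q -> sub_cone i A q v -> nbhs (cmap d q, tco d q v) (timg d setT (sub_cone i A)).
Proof.
move=> oA dq Av; have cq := slice_dom dq.
have : timg c setT A (inc (cmap d q), inc (tco d q v)).
  by rewrite -slice// -tmapE//; exact: timg_coord.
move=> /(near_timg oA) nA.
have si : smooth_at (cmap d q, tco d q v) (@incpp R k l).
  by exact: smooth_at_lin incpp_linear.
have := smooth_at_cont si nA => {}nA.
have nd := near_fst (tco d q v) (near_cimg dq).
apply: filterS (filterI nd nA) => -[x y] [/= xd Axy].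
exact/timg_slice.
Qed.

End cone.
End slice.

Section sub_open.
Context {R : realType} {k l : nat} {S : manifold R k} {M : manifold R (k + l)}.
Variable i : S -> M.
Hypothesis sub : submanifold i.

Lemma slice_charts (p : S) : exists (d : mchart S) (c : mchart M),
  [/\ cdom d p, cdom d = i @^-1` cdom c
    & forall q, cdom d q -> cmap c (i q) = inc (cmap d q)].
Proof.
have [_ /(_ p) [d [c [md mc dp dom sl]]]] := sub.
by exists (MChart md), (MChart mc).
Qed.

(** The general lemmas on connections, applied to [S], require its cone to be open. In a slice chart
    that cone is the preimage of the ambient one under a linear inclusion, and the property is then
    carried to the preferred chart. *)
Lemma sub_cone_open (A : M -> set 'rV[R]_(k + l)) (a : S) :
  (forall a : M, open (timg (chart_at a) setT A)) ->
  open (timg (chart_at a) setT (sub_cone i A)).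
Proof.
move=> oA; rewrite openE => xy /(@timg_coordP _ _ _ _ (mchart_at a)) [E [aq Aq]].
rewrite E; set q := cinv _ _ in aq Aq *.
have [d [c [dq dom sl]]] := slice_charts q.
by have := timg_nbhs aq dq (nbhs_slice_cone dom sl oA dq Aq).
Qed.

End sub_open.

(** * Tangential and normal components *)

Section normal.
Context {R : realType} {k l : nat} {S : manifold R k} {M : manifold R (k + l)}.
Variables (i : S -> M) (A : M -> set 'rV[R]_(k + l)) (L : M -> 'rV[R]_(k + l) -> R).
Hypotheses (pf : pseudo_finsler_metric A L) (Hnd : nondegenerate_submanifold i A L).
Variables (d : mchart S) (c : mchart M).
Hypotheses (dom : cdom d = i @^-1` cdom c)
  (slice : forall q, cdom d q -> cmap c (i q) = inc (cmap d q)).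
Implicit Types (q : S) (x : 'rV[R]_k) (y e : 'rV[R]_(k + l)) (p : 'rV[R]_k * 'rV[R]_(k + l)).

Let oA := pf_open pf.

Definition incp p : 'rV[R]_(k + l) * 'rV[R]_(k + l) := (inc p.1, p.2).

Definition pairing p e : 'rV[R]_k := \row_s metric L c (incp p) e (inc (delta_mx 0 s)).
Definition gram p : 'M[R]_k := \matrix_(r, s) metric L c (incp p) (inc (delta_mx 0 r)) (inc (delta_mx 0 s)).
(** The places, over [S] but not necessarily tangent to it, where the orthogonal decomposition
    exists. Non-degeneracy is stated through the Gram determinant because this condition is visibly
    open, which differentiating [II] in all directions requires. *)
Definition regular p := [/\ cimg d setT p.1, timg c setT A (incp p) & \det (gram p) != 0].
(** Solution of the linear system which says that [e] and its tangential part have the same products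
    with the coordinate vectors of [S]. *)
Definition tanc p e : 'rV[R]_k := pairing p e *m invmx (gram p).
Definition norc p e : 'rV[R]_(k + l) := e - inc (tanc p e).

Lemma incp_smooth p : smooth_at p incp.
Proof.
apply: smooth_at_pair; apply: smooth_at_lin => s a b //=; exact: inc_linear.
Qed.

Section at_cone.
Variable p : 'rV[R]_k * 'rV[R]_(k + l).
Hypothesis Ap : timg c setT A (incp p).

Lemma metric_incp_smooth a b : smooth_at p (fun p => metric L c (incp p) a b).
Proof.
apply: (@smooth_at_comp _ _ _ _ _ _ incp (fun z => metric L c z a b)).
  exact: incp_smooth.
exact: (metric_smooth pf Ap).
Qed.

Lemma gram_smooth : smooth_at p gram.
Proof.
by apply: smooth_at_mx => r s; under eq_fun do rewrite mxE; exact: metric_incp_smooth.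
Qed.

Lemma pairing_linear : linear (pairing p).
Proof.
by move=> s a b; apply/rowP => j; rewrite !mxE (metric_linearl pf Ap).
Qed.

Lemma pairing_inc u : pairing p (inc u) = u *m gram p.
Proof.
apply/rowP => j; rewrite !mxE {1}(row_sum_delta u) (lin_sum inc_linear).
rewrite (lin_sum (f := fun e => metric L c (incp p) e (inc (delta_mx 0 j)))); last first.
  exact: (metric_linearl pf Ap).
apply: eq_bigr => r _; rewrite (linZ inc_linear) mxE.
by rewrite (linZ (f := fun e => metric L c (incp p) e (inc (delta_mx 0 j)))) //; exact: (metric_linearl pf Ap).
Qed.

Lemma pairing0P e : pairing p e = 0 <-> forall b, metric L c (incp p) e (inc b) = 0.
Proof.
split=> [/rowP pe b|H]; last by apply/rowP => j; rewrite !mxE H.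
rewrite (row_sum_delta b) (lin_sum inc_linear) (lin_sum (metric_linearr pf Ap e)).
apply: big1 => j _; rewrite (linZ inc_linear) (linZ (metric_linearr pf Ap e)).
by have := pe j; rewrite !mxE => ->; rewrite scaler0.
Qed.

End at_cone.

Section at_point.
Variable p : 'rV[R]_k * 'rV[R]_(k + l).
Hypothesis reg : regular p.

Let Ap : timg c setT A (incp p). Proof. by case: reg. Qed.

Lemma near_regular : \forall r \near p, regular r.
Proof.
have [pd _ gp] := reg.
have n1 : \forall r \near p, cimg d setT r.1.
  case: p pd => x y /= xd; apply: near_fst; apply: open_nbhs_nbhs; split => //.
  exact: cimgT_open.
have n2 : \forall r \near p, timg c setT A (incp r).
  by have := smooth_at_cont (incp_smooth p) (near_timg oA Ap).
have n3 : \forall r \near p, \det (gram r) != 0.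
  have n0 : nbhs (\det (gram p)) [set r : R | r != 0].
    by apply: open_nbhs_nbhs; split; [exact: open_neq|].
  by have := smooth_at_cont (smooth_at_det (gram_smooth Ap)) n0.
apply: filterS (filterI n1 (filterI n2 n3)) => r [rd [rA rg]].
exact: (And3 rd rA rg).
Qed.

Lemma tanc_linear : linear (tanc p).
Proof. by move=> s a b; rewrite /tanc (pairing_linear Ap) mulmxDl -scalemxAl. Qed.

Lemma norc_linear : linear (norc p).
Proof.
move=> s a b; rewrite /norc tanc_linear inc_linear.
by rewrite scalerBr opprD addrACA.
Qed.

Let gu : gram p \in unitmx.
Proof. by case: reg => _ _; rewrite unitmxE unitfE. Qed.

Lemma pairing_norc e : pairing p (norc p e) = 0.
Proof.
by rewrite /norc (linB (pairing_linear Ap)) (pairing_inc Ap) /tanc mulmxKV// subrr.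
Qed.

Lemma norc_orth e b : metric L c (incp p) (norc p e) (inc b) = 0.
Proof. by have /(pairing0P Ap) := pairing_norc e; apply. Qed.

Lemma tanc_unique e u : (forall b, metric L c (incp p) (e - inc u) (inc b) = 0) ->
  u = tanc p e.
Proof.
move=> /(pairing0P Ap); rewrite (linB (pairing_linear Ap)) (pairing_inc Ap) => /eqP.
by rewrite subr_eq0 /tanc => /eqP ->; rewrite mulmxK.
Qed.

Lemma tanc_inc u : tanc p (inc u) = u.
Proof. by rewrite /tanc (pairing_inc Ap) mulmxK. Qed.

Lemma norc_inc u : norc p (inc u) = 0.
Proof. by rewrite /norc tanc_inc subrr. Qed.

Lemma norcK e : norc p (norc p e) = norc p e.
Proof. by rewrite {2}/norc (linB norc_linear) norc_inc subr0. Qed.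

Lemma norc_tanc e : e = inc (tanc p e) + norc p e.
Proof. by rewrite /norc addrC subrK. Qed.

Lemma metric_norc n e : (forall b, metric L c (incp p) n (inc b) = 0) ->
  metric L c (incp p) (norc p e) n = metric L c (incp p) e n.
Proof.
move=> Hn; rewrite (metric_sym pf Ap) [RHS](metric_sym pf Ap).
by rewrite /norc (linB (metric_linearr pf Ap n)) Hn subr0.
Qed.

Lemma tanc_smooth e : smooth_at p (fun p => tanc p e).
Proof.
apply: smooth_at_mulmx; last by apply: smooth_at_invmx; [case: reg|exact: (gram_smooth Ap)].
by apply: smooth_at_mx => r s; under eq_fun do rewrite mxE; exact: (metric_incp_smooth Ap).
Qed.

Lemma norc_smooth e : smooth_at p (fun p => norc p e).
Proof.
apply: smooth_atB; first exact: smooth_at_cst.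
apply: (@smooth_at_comp _ _ _ _ _ _ (fun p => tanc p e) inc); last exact: inc_smooth.
exact: tanc_smooth.
Qed.

End at_point.

(** A row vector in the kernel of the Gram matrix is a tangent vector orthogonal to the whole
    tangent space of [S], hence zero by non-degeneracy. *)
Lemma regular_tangent (x y : 'rV[R]_k) :
  timg d setT (sub_cone i A) (x, y) -> regular (x, inc y).
Proof.
move=> Axy; have [E [dq Aq]] := timg_coordP Axy.
have xd : cimg d setT x by case/timgE: Axy.
have Ai : timg c setT A (incp (x, inc y)) by exact/(timg_slice dom slice).
split => //; apply/negP => /eqP /eqP /det0P [u u0 ug].
move/eqP: u0; apply; set q := cinv d (x, y).1 in dq Aq E.
case: E => xE yE; have cq := slice_dom dom dq.
rewrite -(tvecK u dq) (Hnd Aq (u := tve d (cmap d q) u)) ?(lin0 (tcoord_linear dq))// => w.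
have /(pairing0P Ai) /(_ (tco d q w)) H := etrans (pairing_inc Ai u) ug.
rewrite (fundamentalE _ _ _ _ cq) (slice dq).
rewrite [X in metric _ _ (_, X)](tmapE dom slice _ dq) [X in metric _ _ _ X](tmapE dom slice _ dq).
rewrite [X in metric _ _ _ _ X](tmapE dom slice _ dq) (tvecK u dq).
by move: H; rewrite /incp /= {1}xE {1}yE.
Qed.

End normal.

Lemma smooth_snd_slice {R : realType} {E E' F : normedModType R} (fE : findim E) (fE' : findim E')
    (f : E * E' -> F) (x0 : E) (y0 : E') :
  smooth_at (x0, y0) f -> smooth_at y0 (fun y => f (x0, y)).
Proof.
move=> sf; apply: (@smooth_at_comp _ _ _ _ _ _ (fun y => (x0, y)) f) => //.
by apply: smooth_at_pair; [exact: smooth_at_cst|exact: smooth_at_id].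
Qed.

(** * Coordinate expressions of the second fundamental form and of the difference tensor *)

Section sub_formulas.
Context {R : realType} {k l : nat} {S : manifold R k} {M : manifold R (k + l)}.
Variables (i : S -> M) (A : M -> set 'rV[R]_(k + l)) (L : M -> 'rV[R]_(k + l) -> R).
Variables (nablaM : connection_op (M := M)) (nablaS : connection_op (M := S)).
Hypotheses (pf : pseudo_finsler_metric A L) (Hnd : nondegenerate_submanifold i A L)
  (acM : anisotropic_connection A nablaM)
  (acS : anisotropic_connection (sub_cone i A) nablaS)
  (oS : forall a : S, open (timg (chart_at a) setT (sub_cone i A))).
Variables (d : mchart S) (c : mchart M).
Hypotheses (dom : cdom d = i @^-1` cdom c)
  (slice : forall q, cdom d q -> cmap c (i q) = inc (cmap d q)).
Implicit Types (q : S) (X Y Z : vfield S) (p : 'rV[R]_k * 'rV[R]_(k + l)).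

Let oA := pf_open pf.
Let GM := christoffel nablaM c.
Let GS := christoffel nablaS d.
Let tmapEq := tmapE dom slice.

Definition base q (w : 'rV[R]_(k + l)) := (cmap d q, tco c (i q) w).

Lemma incp_base q w : cdom d q -> incp (base q w) = (cmap c (i q), tco c (i q) w).
Proof. by move=> dq; rewrite /incp /base slice. Qed.

Lemma base_tmap q v : cdom d q -> base q (tmap i q v) = (cmap d q, inc (tco d q v)).
Proof. by move=> dq; rewrite /base tmapEq. Qed.

Lemma regular_tmap q v : cdom d q -> sub_cone i A q v ->
  regular A L d c (base q (tmap i q v)).
Proof.
move=> dq Av; rewrite base_tmap//; apply: (regular_tangent pf Hnd dom slice).
exact: timg_coord.
Qed.

Lemma tan_partE q w e : cdom d q -> regular A L d c (base q w) ->
  tco d q (tan_part i L q w e) = tanc L c (base q w) (tco c (i q) e).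
Proof.
move=> dq reg; have cq := slice_dom dom dq.
have gE u b : fundamental L (i q) w (e - tmap i q u) (tmap i q b) =
    metric L c (incp (base q w)) (tco c (i q) e - inc (tco d q u)) (inc (tco d q b)).
  by rewrite (fundamentalE _ _ _ _ cq) (linB (tcoord_linear cq)) !tmapEq// incp_base.
apply: (@any_ofE _ _ _ (tve d (cmap d q) (tanc L c (base q w) (tco c (i q) e)))
    (fun u => tco d q u = _)) => [b|u Hu].
  by rewrite gE (tvecK _ dq); exact: (norc_orth pf reg).
apply: (tanc_unique pf reg) => b.
by have := Hu (tve d (cmap d q) b); rewrite gE (tvecK _ dq).
Qed.

Lemma nor_partE q w e : cdom d q -> regular A L d c (base q w) ->
  tco c (i q) (nor_part i L q w e) = norc L c (base q w) (tco c (i q) e).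
Proof.
move=> dq reg; have cq := slice_dom dom dq.
by rewrite /nor_part (linB (tcoord_linear cq)) tmapEq// tan_partE.
Qed.

Definition scoord (W : S -> 'rV[R]_(k + l)) x := tco c (i (cinv d x)) (W (cinv d x)).

Lemma scoordE W q : cdom d q -> scoord W (cmap d q) = tco c (i q) (W q).
Proof. by move=> dq; rewrite /scoord (cmapK dq). Qed.

Lemma near_scoord_push Y q : cdom d q ->
  \forall x \near cmap d q, inc (cfield d Y x) = scoord (push i Y) x.
Proof.
move=> dq; apply: filterS (near_cimg dq) => x xd; have dx := cinv_dom xd.
by rewrite /scoord /push cfield_val tmapEq.
Qed.

Lemma scoord_push_smooth Y q : cdom d q -> smooth_near q Y ->
  smooth_at (cmap d q) (scoord (push i Y)).
Proof.
move=> dq /(smooth_nearP _ dq) sY; apply: (smooth_at_eq (near_scoord_push Y dq)).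
by apply: (@smooth_at_comp _ _ _ _ _ _ (cfield d Y) inc); [exact: sY|exact: inc_smooth].
Qed.

(** The extension has components that do not depend on the last [l] slice coordinates. *)
Lemma extension_alongI W q : cdom d q -> smooth_at (cmap d q) (scoord W) ->
  extension_along i q W (lift_field c (fun z => scoord W (lsubmx z))).
Proof.
move=> dq sW; have cq := slice_dom dom dq; split.
  apply: (lift_field_smooth cq); rewrite slice//.
  apply: (@smooth_at_comp _ _ _ _ _ _ (fun z : 'rV[R]_(k + l) => lsubmx z) (scoord W)).
    exact: lsubmx_smooth.
  by rewrite incK.
apply: filterS (near_cdom dq) => r dr; have cr := slice_dom dom dr.
by rewrite /lift_field {2}slice// incK scoordE// tcoordK.
Qed.

(** The direction of differentiation is tangent to [S], so the chain rule replaces the derivative of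
    any extension [Wb] by that of its restriction to [S]. *)
Lemma ambientE q w X W : cdom d q -> A (i q) w -> smooth_near q X ->
  smooth_at (cmap d q) (scoord W) ->
  tco c (i q) (ambient i nablaM q w X W) =
  'L_(tco d q (X q)) (scoord W) (cmap d q)
  + GM (incp (base q w)) (inc (tco d q (X q))) (tco c (i q) (W q)).
Proof.
move=> dq Aw sX sW; have cq := slice_dom dom dq.
have eX := extension_alongI dq (scoord_push_smooth dq sX).
have eW := extension_alongI dq sW.
rewrite /ambient; set E := (X in any_of X).
have [e Ee] : exists e, E e by eexists; do 2!eexists; split; [exact: eX|exact: eW|reflexivity].
apply: (@any_ofE _ _ _ _ (fun e => tco c (i q) e = _) Ee) => {e Ee}.
move=> _ [Xb [Wb [[sXb nX] [sWb nW] ->]]].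
rewrite (nablaE acM cq Aw sXb sWb) (nbhs_singleton nX) (nbhs_singleton nW) /push tmapEq//.
rewrite incp_base// /GM; congr (_ + _).
have sWc := (smooth_nearP _ cq).1 sWb; rewrite slice// in sWc *.
have nE : \forall x \near cmap d q, (cfield c Wb \o inc) x = scoord W x.
  apply: filterS (filterI (near_cimg dq) (near_chart dq nW)) => x [xd Wx].
  by rewrite /= cfield_val -(slice_cinv dom slice xd) Wx.
by rewrite -(lderive_near _ nE) (lderive_comp _ (inc_smooth _) sWc) lderive_inc.
Qed.

Definition sff p a b := norc L c p (GM (incp p) (inc a) (inc b)).

Definition dif (xy : 'rV[R]_k * 'rV[R]_k) a b : 'rV[R]_k :=
  tanc L c (xy.1, inc xy.2) (GM (inc xy.1, inc xy.2) (inc a) (inc b)) - GS xy a b.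

Lemma GM_incp_smooth p a b : timg c setT A (incp p) -> smooth_at p (fun p => GM (incp p) a b).
Proof.
move=> Ap; apply: (@smooth_at_comp _ _ _ _ _ _ incp (fun z => GM z a b)).
  exact: incp_smooth.
by have [_] := christoffel_bilin oA acM Ap; apply.
Qed.

Lemma GM_linear zw : timg c setT A zw ->
  (forall a, linear (GM zw a)) /\ (forall b, linear (GM zw ^~ b)).
Proof. by move=> Az; have [/nbhs_singleton] := christoffel_bilin oA acM Az. Qed.

Lemma GS_linear xy : timg d setT (sub_cone i A) xy ->
  (forall a, linear (GS xy a)) /\ (forall b, linear (GS xy ^~ b)).
Proof. by move=> Az; have [/nbhs_singleton] := christoffel_bilin oS acS Az. Qed.

Lemma sff_bilin p : regular A L d c p -> bilin_smooth_at p sff.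
Proof.
move=> reg; have Ap : timg c setT A (incp p) by case: reg.
split=> [|a b].
  apply: filterS (near_regular pf reg) => r regr.
  have [Gr Gl] : (forall a, linear (GM (incp r) a)) /\ (forall b, linear (GM (incp r) ^~ b)).
    by apply: GM_linear; case: regr.
  have nl := norc_linear pf regr.
  split=> [a|b] s u v; rewrite /sff inc_linear.
    by rewrite Gr nl.
  by rewrite Gl nl.
apply: (@smooth_at_slot _ _ _ _ _ _ (fun p e => norc L c p e)).
- by apply: filterS (near_regular pf reg) => r; exact: norc_linear.
- by move=> e; exact: (norc_smooth pf reg).
- exact: GM_incp_smooth.
Qed.

Lemma dif_bilin xy : timg d setT (sub_cone i A) xy -> bilin_smooth_at xy dif.
Proof.
move=> Axy.
have regT (r : 'rV[R]_k * 'rV[R]_k) : timg d setT (sub_cone i A) r ->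
    regular A L d c (r.1, inc r.2).
  by case: r => r1 r2 Ar; exact: (regular_tangent pf Hnd dom slice Ar).
have regc (r : 'rV[R]_k * 'rV[R]_k) : timg d setT (sub_cone i A) r -> timg c setT A (inc r.1, inc r.2).
  by move=> /regT [].
split=> [|a b].
  apply: filterS (near_timg oS Axy) => r Ar.
  have [Gr Gl] := GM_linear (regc _ Ar); have [Hr Hl] := GS_linear Ar.
  have tl := tanc_linear pf (regT _ Ar).
  split=> [a|b] s u v; rewrite /dif inc_linear.
    by rewrite Gr Hr tl scalerBr opprD addrACA.
  by rewrite Gl Hl tl scalerBr opprD addrACA.
apply: smooth_atB; last by have [_] := christoffel_bilin oS acS Axy; apply.
have reg := regT _ Axy.
apply: (@smooth_at_comp _ _ _ _ _ _ tanp (fun p => tanc L c p (GM (incp p) (inc a) (inc b)))).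
  exact: smooth_at_lin tanp_linear.
apply: (@smooth_at_slot _ _ _ _ _ _ (fun p e => tanc L c p e)).
- by apply: filterS (near_regular pf reg) => r; exact: tanc_linear.
- by move=> e; exact: (tanc_smooth pf reg).
- by apply: GM_incp_smooth; case: reg.
Qed.

Lemma ambient_pushE q w X Y : cdom d q -> A (i q) w -> smooth_near q X -> smooth_near q Y ->
  tco c (i q) (ambient i nablaM q w X (push i Y)) =
  inc ('L_(tco d q (X q)) (cfield d Y) (cmap d q))
  + GM (incp (base q w)) (inc (tco d q (X q))) (inc (tco d q (Y q))).
Proof.
move=> dq Aw sX sY; have sYc := (smooth_nearP _ dq).1 sY.
rewrite (ambientE dq Aw sX (scoord_push_smooth dq sY)) /push tmapEq//; congr (_ + _).
rewrite -(lderive_near _ (near_scoord_push Y dq)).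
have -> : (fun x => inc (cfield d Y x)) = inc \o cfield d Y by [].
by rewrite (lderive_comp _ sYc (inc_smooth _)) lderive_inc.
Qed.

Lemma regular_cone q w : cdom d q -> regular A L d c (base q w) -> A (i q) w.
Proof.
move=> dq [_ + _]; rewrite incp_base// => /timgE[_ /=].
have cq := slice_dom dom dq.
by rewrite (cmapK cq) (tcoordK _ cq).
Qed.

Lemma cst_ext q a : cdom d q -> extension q a (cst_field d (tco d q a)).
Proof. by move=> dq; rewrite -{1}(tcoordK a dq); exact: cst_field_extension. Qed.

(** The derivative of [Y] is tangent to [S] and is lost in the normal part. In [differenceE] the
    same term cancels against the one in the connection of [S]. *)
Lemma second_formE q w x y : cdom d q -> regular A L d c (base q w) ->
  tco c (i q) (second_form i L nablaM q w x y) = sff (base q w) (tco d q x) (tco d q y).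
Proof.
move=> dq reg; have Aw := regular_cone dq reg.
rewrite /second_form; set E := (X in any_of X).
have [e Ee] : exists e, E e.
  by eexists; do 2!eexists; split; [exact: cst_ext|exact: cst_ext|reflexivity].
apply: (@any_ofE _ _ _ _ (fun e => tco c (i q) e = _) Ee) => {e Ee}.
move=> _ [X [Y [[sX Xq] [sY Yq] ->]]].
rewrite (nor_partE _ dq reg) (ambient_pushE dq Aw sX sY) Xq Yq.
by rewrite (linD (norc_linear pf reg)) (norc_inc pf reg) add0r.
Qed.

Lemma differenceE q v x y : cdom d q -> sub_cone i A q v ->
  tco d q (difference i L nablaM nablaS q v x y) =
  dif (cmap d q, tco d q v) (tco d q x) (tco d q y).
Proof.
move=> dq Av; have reg := regular_tmap dq Av; have Aw := regular_cone dq reg.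
rewrite /difference; set E := (X in any_of X).
have [e Ee] : exists e, E e.
  by eexists; do 2!eexists; split; [exact: cst_ext|exact: cst_ext|reflexivity].
apply: (@any_ofE _ _ _ _ (fun e => tco d q e = _) Ee) => {e Ee}.
move=> _ [X [Y [[sX Xq] [sY Yq] ->]]].
rewrite (linB (tcoord_linear dq)) (tan_partE _ dq reg) (ambient_pushE dq Aw sX sY).
rewrite (nablaE acS dq Av sX sY) Xq Yq (linD (tanc_linear pf reg)) (tanc_inc pf reg).
rewrite base_tmap// /dif /incp /=.
by rewrite opprD addrACA subrr add0r.
Qed.

Lemma near_base q w : cdom d q -> regular A L d c (base q w) ->
  \forall w' \near w, regular A L d c (base q w').
Proof.
move=> dq reg; have cq := slice_dom dom dq.
have sb : smooth_at w (base q).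
  apply: smooth_at_pair; first exact: smooth_at_cst.
  exact: smooth_at_lin (tcoord_linear cq).
by have := smooth_at_cont sb (near_regular pf reg).
Qed.

Lemma vderiv_second_formE q w x y (z : 'rV[R]_(k + l)) : cdom d q ->
  regular A L d c (base q w) ->
  tco c (i q) (vderiv_second_form i L nablaM q w x y z) =
  'L_(0, tco c (i q) z) (fun p => sff p (tco d q x) (tco d q y)) (base q w).
Proof.
move=> dq reg; have cq := slice_dom dom dq.
have [_ /(_ (tco d q x) (tco d q y)) ss] := sff_bilin reg.
rewrite /base lderive_slice; apply: (vderiv_coord z cq cq).
  exact: smooth_snd_slice ss.
by apply: filterS (near_base dq reg) => w' regw; exact: second_formE.
Qed.

Lemma near_sub_cone q v : cdom d q -> sub_cone i A q v ->
  \forall v' \near v, sub_cone i A q v'.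
Proof.
move=> dq Av; have sb : smooth_at v (fun v' => (cmap d q, tco d q v')).
  apply: smooth_at_pair; first exact: smooth_at_cst.
  exact: smooth_at_lin (tcoord_linear dq).
have H : \forall v' \near v, timg d setT (sub_cone i A) (cmap d q, tco d q v').
  by have := smooth_at_cont sb (near_timg oS (timg_coord dq Av)).
by apply: filterS H => v' /timgE[_ /=]; rewrite (cmapK dq) (tcoordK _ dq).
Qed.

Lemma vderiv_differenceE q v x y z : cdom d q -> sub_cone i A q v ->
  tco d q (vderiv_difference i L nablaM nablaS q v x y z) =
  'L_(0, tco d q z) (fun r => dif r (tco d q x) (tco d q y)) (cmap d q, tco d q v).
Proof.
move=> dq Av; have [_ /(_ (tco d q x) (tco d q y)) ss] := dif_bilin (timg_coord dq Av).
rewrite lderive_slice; apply: (vderiv_coord z dq dq).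
  exact: smooth_snd_slice ss.
by apply: filterS (near_sub_cone dq Av) => v' Av'; exact: differenceE.
Qed.

Lemma admissible_cst q v : cdom d q -> sub_cone i A q v ->
  admissible_extension (sub_cone i A) q v (cst_field d (tco d q v)).
Proof.
move=> dq Av; have [sv vq] := cst_ext v dq; split => //; split => //.
have spair : smooth_at (cmap d q) (fun w : 'rV[R]_k => (w, tco d q v)).
  by apply: smooth_at_pair; [exact: smooth_at_id|exact: smooth_at_cst].
have H : \forall x \near cmap d q, timg d setT (sub_cone i A) (x, tco d q v).
  by have := smooth_at_cont spair (near_timg oS (timg_coord dq Av)).
have := near_chartV dq H; apply: filter_app; apply: filterS (near_cdom dq) => r dr /timgE[/= _].
by rewrite (cmapK dr).
Qed.

(** The mechanism of [curvatureE]: the term in the vertical derivative of [Q] replaces the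
    derivative of [V] by the horizontal direction of [S], and the derivatives of [Y] and [Z] cancel
    against the last two terms. *)
Lemma cov_differenceE q v x y z : cdom d q -> sub_cone i A q v ->
  let r := (cmap d q, tco d q v) in
  let a := tco d q x in let b := tco d q y in let e := tco d q z in
  tco d q (cov_difference i A L nablaM nablaS q v x y z) =
  'L_(a, - GS r a r.2) (fun r => dif r b e) r + GS r a (dif r b e)
  - dif r (GS r a b) e - dif r b (GS r a e).
Proof.
move=> dq Av r a b e; have Ar : timg d setT (sub_cone i A) r := timg_coord dq Av.
rewrite /cov_difference; set E := (X in any_of X).
have [e0 Ee] : exists e0, E e0.
  by eexists; do 4!eexists; split;
    [exact: admissible_cst|exact: cst_ext|exact: cst_ext|exact: cst_ext|reflexivity].
apply: (@any_ofE _ _ _ _ (fun e => tco d q e = _) Ee) => {e0 Ee}.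
move=> _ [V [X [Y [Z [[aV Vq] [sX Xq] [sY Yq] [sZ Zq] ->]]]]].
have [sVc AVc] := admissible_coord dq aV; have sV : smooth_near q V by case: aV.
have sYc := (smooth_nearP _ dq).1 sY; have sZc := (smooth_nearP _ dq).1 sZ.
have Vc : cfield d V (cmap d q) = tco d q v by rewrite (cfieldE V dq) Vq.
have Yc : cfield d Y (cmap d q) = b by rewrite (cfieldE Y dq) Yq.
have Zc : cfield d Z (cmap d q) = e by rewrite (cfieldE Z dq) Zq.
pose D : vfield S := fun q => difference i L nablaM nablaS q (V q) (Y q) (Z q).
have spair : smooth_at (cmap d q) (fun x => (x, cfield d V x)).
  by apply: smooth_at_pair => //; exact: smooth_at_id.
have bD : bilin_smooth_at (cmap d q, cfield d V (cmap d q)) dif.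
  by rewrite Vc; exact: dif_bilin.
have nD : \forall x \near cmap d q, dif (x, cfield d V x) (cfield d Y x) (cfield d Z x) = cfield d D x.
  have [_ AV] := aV; have := near_chart dq AV; apply: filter_app.
  apply: filterS (near_cimg dq) => x' xd AVx; have dx := cinv_dom xd.
  have -> : cfield d D x' = tco d (cinv d x') (D (cinv d x')) by rewrite cfield_val.
  rewrite [RHS](differenceE (Y (cinv d x')) (Z (cinv d x')) dx AVx) (cinvK xd).
  by rewrite !cfield_val.
have sDc : smooth_at (cmap d q) (cfield d D).
  by apply: (smooth_at_eq nD); exact: (smooth_bilin_along _ _ _ bD spair sYc sZc).
have sD : smooth_near q D by exact/(smooth_nearP _ dq).
have tl := tcoord_linear dq.
rewrite !(linB tl) [X in X - _ - _ - _](nablaE acS dq Av sX sD).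
rewrite [X in _ - X - _ - _](vderiv_differenceE _ _ _ dq Av).
rewrite [X in _ - _ - X - _](differenceE _ _ dq Av) [X in _ - _ - _ - X](differenceE _ _ dq Av).
have EV : tco d q (nablaS q v X V) = 'L_a (cfield d V) (cmap d q) + GS r a (tco d q v).
  by rewrite (nablaE acS dq Av sX sV) Xq Vq.
have EY : tco d q (nablaS q v X Y) = 'L_a (cfield d Y) (cmap d q) + GS r a b.
  by rewrite (nablaE acS dq Av sX sY) Xq Yq.
have EZ : tco d q (nablaS q v X Z) = 'L_a (cfield d Z) (cmap d q) + GS r a e.
  by rewrite (nablaE acS dq Av sX sZ) Xq Zq.
rewrite EV EY EZ Xq -/r -/a -/b -/e -/GS.
have -> : tco d q (D q) = dif r b e by rewrite -(cfieldE D dq) -(nbhs_singleton nD) Vc Yc Zc.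
rewrite -(lderive_near _ nD) (lderive_bilin_along _ _ _ bD spair sYc sZc) Vc Yc Zc -/r.
rewrite (lderive_pair _ (smooth_at_id _ _) sVc) lderive_id.
have [/nbhs_singleton [dr dl] /(_ b e) sd] := dif_bilin Ar.
rewrite (lderive_split sd a ('L_a _ _)) (lderive_split sd a (- _)).
rewrite (linD (lderive_snd_linear sd)) (linN (lderive_snd_linear sd)).
rewrite (linD (dl e)) (linD (dr b)).
rewrite /r /=; gen_lderive.
repeat match goal with |- context [dif ?r ?a ?b] => let g := fresh "g" in move: (dif r a b) => g end.
repeat match goal with |- context [GS ?r ?a ?b] => let g := fresh "g" in move: (GS r a b) => g end.
row_ring.
Qed.

(** The correction now involves the ambient derivative of [V], so the derivative of [II] is along
    the horizontal direction of [M], which in general leaves the vectors tangent to [S]. The other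
    two corrections use the symbols of [S]. *)
Lemma cov_second_formE q v x y z : cdom d q -> sub_cone i A q v ->
  let r := (cmap d q, tco d q v) in let p := (cmap d q, inc (tco d q v)) in
  let a := tco d q x in let b := tco d q y in let e := tco d q z in
  tco c (i q) (cov_second_form i A L nablaM nablaS q v x y z) =
  norc L c p ('L_(a, - GM (incp p) (inc a) p.2) (fun p => sff p b e) p + GM (incp p) (inc a) (sff p b e))
  - sff p (GS r a b) e - sff p b (GS r a e).
Proof.
move=> dq Av r p a b e; have cq := slice_dom dom dq.
have reg := regular_tmap dq Av; have Aw := regular_cone dq reg.
have pE : base q (tmap i q v) = p by rewrite base_tmap.
rewrite /cov_second_form; set E := (X in any_of X).
have [e0 Ee] : exists e0, E e0.
  have aV : admissible_extension A (i q) (tmap i q v) (cst_field c (tco c (i q) (tmap i q v))).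
    split; last by rewrite /cst_field /lift_field (tcoordK _ cq).
    split; first exact: cst_field_smooth.
    have spair : smooth_at (cmap c (i q)) (fun w : 'rV[R]_(k + l) => (w, tco c (i q) (tmap i q v))).
      by apply: smooth_at_pair; [exact: smooth_at_id|exact: smooth_at_cst].
    have H : \forall x \near cmap c (i q), timg c setT A (x, tco c (i q) (tmap i q v)).
      by have := smooth_at_cont spair (near_timg oA (timg_coord cq Aw)).
    have := near_chartV cq H; apply: filter_app; apply: filterS (near_cdom cq) => s cs /timgE[/= _].
    by rewrite (cmapK cs).
  by eexists; do 4!eexists; split; [exact: aV|exact: cst_ext|exact: cst_ext|exact: cst_ext|reflexivity].
apply: (@any_ofE _ _ _ _ (fun e => tco c (i q) e = _) Ee) => {e0 Ee}.
move=> _ [V [X [Y [Z [[aV Vq] [sX Xq] [sY Yq] [sZ Zq] ->]]]]].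
have [sVc AVc] := admissible_coord cq aV; have [sV nAV] := aV.
have sYc := (smooth_nearP _ dq).1 sY; have sZc := (smooth_nearP _ dq).1 sZ.
pose VS := scoord (V \o i).
have nVS : \forall x \near cmap d q, (cfield c V \o inc) x = VS x.
  apply: filterS (near_cimg dq) => x' xd.
  by rewrite /= cfield_val -(slice_cinv dom slice xd).
have sVS : smooth_at (cmap d q) VS.
  apply: (smooth_at_eq nVS); apply: (@smooth_at_comp _ _ _ _ _ _ inc (cfield c V)).
    exact: inc_smooth.
  by rewrite -slice.
have Vc : VS (cmap d q) = inc (tco d q v) by rewrite /VS scoordE//= Vq tmapEq.
have Yc : cfield d Y (cmap d q) = b by rewrite (cfieldE Y dq) Yq.
have Zc : cfield d Z (cmap d q) = e by rewrite (cfieldE Z dq) Zq.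
pose W q := second_form i L nablaM q (V (i q)) (Y q) (Z q).
have spair : smooth_at (cmap d q) (fun x => (x, VS x)).
  by apply: smooth_at_pair => //; exact: smooth_at_id.
have regp : regular A L d c p by rewrite -pE.
have bW : bilin_smooth_at (cmap d q, VS (cmap d q)) sff.
  by rewrite Vc; exact: sff_bilin.
have nreg : \forall x \near cmap d q, regular A L d c (x, VS x).
  have regV : regular A L d c (cmap d q, VS (cmap d q)) by rewrite Vc.
  by have := smooth_at_cont spair (near_regular pf regV).
have nW : \forall x \near cmap d q, sff (x, VS x) (cfield d Y x) (cfield d Z x) = scoord W x.
  apply: filterS (filterI (near_cimg dq) nreg) => x' [xd regx]; have dx := cinv_dom xd.
  have bE : base (cinv d x') (V (i (cinv d x'))) = (x', VS x').
    by rewrite /base (cinvK xd).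
  by rewrite /scoord /W second_formE// bE // !cfield_val.
have sW : smooth_at (cmap d q) (scoord W).
  by apply: (smooth_at_eq nW); exact: (smooth_bilin_along _ _ _ bW spair sYc sZc).
have tl := tcoord_linear cq.
rewrite (linB tl) (linB tl) (nor_partE _ dq reg) (linB tl).
rewrite [X in norc _ _ _ (X - _)](ambientE dq Aw sX sW).
rewrite [X in norc _ _ _ (_ - X)](vderiv_second_formE _ _ _ dq reg).
rewrite [X in _ - X - _](second_formE _ _ dq reg) [X in _ - _ - X](second_formE _ _ dq reg).
have EV : tco c (i q) (ambient i nablaM q (tmap i q v) X (V \o i)) =
    'L_a VS (cmap d q) + GM (incp p) (inc a) (inc (tco d q v)).
  by rewrite (ambientE dq Aw sX sVS) /= Vq tmapEq// pE Xq.
have EY : tco d q (nablaS q v X Y) = 'L_a (cfield d Y) (cmap d q) + GS r a b.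
  by rewrite (nablaE acS dq Av sX sY) Xq Yq.
have EZ : tco d q (nablaS q v X Z) = 'L_a (cfield d Z) (cmap d q) + GS r a e.
  by rewrite (nablaE acS dq Av sX sZ) Xq Zq.
rewrite EV EY EZ pE Xq -/r -/a -/b -/e.
have -> : tco c (i q) (W q) = sff p b e.
  by rewrite -(scoordE W dq) -(nbhs_singleton nW) Vc Yc Zc.
rewrite -(lderive_near _ nW) (lderive_bilin_along _ _ _ bW spair sYc sZc) Vc Yc Zc -/p.
rewrite (lderive_pair _ (smooth_at_id _ _) sVS) lderive_id.
have [/nbhs_singleton [dr dl] /(_ b e) sd] := sff_bilin regp.
rewrite (lderive_split sd a ('L_a _ _)) (lderive_split sd a (- _)).
rewrite (linD (lderive_snd_linear sd)) (linN (lderive_snd_linear sd)).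
rewrite (linD (dl e)) (linD (dr b)).
(* Values of [sff] are already normal, so the terms containing the derivatives of [Y] and [Z] can be
   taken out of [norc], where they meet their opposites. *)
have nsff s t : norc L c p (sff p s t) = sff p s t by rewrite /sff (norcK pf regp).
have nl := norc_linear pf regp.
have nE t1 t2 t3 t4 s t s' t' :
    norc L c p (t1 + t2 + sff p s t + sff p s' t' + t3 - (t2 + t4)) =
    norc L c p (t1 - t4 + t3) + sff p s t + sff p s' t'.
  rewrite -[in RHS](nsff s t) -[in RHS](nsff s' t') -!(linD nl); congr (norc L c p _).
  by move: (sff p s t) (sff p s' t') => g g'; row_ring.
rewrite nE (_ : p.2 = inc (tco d q v)) //.
repeat match goal with |- context [sff ?r ?a ?b] => let g := fresh "g" in move: (sff r a b) => g end.
by move: (norc _ _ _ _) => n; row_ring.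
Qed.

End sub_formulas.

Lemma lderive_shift {R : realType} {E F G : normedModType R} (f : E * F -> G) (p : E * F)
    (sf : smooth_at p f) (s : E) (a b : F) :
  'L_(s, - (a + b)) f p = 'L_(s, - a) f p - 'L_(0, b) f p.
Proof.
rewrite (lderive_split sf s (- (a + b))) (lderive_split sf s (- a)).
by rewrite opprD (linD (lderive_snd_linear sf)) (linN (lderive_snd_linear sf) b) addrA.
Qed.

(** * Coordinate form of the equations *)

Section decomposition.
Context {R : realType} {k l : nat}.
Implicit Types (r : 'rV[R]_k * 'rV[R]_k) (u w z : 'rV[R]_k).
Variables (GM : 'rV[R]_(k + l) * 'rV[R]_(k + l) -> 'rV[R]_(k + l) -> 'rV[R]_(k + l) -> 'rV[R]_(k + l))
  (GS Q : 'rV[R]_k * 'rV[R]_k -> 'rV[R]_k -> 'rV[R]_k -> 'rV[R]_k)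
  (B : 'rV[R]_k * 'rV[R]_(k + l) -> 'rV[R]_k -> 'rV[R]_k -> 'rV[R]_(k + l))
  (r : 'rV[R]_k * 'rV[R]_k).
Hypotheses (bGM : bilin_smooth_at (incpp r) GM) (bGS : bilin_smooth_at r GS)
  (bQ : bilin_smooth_at r Q) (bB : bilin_smooth_at (tanp r) B)
  (dec : \forall s \near r, forall a b,
    GM (incpp s) (inc a) (inc b) = inc (GS s a b + Q s a b) + B (tanp s) a b)
  (sym : forall a b, GS r a b = GS r b a).

Let dec0 a b : GM (incpp r) (inc a) (inc b) = inc (GS r a b + Q r a b) + B (tanp r) a b.
Proof. exact: (nbhs_singleton dec). Qed.

Let sGM a b : smooth_at (incpp r) (fun s => GM s a b). Proof. by case: bGM. Qed.
Let sGS a b : smooth_at r (fun s => GS s a b). Proof. by case: bGS. Qed.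
Let sQ a b : smooth_at r (fun s => Q s a b). Proof. by case: bQ. Qed.
Let sB a b : smooth_at (tanp r) (fun s => B s a b). Proof. by case: bB. Qed.
Let lGMr a : linear (GM (incpp r) a). Proof. by case: bGM => /nbhs_singleton []. Qed.
Let lGSr a : linear (GS r a). Proof. by case: bGS => /nbhs_singleton []. Qed.
Let lQr a : linear (Q r a). Proof. by case: bQ => /nbhs_singleton []. Qed.
Let lBr a : linear (B (tanp r) a). Proof. by case: bB => /nbhs_singleton []. Qed.

(** Coordinate form of the ambient covariant derivative of [II(w, z)] along [u], before projection
    to the normal space. *)
Definition normal_rate u w z : 'rV[R]_(k + l) :=
  'L_(u, - GM (incpp r) (inc u) (inc r.2)) (fun s => B s w z) (tanp r)
  + GM (incpp r) (inc u) (B (tanp r) w z).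

(** The splitting [dec] is an identity over vectors tangent to [S], so it may be differentiated
    along directions of the form [(inc a, inc b)]. *)
Lemma lderive_christoffel_tangent a b w z :
  'L_(inc a, inc b) (fun s => GM s (inc w) (inc z)) (incpp r) =
  inc ('L_(a, b) (fun s => GS s w z) r + 'L_(a, b) (fun s => Q s w z) r)
  + 'L_(a, inc b) (fun s => B s w z) (tanp r).
Proof.
have si : smooth_at r (@incpp R k l) by exact: smooth_at_lin incpp_linear.
have st : smooth_at r (@tanp R k l) by exact: smooth_at_lin tanp_linear.
have sGQ : smooth_at r (fun s => GS s w z + Q s w z) by exact: smooth_atD.
have sI : smooth_at r (fun s => @inc R k l (GS s w z + Q s w z)).
  by apply: (@smooth_at_comp _ _ _ _ _ _ (fun s => GS s w z + Q s w z) inc) => //; exact: inc_smooth.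
have sBt : smooth_at r (fun s => B (tanp s) w z).
  exact: (@smooth_at_comp _ _ _ _ _ _ tanp (fun s => B s w z)).
have := lderive_comp (a, b) si (sGM (inc w) (inc z)).
rewrite (lderive_lin _ _ incpp_linear) => <-.
have nE : \forall s \near r, ((fun s => GM s (inc w) (inc z)) \o incpp) s =
    inc (GS s w z + Q s w z) + B (tanp s) w z.
  by apply: filterS dec => s /(_ w z).
rewrite (lderive_near _ nE) (lderiveD _ sI sBt); congr (_ + _).
  have := lderive_comp (a, b) sGQ (@inc_smooth R k l _) => ->.
  by rewrite lderive_inc (lderiveD _ (sGS w z) (sQ w z)).
have := lderive_comp (a, b) st (sB w z) => ->.
by rewrite (lderive_lin _ _ tanp_linear).
Qed.

(** The horizontal direction has vertical part [- inc (GS + Q) - B]. The [B] part is not tangent to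
    [S] and is split off first, which leaves the vertical derivative of [GM];
    [lderive_christoffel_tangent] applies to the rest. The direction inside [normal_rate] is split
    in the same way, hence the compensating vertical derivative of [B]. *)
Lemma horizontal_christoffelE u w z : let v := r.2 in
  'L_(inc u, - GM (incpp r) (inc u) (inc v)) (fun s => GM s (inc w) (inc z)) (incpp r)
  + GM (incpp r) (inc u) (GM (incpp r) (inc w) (inc z)) =
  inc ('L_(u, - GS r u v) (fun s => GS s w z) r + GS r u (GS r w z)
       - 'L_(0, Q r u v) (fun s => GS s w z) r
       + ('L_(u, - GS r u v) (fun s => Q s w z) r + GS r u (Q r w z))
       - 'L_(0, Q r u v) (fun s => Q s w z) r + Q r u (GS r w z) + Q r u (Q r w z))
  + (normal_rate u w z + 'L_(0, B (tanp r) u v) (fun s => B s w z) (tanp r)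
     + B (tanp r) u (GS r w z) + B (tanp r) u (Q r w z))
  - 'L_(0, B (tanp r) u v) (fun s => GM s (inc w) (inc z)) (incpp r).
Proof.
move=> v; have il := @inc_linear R k l.
have E1 : 'L_(inc u, - GM (incpp r) (inc u) (inc v)) (fun s => GM s (inc w) (inc z)) (incpp r) =
    'L_(inc u, inc (- (GS r u v + Q r u v))) (fun s => GM s (inc w) (inc z)) (incpp r)
    - 'L_(0, B (tanp r) u v) (fun s => GM s (inc w) (inc z)) (incpp r).
  by rewrite dec0 (linN il) (lderive_shift (sGM _ _)).
have E2 : normal_rate u w z =
    'L_(u, inc (- (GS r u v + Q r u v))) (fun s => B s w z) (tanp r)
    - 'L_(0, B (tanp r) u v) (fun s => B s w z) (tanp r)
    + GM (incpp r) (inc u) (B (tanp r) w z).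
  by rewrite /normal_rate dec0 (linN il) (lderive_shift (sB _ _)).
rewrite E1 E2 lderive_christoffel_tangent.
rewrite [X in GM _ _ X]dec0 (linD (lGMr _)) dec0 !(linD (lGSr _)) !(linD (lQr _)) !(linD (lBr _)).
rewrite (lderive_shift (sGS w z)) (lderive_shift (sQ w z)).
gen_lderive.
rewrite !(linD il, linN il).
repeat match goal with |- context [GM ?r ?a ?b] => let g := fresh "g" in move: (GM r a b) => g end.
repeat match goal with |- context [B ?r ?a ?b] => let g := fresh "g" in move: (B r a b) => g end.
repeat match goal with |- context [@inc ?R ?k ?l ?b] => let g := fresh "g" in move: (@inc R k l b) => g end.
row_ring.
Qed.

(** Antisymmetrization in [u] and [w] of the previous identity. The terms [Q r (GS r u w) z] and
    [Q r (GS r w u) z] do not come from the expansion: they complete the covariant derivatives of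
    [Q], and cancel each other because [S] has no torsion. *)
Lemma curvature_decomposition u w z : let v := r.2 in
  curvature_coord GM (incpp r) (inc u) (inc w) (inc z) =
  inc (curvature_coord GS r u w z
    + ('L_(0, Q r w v) (fun s => GS s u z) r - 'L_(0, Q r u v) (fun s => GS s w z) r)
    + (('L_(u, - GS r u v) (fun s => Q s w z) r + GS r u (Q r w z)
        - Q r (GS r u w) z - Q r w (GS r u z))
      - ('L_(w, - GS r w v) (fun s => Q s u z) r + GS r w (Q r u z)
        - Q r (GS r w u) z - Q r u (GS r w z)))
    + ('L_(0, Q r w v) (fun s => Q s u z) r - 'L_(0, Q r u v) (fun s => Q s w z) r)
    + (Q r u (Q r w z) - Q r w (Q r u z)))
  + ((normal_rate u w z + 'L_(0, B (tanp r) u v) (fun s => B s w z) (tanp r)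
     + B (tanp r) u (GS r w z) + B (tanp r) u (Q r w z))
    - (normal_rate w u z + 'L_(0, B (tanp r) w v) (fun s => B s u z) (tanp r)
     + B (tanp r) w (GS r u z) + B (tanp r) w (Q r u z)))
  + ('L_(0, B (tanp r) w v) (fun s => GM s (inc u) (inc z)) (incpp r)
     - 'L_(0, B (tanp r) u v) (fun s => GM s (inc w) (inc z)) (incpp r)).
Proof.
move=> v; have il := @inc_linear R k l.
rewrite [LHS]/curvature_coord [X in X - _]horizontal_christoffelE [X in _ - X]horizontal_christoffelE.
rewrite /curvature_coord (sym w u) -/v.
gen_lderive.
move: (normal_rate u w z) (normal_rate w u z) => n1 n2.
repeat match goal with |- context [GS ?r ?a ?b] => let g := fresh "g" in move: (GS r a b) => g end.
repeat match goal with |- context [Q ?r ?a ?b] => let g := fresh "g" in move: (Q r a b) => g end.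
repeat match goal with |- context [B ?r ?a ?b] => let g := fresh "g" in move: (B r a b) => g end.
rewrite !(linD il, linN il).
repeat match goal with |- context [@inc ?R ?k ?l ?b] => let g := fresh "g" in move: (@inc R k l b) => g end.
row_ring.
Qed.

End decomposition.

Lemma christoffel_sym {R : realType} {n : nat} {M : manifold R n} (A : M -> set 'rV[R]_n)
    (L : M -> 'rV[R]_n -> R) (nabla : connection_op (M := M)) (c : mchart M) xy
    (a b : 'rV[R]_n) : levi_civita_chern A L nabla -> timg c setT A xy ->
  christoffel nabla c xy a b = christoffel nabla c xy b a.
Proof.
move=> lcc /timg_coordP[E [cq Aq]]; set q := cinv c xy.1 in E cq Aq.
have sa : smooth_near q (cst_field c a) := cst_field_smooth a cq.
have sb : smooth_near q (cst_field c b) := cst_field_smooth b cq.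
have := congr1 (tco c q) (lcc_torsion_free lcc Aq sa sb).
rewrite (linB (tcoord_linear cq)) (bracketE cq sa sb).
rewrite (nablaE (lcc_connection lcc) cq Aq sa sb) (nablaE (lcc_connection lcc) cq Aq sb sa).
rewrite !(tcoord_cst_field _ cq) !(lderive_cst_field _ _ cq) !add0r oppr0 -E.
by move/eqP; rewrite subr_eq0 => /eqP.
Qed.

(** * Pairing with tangent and with normal vectors *)

Section gauss_codazzi.
Context {R : realType} {k l : nat} {S : manifold R k} {M : manifold R (k + l)}.
Variables (i : S -> M) (A : M -> set 'rV[R]_(k + l)) (L : M -> 'rV[R]_(k + l) -> R).
Variables (nablaM : connection_op (M := M)) (nablaS : connection_op (M := S)).
Hypotheses (pf : pseudo_finsler_metric A L) (Hnd : nondegenerate_submanifold i A L)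
  (lM : levi_civita_chern A L nablaM)
  (lS : levi_civita_chern (sub_cone i A) (sub_metric i L) nablaS)
  (oS : forall a : S, open (timg (chart_at a) setT (sub_cone i A))).
Variables (d : mchart S) (c : mchart M).
Hypotheses (dom : cdom d = i @^-1` cdom c)
  (slice : forall q, cdom d q -> cmap c (i q) = inc (cmap d q)).
Variable r : 'rV[R]_k * 'rV[R]_k.
Hypothesis Ar : timg d setT (sub_cone i A) r.
Implicit Types (a b u w z : 'rV[R]_k) (e : 'rV[R]_(k + l)).

Let oA := pf_open pf.
Let acM := lcc_connection lM.
Let acS := lcc_connection lS.
Let GM := christoffel nablaM c.
Let GS := christoffel nablaS d.
Let B := sff L nablaM c.
Let Q := dif L nablaM nablaS d c.
Let g := metric L c (incpp r).

Let reg (s : 'rV[R]_k * 'rV[R]_k) : timg d setT (sub_cone i A) s -> regular A L d c (tanp s).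
Proof. by case: s => s1 s2; exact: (regular_tangent pf Hnd dom slice). Qed.

Let Az : timg c setT A (incpp r). Proof. by case: (reg Ar). Qed.

Lemma metric_sff_eq0 p a b (e : 'rV[R]_k) : regular A L d c p -> metric L c (incp p) (B p a b) (inc e) = 0.
Proof. by move=> regp; exact: (norc_orth pf regp). Qed.

(** Derivative of the identity [g(II(w, z), b) = 0]. It holds at all regular points near [tanp r],
    also over vectors not tangent to [S], so the vertical direction [e] may be any ambient
    vector. *)
Lemma lderive_metric_sff a e w z b :
  g ('L_(a, e) (fun s => B s w z) (tanp r)) (inc b) =
  - 'L_(inc a, e) (fun s => metric L c s (B (tanp r) w z) (inc b)) (incpp r).
Proof.
have regr := reg Ar.
have [_ /(_ w z) sB] := sff_bilin pf acM regr.
have nE : \forall s \near tanp r, metric L c (incp s) (B s w z) (inc b) = 0.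
  by apply: filterS (near_regular pf regr) => s; exact: metric_sff_eq0.
have := lderive_near (a, e) nE; rewrite lderive_cst.
have bg : bilin_smooth_at (incp (tanp r)) (metric L c) := metric_bilin pf Az.
rewrite (lderive_bilin_along _ _ _ bg (incp_smooth _) sB (smooth_at_cst _ _) (a, e)).
rewrite lderive_cst (lin0 (metric_linearr pf Az _)) addr0.
have -> : 'L_(a, e) incp (tanp r) = (inc a, e).
  by apply: lderive_lin => s x y; rewrite /incp /= inc_linear.
by move/eqP; rewrite addrC addr_eq0 => /eqP.
Qed.

Let dec : \forall s \near r, forall a b,
  GM (incpp s) (inc a) (inc b) = inc (GS s a b + Q s a b) + B (tanp s) a b.
Proof.
apply: filterS (near_timg oS Ar) => s As a b.
rewrite [LHS](norc_tanc L c (tanp s)) /Q /dif /B /sff; congr (inc _ + _).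
by rewrite addrC subrK.
Qed.

(** By orthogonality the derivative of [II] is minus a horizontal derivative of the metric, which
    [metric_compat] evaluates. One of the two resulting terms cancels the Christoffel term of
    [normal_rate]; in the other, [II(w, z)] is paired with [GM(u, b)], of which only the normal part
    [II(u, b)] contributes. *)
Lemma metric_normal_rate u w z b :
  g (normal_rate GM B r u w z) (inc b) = - g (B (tanp r) w z) (B (tanp r) u b).
Proof.
rewrite /normal_rate /g (linD (metric_linearl pf Az _)) -/g lderive_metric_sff.
have := metric_compat pf lM (inc u) (B (tanp r) w z) (inc b) Az; rewrite -/GM -/g => ->.
have /(_ u b) -> := nbhs_singleton dec.
rewrite opprD addrAC addNr add0r; congr (- _).
rewrite /g (linD (metric_linearr pf Az _)) (metric_sym pf Az _ (inc _)).
by rewrite [X in X + _](metric_sym pf Az) [X in X + _](metric_sff_eq0 _ _ _ (reg Ar)) add0r.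
Qed.

Let bGM : bilin_smooth_at (incpp r) GM := christoffel_bilin oA acM Az.
Let bGS : bilin_smooth_at r GS := christoffel_bilin oS acS Ar.
Let bQ : bilin_smooth_at r Q := dif_bilin pf Hnd acM acS oS dom slice Ar.
Let bB : bilin_smooth_at (tanp r) B := sff_bilin pf acM (reg Ar).
Let sym a b : GS r a b = GS r b a. Proof. exact: christoffel_sym lS Ar. Qed.

Let split_lin (h : 'rV[R]_(k + l) -> R) (lh : linear h) x n1 n2 n3 n4 m1 m2 m3 m4 e :
  h (x + (n1 + n2 + n3 + n4 - (m1 + m2 + m3 + m4)) + e) =
  h x + (h n1 + h n2 + h n3 + h n4 - (h m1 + h m2 + h m3 + h m4)) + h e.
Proof. by rewrite !(linD lh, linN lh). Qed.

Definition tangential_curvature u w z : 'rV[R]_k := let v := r.2 in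
  curvature_coord GS r u w z
    + ('L_(0, Q r w v) (fun s => GS s u z) r - 'L_(0, Q r u v) (fun s => GS s w z) r)
    + (('L_(u, - GS r u v) (fun s => Q s w z) r + GS r u (Q r w z)
        - Q r (GS r u w) z - Q r w (GS r u z))
      - ('L_(w, - GS r w v) (fun s => Q s u z) r + GS r w (Q r u z)
        - Q r (GS r w u) z - Q r u (GS r w z)))
    + ('L_(0, Q r w v) (fun s => Q s u z) r - 'L_(0, Q r u v) (fun s => Q s w z) r)
    + (Q r u (Q r w z) - Q r w (Q r u z)).

(** Against a tangent vector the undifferentiated values of [II] vanish, the normal rates give the
    quadratic terms, and the vertical derivatives of [II] become vertical derivatives of the metric:
    these are the Cartan terms. *)
Lemma gauss_coord u w z b : let v := r.2 in let p := tanp r in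
  g (curvature_coord GM (incpp r) (inc u) (inc w) (inc z)) (inc b) =
  g (inc (tangential_curvature u w z)) (inc b)
  - g (B p w z) (B p u b) + g (B p u z) (B p w b)
  - 'L_(0, B p u v) (fun s => metric L c s (B p w z) (inc b)) (incpp r)
  + 'L_(0, B p w v) (fun s => metric L c s (B p u z) (inc b)) (incpp r)
  + g ('L_(0, B p w v) (fun s => GM s (inc u) (inc z)) (incpp r)
       - 'L_(0, B p u v) (fun s => GM s (inc w) (inc z)) (incpp r)) (inc b).
Proof.
move=> v p; rewrite [X in g X _](curvature_decomposition bGM bGS bQ bB dec sym).
have lg := metric_linearl pf Az (inc b).
rewrite /g [LHS](split_lin lg) -/g.
rewrite !metric_normal_rate !lderive_metric_sff.
have g0 (x y : 'rV[R]_k) : g (B (tanp r) x y) (inc b) = 0 by exact: metric_sff_eq0 (reg Ar).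
rewrite !g0 (lin0 inc_linear) -/v -/p -/(tangential_curvature u w z).
gen_lderive.
by repeat match goal with |- context [g ?x ?n] => let y := fresh "y" in move: (g x n) => y end; ring.
Qed.

(** Against a normal vector the tangential summand vanishes, and projecting the normal rate does not
    change its product with [n]. The terms [B p (GS r u w) z] of the two covariant derivatives
    cancel by symmetry of [GS]. *)
Lemma codazzi_coord u w z n : (forall b, g n (inc b) = 0) -> let v := r.2 in let p := tanp r in
  let covB u w z := norc L c p (normal_rate GM B r u w z) - B p (GS r u w) z - B p w (GS r u z) in
  g (curvature_coord GM (incpp r) (inc u) (inc w) (inc z)) n =
  g (covB u w z) n - g (covB w u z) n
  + g (B p u (Q r w z)) n - g (B p w (Q r u z)) n
  + g ('L_(0, B p u v) (fun s => B s w z) p) n - g ('L_(0, B p w v) (fun s => B s u z) p) n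
  + g ('L_(0, B p w v) (fun s => GM s (inc u) (inc z)) (incpp r)) n
  - g ('L_(0, B p u v) (fun s => GM s (inc w) (inc z)) (incpp r)) n.
Proof.
move=> Hn v p covB; rewrite [X in g X _](curvature_decomposition bGM bGS bQ bB dec sym).
have lg := metric_linearl pf Az n.
have Hi (e : 'rV[R]_k) : g (inc e) n = 0 by rewrite /g (metric_sym pf Az); exact: Hn.
have l3 (x y t : 'rV[R]_(k + l)) : g (x - y - t) n = g x n - g y n - g t n.
  by rewrite /g !(linB lg).
have l2 (x y : 'rV[R]_(k + l)) : g (x - y) n = g x n - g y n by rewrite /g (linB lg).
have gn e : g (norc L c p e) n = g e n by exact: (metric_norc pf (reg Ar)).
rewrite /g [LHS](split_lin lg) -/g Hi add0r /covB !l3 [X in _ + X = _]l2 !(gn (normal_rate _ _ _ _ _ _)) (sym w u) -/v -/p -/g.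
gen_lderive.
by repeat match goal with |- context [g ?x n] => let y := fresh "y" in move: (g x n) => y end; ring.
Qed.

End gauss_codazzi.

Theorem theorem5 (R : realType) (k l : nat)
  (M : manifold R (k + l)) (S : manifold R k) (i : S -> M)
  (A : M -> set 'rV[R]_(k + l)) (L : M -> 'rV[R]_(k + l) -> R)
  (nablaM : connection_op (M := M)) (nablaS : connection_op (M := S))
  (HL : pseudo_finsler_metric A L)
  (HS : submanifold i)
  (Hnd : nondegenerate_submanifold i A L)
  (HM : levi_civita_chern A L nablaM)
  (HSc : levi_civita_chern (sub_cone i A) (sub_metric i L) nablaS)
  (p : S) (v : 'rV[R]_k) (hv : sub_cone i A p v) (u w z : 'rV[R]_k) :
  let T := tmap i p in
  let g := fundamental L (i p) (T v) in
  let C := cartan L (i p) (T v) in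
  let RM := curvature A nablaM (i p) (T v) in
  let RS := curvature (sub_cone i A) nablaS p v in
  let PM := vertical_deriv nablaM (i p) (T v) in
  let PS := vertical_deriv nablaS p v in
  let II := second_form i L nablaM p (T v) in
  let dII := vderiv_second_form i L nablaM p (T v) in
  let covII := cov_second_form i A L nablaM nablaS p v in
  let Q := difference i L nablaM nablaS p v in
  let dQ := vderiv_difference i L nablaM nablaS p v in
  let covQ := cov_difference i A L nablaM nablaS p v in
  (forall b : 'rV[R]_k,
    g (RM (T u) (T w) (T z)) (T b) =
      g (T (RS u w z)) (T b)
      - g (II w z) (II u b) + g (II u z) (II w b)
      - 2 * C (II u v) (II w z) (T b) + 2 * C (II w v) (II u z) (T b)
      + g (PM (T u) (T z) (II w v) - PM (T w) (T z) (II u v)) (T b)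
      + g (T (PS u z (Q w v) - PS w z (Q u v))) (T b)
      + g (T (covQ u w z - covQ w u z)) (T b)
      + g (T (dQ u z (Q w v) - dQ w z (Q u v))) (T b)
      + g (T (Q u (Q w z) - Q w (Q u z))) (T b)) /\
  (forall n : 'rV[R]_(k + l), (forall b : 'rV[R]_k, g n (T b) = 0) ->
    g (RM (T u) (T w) (T z)) n =
      g (covII u w z) n - g (covII w u z) n
      + g (II u (Q w z)) n - g (II w (Q u z)) n
      + g (dII w z (II u v)) n - g (dII u z (II w v)) n
      + g (PM (T u) (T z) (II w v)) n - g (PM (T w) (T z) (II u v)) n).
Proof.
have oA := pf_open HL; have acM := lcc_connection HM; have acS := lcc_connection HSc.
have oS a : open (timg (chart_at a) setT (sub_cone i A)) by exact: sub_cone_open.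
have [d [c [dp dom slice]]] := slice_charts HS p.
have cp := slice_dom dom dp.
pose r := (cmap d p, tco d p v).
have Ar : timg d setT (sub_cone i A) r := timg_coord dp hv.
move=> T g C RM RS PM PS II dII covII Q dQ covQ.
have tE a : tco c (i p) (T a) = inc (tco d p a) := tmapE dom slice a dp.
have zE : (cmap c (i p), tco c (i p) (T v)) = incpp r by rewrite (slice _ dp) tE.
have pE : base i d c p (T v) = tanp r := base_tmap dom slice v dp.
have ATv : A (i p) (T v) := hv.
have reg : regular A L d c (base i d c p (T v)) := regular_tmap HL Hnd dom slice dp hv.
have gE a b : g a b = metric L c (incpp r) (tco c (i p) a) (tco c (i p) b).
  by rewrite -zE; exact: fundamentalE cp.
have CE a b e : 2 * C a b e = 'L_(0, tco c (i p) e)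
    (fun s => metric L c s (tco c (i p) a) (tco c (i p) b)) (incpp r).
  by rewrite -zE; exact: cartanE cp.
have RME a b e : tco c (i p) (RM a b e) = curvature_coord (christoffel nablaM c) (incpp r)
    (tco c (i p) a) (tco c (i p) b) (tco c (i p) e).
  by rewrite -zE; exact: (curvatureE oA acM _ _ _ cp ATv).
have RSE a b e : tco d p (RS a b e) = curvature_coord (christoffel nablaS d) r
    (tco d p a) (tco d p b) (tco d p e).
  exact: (curvatureE oS acS _ _ _ dp hv).
have PME a b e : tco c (i p) (PM a b e) = 'L_(0, tco c (i p) e)
    (fun s => christoffel nablaM c s (tco c (i p) a) (tco c (i p) b)) (incpp r).
  by rewrite -zE; exact: (vertical_derivE oA acM _ _ _ cp ATv).
have PSE a b e : tco d p (PS a b e) = 'L_(0, tco d p e)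
    (fun s => christoffel nablaS d s (tco d p a) (tco d p b)) r.
  exact: (vertical_derivE oS acS _ _ _ dp hv).
have IIE a b : tco c (i p) (II a b) = sff L nablaM c (tanp r) (tco d p a) (tco d p b).
  by rewrite -pE; exact: (second_formE HL acM dom slice a b dp reg).
have dIIE a b e : tco c (i p) (dII a b e) = 'L_(0, tco c (i p) e)
    (fun s => sff L nablaM c s (tco d p a) (tco d p b)) (tanp r).
  by rewrite -pE; exact: (vderiv_second_formE HL acM dom slice a b e dp reg).
have QE a b : tco d p (Q a b) = dif L nablaM nablaS d c r (tco d p a) (tco d p b).
  exact: (differenceE HL Hnd acM acS dom slice a b dp hv).
have dQE a b e : tco d p (dQ a b e) = 'L_(0, tco d p e)
    (fun s => dif L nablaM nablaS d c s (tco d p a) (tco d p b)) r.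
  exact: (vderiv_differenceE HL Hnd acM acS oS dom slice a b e dp hv).
have covQE a b e := cov_differenceE HL Hnd acM acS oS dom slice a b e dp hv.
have covIIE a b e := cov_second_formE HL Hnd acM acS dom slice a b e dp hv.
cbv zeta in covQE, covIIE.
have {}covQE a b e : tco d p (covQ a b e) = _ := covQE a b e.
have {}covIIE a b e : tco c (i p) (covII a b e) =
    norc L c (tanp r) (normal_rate (christoffel nablaM c) (sff L nablaM c) r
      (tco d p a) (tco d p b) (tco d p e))
    - sff L nablaM c (tanp r) (christoffel nablaS d r (tco d p a) (tco d p b)) (tco d p e)
    - sff L nablaM c (tanp r) (tco d p b) (christoffel nablaS d r (tco d p a) (tco d p e))
  := covIIE a b e.
rewrite -/r in covQE.
(* Only the coordinate formulas are used from here on; opaque names keep rewriting from unfolding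
   the objects. *)
clearbody covQ dQ Q covII dII II PS PM RS RM C g T.
have lc := tcoord_linear cp; have ld := tcoord_linear dp.
have Az : timg c setT A (incpp r) by rewrite -zE; exact: timg_coord.
split=> [b|n Hn].
  have tE2 : tangential_curvature L nablaM nablaS d c r (tco d p u) (tco d p w) (tco d p z) =
      tco d p (RS u w z) + tco d p (PS u z (Q w v) - PS w z (Q u v))
      + tco d p (covQ u w z - covQ w u z) + tco d p (dQ u z (Q w v) - dQ w z (Q u v))
      + tco d p (Q u (Q w z) - Q w (Q u z)).
    by rewrite !(linB ld) RSE !PSE !covQE !dQE !QE.
  (* [cartan] differentiates along its last argument, here [T b]; by total symmetry the derivative
     is moved to the first argument, the value of [II] along which [gauss_coord] differentiates. *)
  have C2 x y a : 2 * C (II x v) (II y a) (T b) =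
      'L_(0, tco c (i p) (II x v)) (fun s => metric L c s (tco c (i p) (II y a)) (tco c (i p) (T b))) (incpp r).
    by rewrite CE; exact: (metric_cycle HL Az).
  rewrite !C2 !gE RME !tE (gauss_coord HL Hnd HM HSc oS dom slice Ar) tE2 (linB lc) !PME !tE !IIE.
  have gl := metric_linearl HL Az (inc (tco d p b)).
  rewrite !(linD inc_linear) !(linD gl).
  gen_lderive.
  by repeat match goal with |- context [metric ?L ?c ?xy ?x ?n] =>
    let y := fresh "y" in move: (metric L c xy x n) => y end; ring.
rewrite !gE RME !tE (codazzi_coord HL Hnd HM HSc oS dom slice Ar).
  rewrite !PME !dIIE !covIIE !IIE !QE !tE.
  gen_lderive.
  by repeat match goal with |- context [metric ?L ?c ?xy ?x ?n] =>
    let y := fresh "y" in move: (metric L c xy x n) => y end; ring.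
(* Normality of [n] is known against vectors [T b], and every row [x] gives the components of such a
   vector. *)
move=> x; have := Hn (tve d (cmap d p) x).
by rewrite gE tE (tvecK x dp).
Qed.
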